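(* Let $m\in\mathbb{R}$, $0\le\rho\le1$, $a\in S^m_{\rho,\rho}$, fix constants $0<c_1<c_2$ and a natural number $N_0>d$. Then there is $C$ such that for every $R\ge1$, every Schwartz function $f$ with $\operatorname{supp}\widehat f\subseteq\{\xi: c_1R\le|\xi|\le c_2R\}$ and every non-negative $w\in L^1_{\mathrm{loc}}(\mathbb{R}^d)$, $$\int_{\mathbb{R}^d}|T_af|^2w\le C\int_{\mathbb{R}^d}|f|^2\,\mathcal{A}_{\rho,m,R}w,$$ where $$\mathcal{A}_{\rho,m,R}w(x)=R^{2m}\int_{\mathbb{R}^d}\Big(\sup_{|y-z|\le R^{-\rho}}w(z)\Big)\frac{R^{\rho d}}{(1+R^{2\rho}|x-y|^2)^{N_0/2}}\,dy.$$
   Context: The Hörmander class $S^m_{\rho,\delta}$ is the set of $a\in C^\infty(\mathbb{R}^d\times\mathbb{R}^d)$ with $|\partial_x^\nu\partial_\xi^\sigma a(x,\xi)|\le C_{\nu,\sigma}(1+|\xi|)^{m-\rho|\sigma|+\delta|\nu|}$ for all multi-indices $\nu,\sigma$. For Schwartz $f$, $T_af(x)=\int e^{ix\cdot\xi}a(x,\xi)\widehat f(\xi)d\xi$. The constant $C$ is independent of $R$, $f$ and $w$. *)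

(* Defs.v *)
From HB Require Import structures.
From mathcomp Require Import all_boot all_order all_algebra.
From mathcomp Require Import all_classical all_reals all_analysis.
From mathcomp Require Import complex.
Set Implicit Arguments. Unset Strict Implicit. Unset Printing Implicit Defensive.
Import Order.TTheory GRing.Theory Num.Theory.
Import numFieldNormedType.Exports.
Local Open Scope classical_set_scope.
Local Open Scope ring_scope.

Definition dotv {R : realType} {d : nat} (x y : 'rV[R]_d) : R :=
  \sum_(i < d) x 0 i * y 0 i.
Definition enorm {R : realType} {d : nat} (x : 'rV[R]_d) : R :=
  Num.sqrt (dotv x x).

Definition cabs {R : realType} (z : R[i]) : R :=
  Num.sqrt (complex.Re z ^+ 2 + complex.Im z ^+ 2).
Definition expi {R : realType} (t : R) : R[i] := (cos t +i* sin t)%C.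

(* Lebesgue measure on R^d: the Caratheodory extension of the          *)
(* Lebesgue outer measure  inf { sum_k vol(Q_k) | A ⊆ ∪_k Q_k },       *)
(* Q_k half-open boxes.                                               *)
Definition box {R : realType} {d : nat} (a b : 'rV[R]_d) : set 'rV[R]_d :=
  [set x | forall i, a 0 i <= x 0 i < b 0 i].

Definition boxvol {R : realType} {d : nat} (a b : 'rV[R]_d) : R :=
  \prod_(i < d) Num.max (b 0 i - a 0 i) 0.

Definition vol0 {R : realType} {d : nat} (A : set 'rV[R]_d) : \bar R :=
  ereal_inf [set v : \bar R | (A = set0 /\ v = 0%E) \/
     exists a b : 'rV[R]_d, A = box a b /\ v = (boxvol a b)%:E].

(* carrier of R^d with all sets declared "elementary" (covers may use any
   set, but non-boxes have volume +oo, so only box covers count) *)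
Definition Rd (R : realType) (d : nat) := 'rV[R]_d.
HB.instance Definition _ (R : realType) (d : nat) :=
  Pointed.on (Rd R d).

Section RdSemiRing.
Variables (R : realType) (d : nat).
Let G : set (set (Rd R d)) := setT.
Lemma Rd_meas0 : G set0. Proof. by []. Qed.
Lemma Rd_measI : setI_closed G. Proof. by []. Qed.
Lemma Rd_measD : semi_setD_closed G.
Proof.
move=> A B _ _; exists [set A `\` B]; split.
- exact: finite_set1.
- by [].
- by rewrite bigcup_set1.
- exact: trivIset1.
Qed.
HB.instance Definition _ := @isSemiRingOfSets.Build default_measure_display
  (Rd R d) G Rd_meas0 Rd_measI Rd_measD.
End RdSemiRing.

Section LebesgueRd.
Variables (R : realType) (d : nat).
Local Open Scope ereal_scope.

Definition volRd : set (Rd R d) -> \bar R := @vol0 R d.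

Lemma vol0_ge0 (A : set (Rd R d)) : 0 <= volRd A.
Proof.
apply: le_ereal_inf_tmp => _ [[_ ->]//|[a [b [_ ->]]]].
rewrite lee_fin /boxvol; apply: prodr_ge0 => i _.
by rewrite le_max lexx orbT.
Qed.

Lemma vol0_set0 : volRd set0 = 0.
Proof.
apply/eqP; rewrite eq_le vol0_ge0 andbT.
by apply: ereal_inf_lbound; left.
Qed.

Definition leb_outer : set (Rd R d) -> \bar R := mu_ext volRd.

HB.instance Definition _ := isOuterMeasure.Build R (Rd R d) leb_outer
  (mu_ext0 vol0_set0 vol0_ge0) (mu_ext_ge0 vol0_ge0)
  (le_mu_ext volRd) (mu_ext_sigma_subadditive vol0_ge0).
End LebesgueRd.

Definition lebRd (R : realType) (d : nat) :
  set (caratheodory_type (@leb_outer R d)) -> \bar R := @leb_outer R d.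
HB.instance Definition _ (R : realType) (d : nat) :=
  isMeasure.Build _ _ _ (@lebRd R d)
    (caratheodory_measure0 (@leb_outer R d))
    (@caratheodory_measure_ge0 _ _ (@leb_outer R d))
    (@caratheodory_measure_sigma_additive _ _ (@leb_outer R d)).

Notation LebRd R d := (caratheodory_type (@leb_outer R d)).

Definition pdiff {R : realType} {n : nat} (i : 'I_n) (f : 'rV[R]_n -> R) :
  'rV[R]_n -> R := fun x => derive f x (delta_mx 0 i).
Definition pdiffs {R : realType} {n : nat} (s : seq 'I_n) (f : 'rV[R]_n -> R) :
  'rV[R]_n -> R := foldr pdiff f s.
Definition smooth {R : realType} {n : nat} (f : 'rV[R]_n -> R) : Prop :=
  forall (s : seq 'I_n) (x : 'rV[R]_n), differentiable (pdiffs s f) x.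

Definition cRe {R : realType} {T : Type} (f : T -> R[i]) : T -> R :=
  fun x => complex.Re (f x).
Definition cIm {R : realType} {T : Type} (f : T -> R[i]) : T -> R :=
  fun x => complex.Im (f x).
Definition csmooth {R : realType} {n : nat} (f : 'rV[R]_n -> R[i]) : Prop :=
  smooth (cRe f) /\ smooth (cIm f).
Definition cpdiffs {R : realType} {n : nat} (s : seq 'I_n)
  (f : 'rV[R]_n -> R[i]) : 'rV[R]_n -> R[i] :=
  fun x => (pdiffs s (cRe f) x +i* pdiffs s (cIm f) x)%C.

Definition msize {n : nat} (nu : 'I_n -> nat) : nat := (\sum_(i < n) nu i)%N.
Definition mseq {n : nat} (nu : 'I_n -> nat) : seq 'I_n :=
  flatten [seq nseq (nu i) i | i <- enum 'I_n].
Definition mono {R : realType} {n : nat} (x : 'rV[R]_n) (al : 'I_n -> nat) : R :=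
  \prod_(i < n) x 0 i ^+ al i.

Definition schwartz {R : realType} {d : nat} (f : 'rV[R]_d -> R[i]) : Prop :=
  csmooth f /\
  forall al be : 'I_d -> nat, exists C : R, forall x : 'rV[R]_d,
    `|mono x al| * cabs (cpdiffs (mseq be) f x) <= C.

Definition cint {R : realType} {d : nat} (f : 'rV[R]_d -> R[i]) : R[i] :=
  (Rintegral (@lebRd R d) setT (cRe f) +i* Rintegral (@lebRd R d) setT (cIm f))%C.

(* Fourier transform, normalised so that f = int e^{ix.xi} fhat(xi) dxi *)
Definition fourier {R : realType} {d : nat} (f : 'rV[R]_d -> R[i])
  (xi : 'rV[R]_d) : R[i] :=
  (((2 * pi) ^- d)%:C * cint (fun x => expi (- dotv x xi) * f x))%C.

Definition joint {R : realType} {d : nat} (a : 'rV[R]_d -> 'rV[R]_d -> R[i]) :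
  'rV[R]_(d + d) -> R[i] := fun z => a (lsubmx z) (rsubmx z).

Definition symb_deriv {R : realType} {d : nat}
  (a : 'rV[R]_d -> 'rV[R]_d -> R[i]) (nu sg : 'I_d -> nat)
  (x xi : 'rV[R]_d) : R[i] :=
  cpdiffs (map (lshift d) (mseq nu) ++ map (@rshift d d) (mseq sg))
    (joint a) (row_mx x xi).

Definition hormander {R : realType} {d : nat} (m rho delta : R)
  (a : 'rV[R]_d -> 'rV[R]_d -> R[i]) : Prop :=
  csmooth (joint a) /\
  forall nu sg : 'I_d -> nat, exists C : R, forall x xi : 'rV[R]_d,
    cabs (symb_deriv a nu sg x xi) <=
      C * (1 + enorm xi) `^ (m - rho * (msize sg)%:R + delta * (msize nu)%:R).

Definition psido {R : realType} {d : nat} (a : 'rV[R]_d -> 'rV[R]_d -> R[i])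
  (f : 'rV[R]_d -> R[i]) (x : 'rV[R]_d) : R[i] :=
  cint (fun xi => expi (dotv x xi) * a x xi * fourier f xi)%C.

Definition fourier_supp_annulus {R : realType} {d : nat}
  (f : 'rV[R]_d -> R[i]) (c1 c2 r : R) : Prop :=
  closure [set xi : 'rV[R]_d | fourier f xi != 0]
    `<=` [set xi | c1 * r <= enorm xi <= c2 * r].

Definition loc_integrable {R : realType} {d : nat} (w : 'rV[R]_d -> R) : Prop :=
  measurable_fun (setT : set (LebRd R d)) w /\
  forall K : set 'rV[R]_d, compact K ->
    (\int[@lebRd R d]_(x in K) `|w x|%:E < +oo)%E.

Definition ball_sup {R : realType} {d : nat} (w : 'rV[R]_d -> R) (r : R)
  (y : 'rV[R]_d) : \bar R :=
  ereal_sup [set (w z)%:E | z in [set z : 'rV[R]_d | enorm (y - z) <= r]].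

Definition Aop {R : realType} {d : nat} (rho m r : R) (N0 : nat)
  (w : 'rV[R]_d -> R) (x : 'rV[R]_d) : \bar R :=
  ((r `^ (2 * m))%:E *
   \int[@lebRd R d]_y (ball_sup w (r `^ (- rho)) y *
      (r `^ (rho * d%:R) /
        (1 + r `^ (2 * rho) * enorm (x - y) ^+ 2) `^ (N0%:R / 2))%:E))%E.

(* Main.v *)
(* Split space into cubes of side s = R^{-rho} / (d+1), in sup norm. On the
   frequency annulus the symbol, multiplied by a smooth cutoff, oscillates in x
   at scale s and in xi at scale 1/s, with size R^m. On one cube the operator is
   therefore bounded on L^2 by C R^m: expand the square over pairs of
   frequencies, integrate by parts d+1 times in x against a smooth bump and apply
   Schur's test. Commuting powers of (y_j - z_j)/s through the operator by
   integrating by parts in xi_j improves this to a weighted bound in which f is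
   damped away from the cube; this needs only pure derivatives of the symbol.
   Finally w is replaced by its supremum on each cube and the local bounds are
   averaged over all cube centres z by Tonelli. Everything is done for real and
   imaginary parts, with the phases cos (theta + al) in place of e^{i theta}. *)
Require Import Defs.
From HB Require Import structures.
From mathcomp Require Import all_boot all_order all_algebra.
From mathcomp Require Import all_classical all_reals all_analysis.
From mathcomp Require Import complex measurable_realfun.
From mathcomp Require Import ring lra.
Set Implicit Arguments. Unset Strict Implicit. Unset Printing Implicit Defensive.
Import Order.TTheory GRing.Theory Num.Theory.
Import numFieldNormedType.Exports.
Local Open Scope classical_set_scope.
Local Open Scope ring_scope.

(** * Lebesgue outer measure: half-spaces, affine maps, boxes *)

Section LebesgueRdBasics.
Variables (R : realType) (d : nat).
Local Notation L := (LebRd R d).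
Local Notation lam := (@lebRd R d).
Implicit Types (A B : set (Rd R d)) (x y z h : 'rV[R]_d).
Local Open Scope ereal_scope.

(** The exponent d+1 makes s^d / (1 + (s |xi - eta|)^(d+1)) integrable, with a bound independent of
    s; this is why no constant depends on R. The hypothesis rho <= 1 enters through R^(-1) <=
    R^(-rho): the cutoff to the annulus varies at scale R and is therefore also admissible at the
    finer scale R^rho. The denominator d+1 of s places a sup-norm cube of radius s inside the
    Euclidean ball of radius R^(-rho). In real form, squares must be summed over the phases 0 and
    -pi/2: only cos cos + sin sin depends on xi - eta alone. The L^2 norm of the truncated Fourier
    transform is controlled by the same bound as the operator, with symbol 1 and with space and
    frequency exchanged. A separate obstacle is measurability, because suprema of w stand inside the
    integrals. The averaging therefore uses open cubes, whose suprema are lower semicontinuous for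
    every w, and passes to closed balls only at the end, by inequalities between integrals of
    nonnegative functions that hold without measurability. *)

Lemma vol0_box_le (a b : 'rV[R]_d) : @volRd R d (box a b) <= (boxvol a b)%:E.
Proof. by apply: ereal_inf_lbound; right; exists a, b. Qed.

(** The plane x_i = [c] cuts a box into two boxes whose sides in direction [i] add up to the old
    side, the other sides being unchanged. A set that is neither a box nor empty has volume +oo. *)
Lemma vol0_halfspace (i : 'I_d) (c : R) (F : set (Rd R d)) :
  @volRd R d (F `&` [set x : Rd R d | (x ord0 i < c)%R]) +
  @volRd R d (F `&` ~` [set x : Rd R d | (x ord0 i < c)%R]) <= @volRd R d F.
Proof.
set H := [set x | _]; apply: le_ereal_inf_tmp => _ [[-> ->]|[a [b [-> ->]]]].
  by rewrite !set0I !vol0_set0 adde0.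
pose b' := (\row_k if k == i then Num.min (b ord0 i) c else b ord0 k)%R : 'rV[R]_d.
pose a' := (\row_k if k == i then Num.max (a ord0 i) c else a ord0 k)%R : 'rV[R]_d.
have -> : box a b `&` H = box a b'.
  apply/seteqP; split => x /=.
    move=> [xab xc] k; rewrite mxE; have /andP[xa xb] := xab k.
    rewrite xa /=; case: eqP => // ->.
    by rewrite lt_min xc andbT; have /andP[_] := xab i.
  move=> xab; split; last first.
    by have := xab i; rewrite mxE eqxx lt_min => /and3P[].
  move=> k; have := xab k; rewrite mxE; case: eqP => // ->.
  by rewrite lt_min => /and3P[-> ->].
have -> : box a b `&` ~` H = box a' b.
  apply/seteqP; split => x /=.
    move=> [xab xc] k; rewrite mxE; have /andP[xa xb] := xab k.
    rewrite xb andbT; case: eqP => // ?; subst k.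
    by rewrite ge_max xa /= leNgt; apply/negP.
  move=> xab; split.
    move=> k; have := xab k; rewrite mxE; case: eqP => // ->.
    by rewrite ge_max => /andP[/andP[-> _] ->].
  have := xab i; rewrite mxE eqxx ge_max => /andP[/andP[_ cx] _].
  by apply/negP; rewrite -leNgt.
apply: (le_trans (leeD (vol0_box_le _ _) (vol0_box_le _ _))).
rewrite -EFinD lee_fin /boxvol.
have E (u v : 'rV[R]_d) : (forall j, j != i -> u ord0 j = a ord0 j) ->
    (forall j, j != i -> v ord0 j = b ord0 j) ->
    (\prod_(j < d) Num.max (v ord0 j - u ord0 j) 0 =
     Num.max (v ord0 i - u ord0 i) 0 *
     \prod_(j < d | j != i) Num.max (b ord0 j - a ord0 j) 0)%R.
  move=> ua vb; rewrite (bigD1 i)//=; congr (_ * _)%R.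
  by apply: eq_bigr => j ji; rewrite ua ?vb.
rewrite (E a b')//; last by move=> j /negbTE ji; rewrite mxE ji.
rewrite (E a' b)//; last by move=> j /negbTE ji; rewrite mxE ji.
rewrite (E a b)// !mxE eqxx.
rewrite -mulrDl ler_wpM2r//.
  by apply: prodr_ge0 => j _; rewrite le_max lexx orbT.
move: (a ord0 i) (b ord0 i) => u v.
rewrite /Num.max /Num.min; do ![case: ifPn]; rewrite -?leNgt; lra.
Qed.

(** A cover of the test set, intersected with the half-space and with its complement, covers the two
    pieces at no greater total cost. *)
Lemma measurable_halfspace (i : 'I_d) (c : R) :
  measurable ([set x : L | (x ord0 i < c)%R] : set L).
Proof.
apply: le_caratheodory_measurable => X.
apply: le_ereal_inf_tmp => _ [F [_ XF] <-].
set H := [set x | _].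
apply: (@le_trans _ _ (\sum_(k <oo) @volRd R d (F k `&` H) +
                       \sum_(k <oo) @volRd R d (F k `&` ~` H))).
  apply: leeD; apply: ereal_inf_lbound.
    exists (fun k => F k `&` H) => //; split => //.
    by rewrite -setI_bigcupl; apply: setSI.
  exists (fun k => F k `&` ~` H) => //; split => //.
  by rewrite -setI_bigcupl; apply: setSI.
rewrite -nneseriesD; last 2 first.
- by move=> *; exact: vol0_ge0.
- by move=> *; exact: vol0_ge0.
apply: lee_nneseries => [*|k _].
  by apply: adde_ge0; exact: vol0_ge0.
exact: vol0_halfspace.
Qed.

Lemma measurable_coord (i : 'I_d) : measurable_fun setT (fun x : L => x ord0 i).
Proof.
apply: (measurability _ (RGenInftyO.measurableE R)) => _ [_ [c ->] <-].
rewrite setTI (_ : _ @^-1` _ = [set x : L | (x ord0 i < c)%R]).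
  exact: measurable_halfspace.
by apply/seteqP; split => x /=; rewrite in_itv.
Qed.

Lemma affine_image_box (r : R) (h a b : 'rV[R]_d) : (0 < r)%R ->
  (fun x => r *: x + h)%R @` box a b = box (r *: a + h)%R (r *: b + h)%R.
Proof.
move=> r0; apply/seteqP; split => [_ [x xab <-]|y yab].
  by move=> i; rewrite !mxE lerD2r ltrD2r ler_pM2l// ltr_pM2l.
exists (r^-1 *: (y - h))%R; last first.
  by rewrite scalerA mulfV ?gt_eqF// scale1r subrK.
move=> i; have := yab i; rewrite !mxE => /andP[u v].
rewrite mulrC ler_pdivlMr// ltr_pdivrMr// ![(_ * r)%R]mulrC.
by rewrite lerBrDr ltrBlDr u v.
Qed.

Lemma vol0_affine (r : R) (h : 'rV[R]_d) F : (0 < r)%R ->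
  @volRd R d ((fun x => r *: x + h)%R @` F) <= (r ^+ d)%:E * @volRd R d F.
Proof.
move=> r0; rewrite -lee_pdivrMl ?exprn_gt0//.
apply: le_ereal_inf_tmp => _ [[-> ->]|[a [b [-> ->]]]].
  by rewrite image_set0 vol0_set0 mule0.
rewrite affine_image_box// lee_pdivrMl ?exprn_gt0//.
apply: (le_trans (vol0_box_le _ _)); rewrite -EFinM lee_fin.
have -> : (r ^+ d = \prod_(i < d) r)%R by rewrite prodr_const card_ord.
rewrite /boxvol -big_split/=.
apply: ler_prod => i _; rewrite le_max lexx orbT/= (maxr_pMr _ _ (ltW r0)) mulr0 !mxE.
by rewrite opprD addrACA subrr addr0 -mulrBr.
Qed.

(** The opposite inequality follows by applying this one to the inverse map, as in [leb_outerD] and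
    [lebRd_cube]. *)
Lemma leb_outer_affine (r : R) (h : 'rV[R]_d) A : (0 < r)%R ->
  @leb_outer R d ((fun x => r *: x + h)%R @` A) <= (r ^+ d)%:E * @leb_outer R d A.
Proof.
move=> r0; rewrite -lee_pdivrMl ?exprn_gt0//.
apply: le_ereal_inf_tmp => _ [F [_ AF] <-].
rewrite lee_pdivrMl ?exprn_gt0//.
apply: (@le_trans _ _ (\sum_(k <oo) @volRd R d ((fun x => r *: x + h)%R @` F k))).
  apply: ereal_inf_lbound; exists (fun k => (fun x => r *: x + h)%R @` F k) => //.
  split => // _ [x Ax <-]; have [k _ Fk] := AF _ Ax.
  by exists k => //; exists x.
rewrite -nneseriesZl; last by move=> *; exact: vol0_ge0.
apply: lee_nneseries => [*|k _]; first exact: vol0_ge0.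
exact: vol0_affine.
Qed.

Lemma leb_outerD h A : @leb_outer R d ((fun x => x + h)%R @` A) = @leb_outer R d A.
Proof.
have le (k : 'rV[R]_d) B : @leb_outer R d ((fun x => x + k)%R @` B) <= @leb_outer R d B.
  have := leb_outer_affine k B ltr01; rewrite expr1n mul1e.
  by under eq_imagel do rewrite scale1r.
apply/eqP; rewrite eq_le le/=.
rewrite -{1}(_ : (fun x => x - h)%R @` ((fun x => x + h)%R @` A) = A) ?le//.
by rewrite image_comp/=; under eq_imagel do rewrite /= addrK; rewrite image_id.
Qed.

Lemma lebRd_box_le (a b : 'rV[R]_d) : lam (box a b) <= (boxvol a b)%:E.
Proof.
apply: le_trans (vol0_box_le a b); apply: ereal_inf_lbound => /=.
exists (fun k : nat => if k is 0%N then (box a b : set (Rd R d)) else set0).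
  by split => // x xab; exists 0%N.
rewrite nneseries_recl//; last by move=> *; exact: vol0_ge0.
rewrite eseries0 ?adde0// => -[]// k _ _; exact: vol0_set0.
Qed.

End LebesgueRdBasics.

(** * The sup norm and measurability of vector-valued maps *)

Section SupNorm.
Variables (R : realType) (n : nat).
Implicit Types x y : 'rV[R]_n.

Lemma coord_le_norm x i : `|x 0 i| <= `|x|.
Proof.
rewrite [leRHS]/Num.Def.normr /= mx_normrE.
by apply/bigmax_geP; right; exists (0, i).
Qed.

Lemma rV_norm_le x r : 0 <= r -> (forall i, `|x 0 i| <= r) -> `|x| <= r.
Proof.
move=> r0 xr; rewrite [leLHS]/Num.Def.normr /= mx_normrE.
by apply/bigmax_leP; split => //= -[j i] _; rewrite ord1.
Qed.

Lemma rV_norm_lt x r : 0 < r -> (forall i, `|x 0 i| < r) -> `|x| < r.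
Proof.
move=> r0 xr; rewrite [ltLHS]/Num.Def.normr /= mx_normrE.
by apply/bigmax_ltP; split => //= -[j i] _; rewrite ord1.
Qed.

Lemma rV_norm_attained x : x = 0 \/ exists i, `|x| = `|x 0 i|.
Proof.
have [->|x0] := eqVneq x 0; [by left|right].
have [|[j i] /= xi] := @mx_norm_neq0 _ _ _ x.
  by apply: contra_neq x0 => /mx_norm_eq0.
by exists i; rewrite {1}/Num.Def.normr/= xi ord1.
Qed.

Lemma rat_vector_dense x e : 0 < e ->
  exists q : 'rV[rat]_n, `|x - map_mx ratr q| < e.
Proof.
move=> e0.
have /choice[q qP] i : exists q, `|x 0 i - ratr q| < e.
  have [|q] := @rat_in_itvoo R (x 0 i - e) (x 0 i + e); first lra.
  by rewrite in_itv/= => /andP[? ?]; exists q; rewrite ltr_norml; lra.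
exists (\row_i q i); apply: rV_norm_lt => // i.
by rewrite !mxE; exact: qP.
Qed.

End SupNorm.

Section MeasurableVector.
Variables (R : realType) (n : nat) (d : measure_display) (T : measurableType d).
Variable h : T -> 'rV[R]_n.
Hypothesis mh : forall i, measurable_fun setT (fun t => h t 0 i).

Lemma measurable_preimage_cube z r : measurable [set t | `|h t - z| < r].
Proof.
have [r0|r0] := ltP 0 r; last first.
  rewrite (_ : mkset _ = set0)//; apply/seteqP; split => // t /=.
  by move/(le_lt_trans (normr_ge0 _))/lt_le_trans/(_ r0); rewrite ltxx.
rewrite (_ : mkset _ = \bigcap_(i in [set: 'I_n]) [set t | `|h t 0 i - z 0 i| < r]).
  apply: fin_bigcap_measurable => // i _.
  rewrite -[X in measurable X]setTI.
  rewrite (_ : mkset _ = (fun t => h t 0 i) @^-1` [set` `]z 0 i - r, z 0 i + r[]).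
    by apply: mh => //; exact: measurable_itv.
  by apply/seteqP; split => t /=; rewrite in_itv/= ltr_distl.
apply/seteqP; split => [t /= tz i _|t /= tz].
  by have := le_lt_trans (coord_le_norm (h t - z) i) tz; rewrite !mxE.
by apply: rV_norm_lt => // i; rewrite !mxE; exact: tz.
Qed.

(** Measurability on [LebRd] is Caratheodory's and is not defined through the topology, so open sets
    are reached through coordinates: an open set is the countable union of those cubes with rational
    centre and radius 1 / (k + 1) that it contains. *)
Lemma measurable_preimage_open (U : set 'rV[R]_n) :
  open U -> measurable (h @^-1` U).
Proof.
move=> oU.
pose F (p : 'rV[rat]_n * nat) : set T :=
  if `[< [set x : 'rV[R]_n | `|x - map_mx ratr p.1| < p.2.+1%:R^-1] `<=` U >]
  then [set t | `|h t - map_mx ratr p.1| < p.2.+1%:R^-1] else set0.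
rewrite (_ : _ @^-1` _ = \bigcup_p F p).
  apply: countable_bigcupT_measurable => // p.
  by rewrite /F; case: asboolP => // _; exact: measurable_preimage_cube.
apply/seteqP; split => [t Ut|t [p _]]; last first.
  by rewrite /F; case: asboolP => // pU /= tp; exact: pU.
have /nbhs_ballP[e /= e0 eU] : nbhs (h t) U by exact: open_nbhs_nbhs.
have e2 : 0 < e / 2 by lra.
have [k _ /(_ k (leqnn _)) ke] := near_infty_natSinv_lt (PosNum e2).
have {}ke : k.+1%:R^-1 < e / 2 := ke.
have [q hq] : exists q : 'rV[rat]_n, `|h t - map_mx ratr q| < k.+1%:R^-1.
  by apply: rat_vector_dense.
exists (q, k) => //; rewrite /F/=; case: asboolP => // -[] x /= xq.
apply: eU; rewrite -ball_normE /=.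
rewrite (_ : h t - x = (h t - map_mx ratr q) - (x - map_mx ratr q)); last first.
  by rewrite opprB addrA subrK.
apply: (le_lt_trans (ler_normB _ _)).
have := ltrD (lt_trans hq ke) (lt_trans xq ke); lra.
Qed.

Lemma measurable_fun_continuous_comp (F : 'rV[R]_n -> R) :
  continuous F -> measurable_fun setT (F \o h).
Proof.
move=> cF; apply: (measurability _ (RGenInftyO.measurableE R)) => _ [_ [c ->] <-].
rewrite setTI comp_preimage; apply: measurable_preimage_open.
have /continuousP := cF; apply.
rewrite (_ : mkset _ = [set x | x < c]); first exact: open_lt.
by apply/seteqP; split => x /=; rewrite in_itv.
Qed.

End MeasurableVector.

(** * Cubes, continuous functions, sigma-finiteness *)

Section LebesgueRdCont.
Variables (R : realType) (d : nat).
Local Notation L := (LebRd R d).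
Local Notation lam := (@lebRd R d).

Lemma measurable_cube (z : 'rV[R]_d) r :
  measurable ([set x : L | `|x - z| < r] : set L).
Proof. by apply: (@measurable_preimage_cube R d _ L id) => i; exact: measurable_coord. Qed.

Lemma continuous_measurable (F : 'rV[R]_d -> R) :
  continuous F -> measurable_fun setT (F : L -> R).
Proof.
by apply: (@measurable_fun_continuous_comp R d _ L id) => i; exact: measurable_coord.
Qed.

Lemma open_measurableRd (U : set 'rV[R]_d) : open U -> measurable (U : set L).
Proof. by apply: (@measurable_preimage_open R d _ L id) => i; exact: measurable_coord. Qed.

Local Open Scope ereal_scope.

Lemma lebRd_cube_le (z : 'rV[R]_d) r : (0 <= r)%R ->
  lam [set x | (`|x - z| < r)%R] <= ((r *+ 2) ^+ d)%:E.
Proof.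
move=> r0; pose e : 'rV[R]_d := const_mx r.
apply: (@le_trans _ _ (lam (box (z - e)%R (z + e)%R))).
  apply: le_outer_measure => x /= xz i; rewrite !mxE.
  have := le_lt_trans (coord_le_norm (x - z) i) xz; rewrite !mxE ltr_norml => /andP[? ?].
  by apply/andP; split; lra.
apply: le_trans (lebRd_box_le _ _) _; rewrite lee_fin /boxvol.
have -> : ((r *+ 2) ^+ d = \prod_(i < d) (r *+ 2))%R by rewrite prodr_const card_ord.
apply: ler_prod => i _; rewrite le_max lexx orbT/= !mxE ge_max.
by apply/andP; split; lra.
Qed.

(** The dilation and its inverse give the two inequalities. The volume of the unit cube remains an
    unspecified constant. *)
Lemma lebRd_cube (z : 'rV[R]_d) r : (0 < r)%R ->
  lam [set x | (`|x - z| < r)%R] = (r ^+ d)%:E * lam [set x | (`|x| < 1)%R].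
Proof.
move=> r0; apply/eqP; rewrite eq_le; apply/andP; split.
  rewrite (_ : [set x | _] = (fun x => r *: x + z)%R @` [set x | (`|x| < 1)%R]).
    exact: leb_outer_affine.
  apply/seteqP; split => [x /= xz|_ [x /= x1 <-]]; last first.
    by rewrite addrK normrZ gtr0_norm// -[ltRHS]mulr1 ltr_pM2l.
  exists (r^-1 *: (x - z))%R; last by rewrite scalerA mulfV ?gt_eqF// scale1r subrK.
  by rewrite /= normrZ gtr0_norm ?invr_gt0// mulrC ltr_pdivrMr// mul1r.
rewrite -lee_pdivlMl ?exprn_gt0// -exprVn.
rewrite (_ : [set x | (`|x| < 1)%R] =
    (fun x => r^-1 *: x - r^-1 *: z)%R @` [set x | (`|x - z| < r)%R]).
  by apply: leb_outer_affine; rewrite invr_gt0.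
apply/seteqP; split => [x /= x1|_ [x /= xz <-]].
  exists (r *: x + z)%R; last first.
    by rewrite scalerDr scalerA mulVf ?gt_eqF// scale1r addrK.
  by rewrite /= addrK normrZ gtr0_norm// -[ltRHS]mulr1 ltr_pM2l.
by rewrite -scalerBr normrZ gtr0_norm ?invr_gt0// mulrC ltr_pdivrMr// mul1r.
Qed.

Lemma lebRd_sigma_finite : sigma_finite setT lam.
Proof.
exists (fun k => [set x : L | (`|x - (0 : 'rV[R]_d)| < k.+1%:R)%R]); last first.
  move=> k; split; first exact: measurable_cube.
  by apply: le_lt_trans (lebRd_cube_le _ _) (ltry _).
apply/seteqP; split => // x _; exists (Num.truncn `|x : 'rV[R]_d|) => //=.
by rewrite subr0; exact: truncnS_gt.
Qed.

End LebesgueRdCont.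

HB.instance Definition _ (R : realType) (d : nat) :=
  Measure_isSigmaFinite.Build _ _ _ (@lebRd R d) (@lebRd_sigma_finite R d).

(** * Integrals of real functions and Fubini with a product majorant *)

Section GeneralIntegrals.
Context d (T : measurableType d) (R : realType) (mu : {measure set T -> \bar R}).

(** The integral of a nonnegative function is a supremum over the simple functions below it, hence
    monotone with no measurability assumption. This allows integrands containing [ball_sup], a
    supremum over uncountably many points. *)
Lemma ge0_le_integralW (f g : T -> \bar R) : (forall x, 0 <= f x)%E ->
  (forall x, f x <= g x)%E -> (\int[mu]_x f x <= \int[mu]_x g x)%E.
Proof.
move=> f0 fg; rewrite !ge0_integralTE//; last first.
  by move=> x; exact: le_trans (fg x).
apply: ge_ereal_sup => _ [h hf <-]; apply: ereal_sup_ubound.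
by exists h => // x; exact: le_trans (hf x) (fg x).
Qed.

Definition Rintegrable (f : T -> R) := mu.-integrable setT (EFin \o f).

Lemma Rintegrable_meas f : Rintegrable f -> measurable_fun setT f.
Proof. by move/integrableP => [/measurable_EFinP]. Qed.

Lemma le_Rintegrable (f g : T -> R) : measurable_fun setT f ->
  (forall x, `|f x| <= g x) -> Rintegrable g -> Rintegrable f.
Proof.
move=> mf fg; apply: le_integrable => //; first exact/measurable_EFinP.
by move=> x _ /=; rewrite lee_fin (le_trans (fg x))// ler_norm.
Qed.

Lemma RintegrableD f g : Rintegrable f -> Rintegrable g ->
  Rintegrable (fun x => f x + g x).
Proof. by move=> /(integrableD measurableT) h /h. Qed.

Lemma RintegrableB f g : Rintegrable f -> Rintegrable g ->
  Rintegrable (fun x => f x - g x).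
Proof. by move=> /(integrableB measurableT) h /h. Qed.

Lemma RintegrableZ k f : Rintegrable f -> Rintegrable (fun x => k * f x).
Proof. by move=> /(integrableZl measurableT k). Qed.

Lemma Rintegrable_norm f : Rintegrable f -> Rintegrable (fun x => `|f x|).
Proof. exact: integrable_norm. Qed.

Lemma EFin_Rintegral f : Rintegrable f ->
  ((\int[mu]_x f x)%:E = \int[mu]_x (f x)%:E)%E.
Proof. by move=> fi; rewrite fineK//; exact: integrable_fin_num. Qed.

Lemma normr_Rintegral_le (f g : T -> R) : measurable_fun setT f ->
  (forall x, `|f x| <= g x) -> Rintegrable g ->
  `|\int[mu]_x f x| <= \int[mu]_x g x.
Proof.
move=> mf fg gi; have fi := le_Rintegrable mf fg gi.
apply: (le_trans (le_normr_Rintegral measurableT fi)).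
by apply: le_Rintegral => //; exact: Rintegrable_norm.
Qed.

End GeneralIntegrals.

Section IteratedIntegrals.
Context d1 d2 (X : measurableType d1) (Y : measurableType d2) (R : realType).
Variables (m1 : {sigma_finite_measure set X -> \bar R})
          (m2 : {sigma_finite_measure set Y -> \bar R}).
Variable F : X -> Y -> R.
Hypothesis mF : measurable_fun setT (fun p : X * Y => F p.1 p.2).

(** The integral is a difference of two nonnegative ones, each measurable in the parameter by
    Tonelli's theorem. *)
Lemma measurable_Rintegral_param :
  measurable_fun setT (fun x => \int[m2]_y F x y).
Proof.
rewrite /Rintegral; apply: measurableT_comp; first exact: fine_measurable.
under eq_fun do rewrite integralE.
pose G := EFin \o (fun p : X * Y => F p.1 p.2).
have mG : measurable_fun setT G by exact/measurable_EFinP.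
apply: emeasurable_funB.
- rewrite (_ : (fun _ => _) = fubini_F m2 (G^\+)%E).
    exact: measurable_fun_fubini_tonelli_F (measurable_funepos mG) (funepos_ge0 _).
  by apply/funext => x; apply: eq_integral => y _; rewrite !funeposE.
- rewrite (_ : (fun _ => _) = fubini_F m2 (G^\-)%E).
    exact: measurable_fun_fubini_tonelli_F (measurable_funeneg mG) (funeneg_ge0 _).
  by apply/funext => x; apply: eq_integral => y _; rewrite !funenegE.
Qed.

Variables (g : X -> R) (h : Y -> R).
Hypotheses (gi : Rintegrable m1 g) (hi : Rintegrable m2 h).
Hypotheses (Fgh : forall x y, `|F x y| <= g x * h y).

Lemma Rintegrable_section x : Rintegrable m2 (F x).
Proof.
apply: (le_Rintegrable _ (Fgh x)); last exact: RintegrableZ.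
exact: (measurableT_comp mF (pair1_measurable x)).
Qed.

Lemma Rintegral_section_le x : `|\int[m2]_y F x y| <= g x * \int[m2]_y h y.
Proof.
rewrite -RintegralZl//; apply: normr_Rintegral_le => //; last exact: RintegrableZ.
exact: (measurableT_comp mF (pair1_measurable x)).
Qed.

Lemma Rintegrable_param : Rintegrable m1 (fun x => \int[m2]_y F x y).
Proof.
apply: (le_Rintegrable measurable_Rintegral_param Rintegral_section_le).
by under [X in _ _ X]eq_fun do rewrite mulrC; exact: RintegrableZ.
Qed.

(** The majorant [g x * h y] makes [F] integrable on the product space, so Fubini's theorem
    applies. *)
Lemma Rintegral_Fubini :
  \int[m1]_x \int[m2]_y F x y = \int[m2]_y \int[m1]_x F x y.
Proof.
have mF' : measurable_fun setT (fun p => (F p.1 p.2)%:E) by exact/measurable_EFinP.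
have iF : (m1 \x m2)%E.-integrable setT (fun p => (F p.1 p.2)%:E).
  apply/integrable12ltyP => //.
  apply: (@le_lt_trans _ _ (\int[m1]_x ((g x * \int[m2]_y h y)%R)%:E)%E).
    apply: ge0_le_integralW => x; first by apply: integral_ge0 => y _.
    rewrite -RintegralZl//= EFin_Rintegral; last exact: RintegrableZ.
    by apply: ge0_le_integralW => y //=; rewrite lee_fin.
  rewrite -EFin_Rintegral ?ltry//.
  by under [X in _ _ X]eq_fun do rewrite mulrC; exact: RintegrableZ.
rewrite {1 3}/Rintegral; congr fine.
transitivity (\int[m1]_x \int[m2]_y (F x y)%:E)%E.
  by apply: eq_integral => x _; rewrite EFin_Rintegral//; exact: Rintegrable_section.
rewrite (Fubini iF)/=; apply: eq_integral => y _.
rewrite EFin_Rintegral//; apply: (@le_Rintegrable _ _ _ _ _ (fun x => h y * g x)).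
- exact: (measurableT_comp mF (pair2_measurable y)).
- by move=> x; rewrite mulrC.
- exact: RintegrableZ.
Qed.

End IteratedIntegrals.

(** * Directional derivatives along lines *)

Section DirectionalDerivative.
Variables (R : realType) (V : normedModType R).
Implicit Types (F : V -> R) (x v : V).

Lemma is_derive_line F x v t l :
  is_derive (x + t *: v) v F l <-> is_derive t (1 : R) (fun u : R => F (x + u *: v)) l.
Proof.
have E : (fun h : R => h^-1 *: (F (h *: v + (x + t *: v)) - F (x + t *: v))) =
    (fun h : R => h^-1 *: (F (x + (h *: (1 : R) + t) *: v) - F (x + t *: v))).
  apply/funext => h; congr (_ *: (F _ - _)).
  by rewrite -[h *: (1 : R)]/(h * 1) mulr1 scalerDl addrCA.
split=> -[D1 D2]; split.
- by move: D1; rewrite /derivable/= E.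
- by move: D2; rewrite /derive/= E.
- by move: D1; rewrite /derivable/= -E.
- by move: D2; rewrite /derive/= -E.
Qed.

Lemma is_derive_line0 F x v l :
  is_derive x v F l <-> is_derive (0 : R) (1 : R) (fun u : R => F (x + u *: v)) l.
Proof. by rewrite -is_derive_line scale0r addr0. Qed.

Lemma is_derive_lip F F' v M : (forall x, is_derive x v F (F' x)) ->
  (forall x, `|F' x| <= M) -> forall x (t : R), 0 <= t ->
  `|F (x + t *: v) - F x| <= M * t.
Proof.
move=> dF F'M x t t0.
have dg (u : R) : is_derive u (1 : R) (fun u => F (x + u *: v)) (F' (x + u *: v)).
  exact/is_derive_line.
have [c _] : exists2 c, c \in `[0, t]%R &
    F (x + t *: v) - F (x + 0 *: v) = F' (x + c *: v) * (t - 0).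
  apply: (@MVT_segment R (fun u => F (x + u *: v)) (fun u => F' (x + u *: v))) => //.
  apply: continuous_subspaceT => u.
  by apply: differentiable_continuous; apply/derivable1_diffP; case: (dg u).
rewrite scale0r addr0 subr0 => ->.
by rewrite normrM (ger0_norm t0) ler_wpM2r.
Qed.

(** The increments 1 / (n + 1) turn the limit into that of a sequence, the form required by
    dominated convergence. *)
Lemma is_derive_quotient_cvg F x v l : is_derive x v F l ->
  (fun n : nat => n.+1%:R * (F (x + n.+1%:R^-1 *: v) - F x)) @ \oo --> l.
Proof.
move=> [D1 D2].
have : (fun h : R => h^-1 * (F (h *: v + x) - F x)) @ 0^' --> l.
  by rewrite -D2; exact: D1.
move/cvgr_dnbhsP/(_ (fun n : nat => n.+1%:R^-1)) => /= h.
have : (fun n : nat => n.+1%:R^-1^-1 * (F (n.+1%:R^-1 *: v + x) - F x)) @ \oo --> l.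
  by apply: h; split; [move=> n; rewrite invr_neq0|exact: cvg_harmonic].
by under eq_cvg do rewrite invrK [X in F X]addrC.
Qed.

End DirectionalDerivative.

(** * Translation invariance and the integral of a derivative *)

Section LebesgueRdIntegrals.
Variables (R : realType) (d : nat).
Local Notation L := (LebRd R d).
Local Notation lam := (@lebRd R d).
Implicit Types (f g : 'rV[R]_d -> R) (x z h : 'rV[R]_d).

(** The Caratheodory condition for the preimage is that of [A], tested on the translated set;
    [leb_outerD] identifies the outer measures. *)
Lemma measurable_shift h : measurable_fun setT (fun x : L => (x + h : L)).
Proof.
move=> _ A mA; rewrite setTI.
have {}mA : caratheodory_measurable (@leb_outer R d) A := mA.
suff : caratheodory_measurable (@leb_outer R d) ((fun x : L => (x + h : L)) @^-1` A) by [].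
move=> X.
have E Y : leb_outer (Y `&` (fun x : L => x + h) @^-1` A) =
    leb_outer ((fun x : Rd R d => x + h) @` Y `&` A).
  rewrite -[LHS](leb_outerD h); congr leb_outer.
  apply/seteqP; split => [_ [x [Yx Ax] <-]|_ [[x Yx <-] Ax]].
    by split => //; exists x.
  by exists x.
rewrite -[LHS](leb_outerD h) mA -E; congr (_ + _)%E.
rewrite -[RHS](leb_outerD h); congr leb_outer.
apply/seteqP; split => [_ [[x Yx <-] Ax]|_ [x [Yx Ax] <-]].
  by exists x.
by split => //; exists x.
Qed.

Lemma pushforward_shift h (A : set L) : pushforward lam (fun x : L => (x + h : L)) A = lam A.
Proof.
rewrite /pushforward /lebRd -[LHS](leb_outerD h); congr leb_outer.
apply/seteqP; split => [_ [x Ax <-]//|x Ax].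
by exists (x - h); rewrite /= subrK.
Qed.

Lemma integral_shiftE h (g : L -> \bar R) :
  (\int[lam]_x g x = \int[pushforward lam (fun x : L => ((x + h)%R : L))]_x g x)%E.
Proof.
by congr (integral _ _ _); apply/funext => A; rewrite pushforward_shift.
Qed.

Lemma Rintegrable_shift f h :
  Rintegrable lam f -> Rintegrable lam (fun x => f (x + h)).
Proof.
move=> fi.
have mf : measurable_fun setT (fun x : L => f (x + h)).
  apply: (@measurableT_comp _ _ _ _ _ _ (f : L -> R) _ (fun x : L => (x + h : L))).
    exact: Rintegrable_meas fi.
  exact: measurable_shift.
apply/integrableP; split; first exact/measurable_EFinP.
have /integrableP[_] := fi; apply: le_lt_trans.
have mfE : measurable_fun setT (fun x : L => `|(f x)%:E|%E).
  by apply: measurableT_comp; [exact: abse_measurable|apply/measurable_EFinP; exact: Rintegrable_meas fi].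
have f0 : {in setT, forall x : L, (0 <= `|(f x)%:E|)%E} by move=> x _; exact: abse_ge0.
rewrite [leRHS](integral_shiftE h).
by rewrite (ge0_integral_pushforward (@measurable_shift h) lam measurableT mfE f0) preimage_setT.
Qed.

Lemma Rintegral_shift f h : Rintegrable lam f ->
  \int[lam]_x f (x + h) = \int[lam]_x f x.
Proof.
move=> fi; rewrite /Rintegral; congr fine.
have mfE : measurable_fun setT (fun x : L => (f x)%:E).
  by apply/measurable_EFinP; exact: Rintegrable_meas fi.
rewrite [RHS](integral_shiftE h).
by rewrite (integral_pushforward (@measurable_shift h) mfE (Rintegrable_shift h fi) measurableT)
  preimage_setT.
Qed.

Lemma Rintegrable_cube z r M :
  Rintegrable lam (fun x : L => M * \1_[set x : L | `|x - z| < r] x).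
Proof.
apply: RintegrableZ.
have mA := @measurable_cube R d z r.
apply/integrableP; split; first by apply/measurable_EFinP; exact: measurable_indic.
under eq_integral do rewrite gee0_abs ?lee_fin//.
rewrite integral_indic// setIT.
have [r0|r0] := leP 0 r; first exact: le_lt_trans (lebRd_cube_le z r0) (ltry _).
rewrite (_ : mkset _ = set0) ?measure0//; apply/seteqP; split => // x /=.
by move/(le_lt_trans (normr_ge0 _)); rewrite ltNge (ltW r0).
Qed.

Lemma Rintegral_cube_le z r M : 0 <= r -> 0 <= M ->
  \int[lam]_x (M * \1_[set x : L | `|x - z| < r] x) <= M * (r *+ 2) ^+ d.
Proof.
move=> r0 M0; have := @Rintegrable_cube z r 1.
under eq_fun do rewrite mul1r; move=> i1.
rewrite RintegralZl// ler_wpM2l// -lee_fin EFin_Rintegral// integral_indic//.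
  by rewrite setIT; exact: lebRd_cube_le.
exact: measurable_cube.
Qed.

Lemma bounded_supp_Rintegrable f z r M : measurable_fun setT (f : L -> R) ->
  (forall x, `|f x| <= M) -> (forall x, ~ `|x - z| < r -> f x = 0) ->
  Rintegrable lam f.
Proof.
move=> mf fM f0; apply: (le_Rintegrable mf _ (Rintegrable_cube z r M)) => x.
have M0 := le_trans (normr_ge0 _) (fM x).
rewrite indicE; have [xz|xz] := boolP (x \in _); first by rewrite mulr1.
by rewrite mulr0 f0 ?normr0//; move/negP: xz; rewrite inE.
Qed.

Lemma bounded_supp_Rintegral_le f z r M : 0 <= r -> measurable_fun setT (f : L -> R) ->
  (forall x, `|f x| <= M) -> (forall x, ~ `|x - z| < r -> f x = 0) ->
  `|\int[lam]_x f x| <= M * (r *+ 2) ^+ d.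
Proof.
move=> r0 mf fM f0.
have M0 := le_trans (normr_ge0 _) (fM 0).
apply: le_trans (Rintegral_cube_le z r0 M0).
apply: normr_Rintegral_le (Rintegrable_cube z r M) => // x.
rewrite indicE; have [xz|xz] := boolP (x \in _); first by rewrite mulr1.
by rewrite mulr0 f0 ?normr0//; move/negP: xz; rewrite inE.
Qed.

(* By translation invariance the difference quotients have integral zero, and
   they converge dominatedly to the derivative. *)
Lemma Rintegral_derive_eq0 f f' v z r M : `|v| <= 1 ->
  continuous f -> continuous f' -> (forall x, is_derive x v f (f' x)) ->
  (forall x, `|f' x| <= M) -> (forall x, `|f x| <= M) ->
  (forall x, ~ `|x - z| < r -> f x = 0) -> \int[lam]_x f' x = 0.
Proof.
move=> v1 cf cf' df f'M fM f0.
have M0 := le_trans (normr_ge0 _) (fM 0).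
have mf := continuous_measurable cf.
have mf' := continuous_measurable cf'.
have fi : Rintegrable lam f by exact: bounded_supp_Rintegrable f0.
pose q (n : nat) x := n.+1%:R * (f (x + n.+1%:R^-1 *: v) - f x).
have shi n : Rintegrable lam (fun x => f (x + n.+1%:R^-1 *: v)) by exact: Rintegrable_shift.
have q0 n : \int[lam]_x q n x = 0.
  rewrite RintegralZl//; last exact: RintegrableB.
  by rewrite (RintegralB _ (shi n) fi)//= (Rintegral_shift _ fi) subrr mulr0.
have qi n : Rintegrable lam (q n).
  by apply: RintegrableZ; exact: RintegrableB.
have qc x : (q ^~ x) @ \oo --> f' x by exact: is_derive_quotient_cvg.
(* Since [|v| <= 1] and the increments are at most 1, all quotients vanish off the cube enlarged by
   1. On it the mean value theorem bounds them by [M]. *)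
have qle n x : `|q n x| <= M * \1_[set x : L | `|x - z| < r + 1] x.
  rewrite indicE; have [xz|/negP xz] := boolP (x \in _).
    rewrite mulr1 normrM normr_nat -ler_pdivlMl// mulrC.
    by apply: (is_derive_lip df) => //; rewrite invr_ge0.
  move: xz; rewrite inE/= => xz.
  rewrite mulr0 /q [f x]f0 ?subr0; last by move=> xr; apply: xz; lra.
  rewrite f0 ?mulr0 ?normr0// => xr; apply: xz.
  have -> : x - z = (x + n.+1%:R^-1 *: v - z) - n.+1%:R^-1 *: v.
    by rewrite addrAC addrK.
  apply: (le_lt_trans (ler_normB _ _)).
  suff : `|n.+1%:R^-1 *: v| <= 1 by lra.
  rewrite normrZ ger0_norm ?invr_ge0//.
  by rewrite mulr_ile1 ?invr_ge0// invf_le1 ?ler1n.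
have [] := @dominated_convergence _ L R lam setT measurableT
  (fun n x => (q n x)%:E) (EFin \o f') (fun x => (M * \1_[set x : L | `|x - z| < r + 1] x)%:E).
- by move=> n; apply/measurable_EFinP; exact: Rintegrable_meas (qi n).
- exact/measurable_EFinP.
- by apply/aeW => x _; apply: cvg_EFin; [exact: nearW|exact: qc].
- exact: Rintegrable_cube.
- by apply/aeW => x n _ /=; rewrite lee_fin.
move=> f'i _; rewrite (_ : [sequence _]_n = fun=> 0%E); last first.
  by apply/funext => n /=; rewrite -EFin_Rintegral// q0.
move=> /(cvg_unique (@ereal_hausdorff R) (cvg_cst _)) /= f'0.
by rewrite /Rintegral -[X in fine X]f'0.
Qed.

End LebesgueRdIntegrals.

(** * The decay kernel at frequency scale 1 / s *)

Section DecayKernel.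
Variables (R : realType) (d : nat).
Local Notation L := (LebRd R d).
Local Notation lam := (@lebRd R d).
Implicit Types x y : 'rV[R]_d.

(** The exponent exceeds the dimension, which gives integrability; the factor [s ^+ d] makes the
    integral bounded uniformly in [s]. *)
Definition kappa (s : R) x : R := s ^+ d / (1 + (s * `|x|) ^+ d.+1).

Lemma kappa_ge0 s x : 0 <= s -> 0 <= kappa s x.
Proof. by move=> s0; rewrite divr_ge0 ?exprn_ge0// addr_ge0 ?exprn_ge0 ?mulr_ge0. Qed.

Lemma kappaN s x : kappa s (- x) = kappa s x.
Proof. by rewrite /kappa normrN. Qed.

Lemma continuous_kappa s y : 0 <= s -> continuous (fun x => kappa s (x - y)).
Proof.
move=> s0 x.
have n0 : 1 + (s * `|x - y|) ^+ d.+1 != 0.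
  by rewrite gt_eqF// ltr_pwDl ?exprn_ge0 ?mulr_ge0.
have c1 (k : R) : (fun _ : 'rV[R]_d => k) @ x --> k.
  exact: (@cvg_cst _ k _ (nbhs x) _).
have cn : (fun x : 'rV[R]_d => s * `|x - y|) @ x --> s * `|x - y|.
  apply: (cvgM (c1 s)); apply: cvg_norm.
  exact: (cvgB cvg_id (@cvg_cst _ y _ (nbhs x) _)).
have cX : (fun x : 'rV[R]_d => (s * `|x - y|) ^+ d.+1) @ x --> (s * `|x - y|) ^+ d.+1.
  exact: (continuous_cvg _ (@exprn_continuous R d.+1 _) cn).
exact: (cvgM (c1 (s ^+ d)) (cvgV n0 (cvgD (c1 1) cX))).
Qed.

(** Take the least [k] with t < 2^k. Minimality gives 2^(k-1) <= t unless k = 0, where the left side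
    is at most 1. *)
Lemma dyadic_bound (n : nat) (t : R) : 0 <= t ->
  exists k : nat, t < 2 ^+ k /\
    (1 + t ^+ n.+1)^-1 <= 2 ^+ n.+1 * (2 ^+ k)^-1 ^+ n.+1.
Proof.
move=> t0.
have [k tk kmin] : exists2 k, t < 2 ^+ k & forall j, t < 2 ^+ j -> (k <= j)%N.
  have ex : exists k, t < 2 ^+ k :> R.
    exists (Num.truncn t).+1; apply: (lt_trans (truncnS_gt _)).
    by rewrite -natrX ltr_nat ltn_expl.
  by case: (ex_minnP ex) => k tk kmin; exists k.
exists k; split => //.
have t1 : 0 < 1 + t ^+ n.+1 by rewrite ltr_pwDl ?exprn_ge0.
rewrite -exprMn; case: k => [|k] in tk kmin *.
  rewrite expr0 invr1 mulr1; apply: (@le_trans _ _ 1).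
    by rewrite invf_le1// lerDl exprn_ge0.
  by rewrite exprn_ege1// ler1n.
have kt : 2 ^+ k <= t.
  by rewrite leNgt; apply/negP => /kmin; rewrite ltnn.
have -> : 2 * (2 ^+ k.+1)^-1 = (2 ^+ k)^-1 :> R.
  by rewrite (exprS 2 k) invfM mulrA mulfV// mul1r.
rewrite exprVn lef_pV2 ?posrE ?exprn_gt0//.
by rewrite (@le_trans _ _ (t ^+ n.+1)) ?lerDr// lerXn2r ?nnegrE ?exprn_ge0.
Qed.

(** The kernel lies below a weighted sum of indicators of the cubes of radius 2^k / s, whose
    integrals are 2^(d+1) 2^d 2^(-k) at most. Here 2^(d+1) comes from [dyadic_bound], 2^d from sides
    being twice the radius, and the last factor 2 is the geometric sum. *)
Lemma integral_kappa_le (s : R) y : 0 < s ->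
  (\int[lam]_x (kappa s (x - y))%:E <= (2 ^+ d.+1 * 2 ^+ d * 2)%:E)%E.
Proof.
move=> s0.
pose A k : set L := [set x : L | `|x - y| < 2 ^+ k / s].
pose c k : R := s ^+ d * (2 ^+ d.+1 * (2 ^+ k)^-1 ^+ d.+1).
have c0 k : 0 <= c k by rewrite !mulr_ge0// ?exprn_ge0 ?invr_ge0 ?exprn_ge0// ltW.
have s0' := ltW s0.
have m1 k : measurable_fun setT (fun x : L => (c k * \1_(A k) x)%:E).
  apply/measurable_EFinP; apply: measurable_funM; first exact: measurable_cst.
  by apply: measurable_indic; exact: measurable_cube.
have p1 k x : (0 <= (c k * \1_(A k) x)%:E)%E by rewrite lee_fin mulr_ge0.
apply: (@le_trans _ _ (\int[lam]_x \sum_(k <oo) (c k * \1_(A k) x)%:E)%E).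
  apply: ge0_le_integralW => x; first by rewrite lee_fin kappa_ge0.
  have [k [tk le]] := @dyadic_bound d (s * `|x - y|) (mulr_ge0 s0' (normr_ge0 _)).
  apply: (@le_trans _ _ (c k * \1_(A k) x)%:E).
    rewrite lee_fin indicE mem_set ?mulr1; last first.
      by rewrite /A/= ltr_pdivlMr// mulrC.
    by rewrite ler_wpM2l// exprn_ge0.
  rewrite (@nneseriesD1 _ _ k xpredT)//=.
  by rewrite leeDl// nneseries_ge0.
rewrite integral_nneseries//.
apply: (@le_trans _ _ (\sum_(k <oo) ((2 ^+ d.+1 * 2 ^+ d * 2) / (2 ^ k.+1)%:R)%:E)%E); last first.
  by apply: epsilon_trick0; rewrite !mulr_ge0// exprn_ge0.
apply: lee_nneseries => [k _ _|k _].
  by apply: integral_ge0 => x _; exact: p1.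
rewrite -EFin_Rintegral; last exact: Rintegrable_cube.
rewrite lee_fin; apply: le_trans (Rintegral_cube_le _ _ _) _ => //.
  by rewrite divr_ge0 ?exprn_ge0.
rewrite /c natrX -(mulr_natr (2 ^+ k / s)) (exprS 2 k).
have k2 : 2 ^+ k != 0 :> R by rewrite expf_neq0.
have : (2 ^+ k) ^+ d != 0 :> R by rewrite expf_neq0.
have : s ^+ d != 0 by rewrite expf_neq0// gt_eqF.
move: (2 ^+ k) k2 => p p0.
rewrite !exprMn !exprVn !exprS.
move: (s ^+ d) (p ^+ d) (2 ^+ d) => S P T S0 P0.
rewrite le_eqVlt; apply/orP; left; apply/eqP; field; apply/and3P; split => //.
Qed.

Lemma kappa_Rintegrable s y : 0 < s -> Rintegrable lam (fun x => kappa s (x - y)).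
Proof.
move=> s0; apply/integrableP; split.
  by apply/measurable_EFinP/continuous_measurable/continuous_kappa/ltW.
apply: le_lt_trans (ltry (2 ^+ d.+1 * 2 ^+ d * 2)); apply: le_trans (integral_kappa_le y s0).
apply: ge0_le_integralW => x; first exact: abse_ge0.
by rewrite /= ger0_norm// kappa_ge0// ltW.
Qed.

End DecayKernel.

(** * A piecewise polynomial step function *)

Section SmoothStep.
Variable R : realType.
Implicit Types (t a : R) (G H g h : R -> R) (p q : {poly R}).

Definition glue a G H t : R := if t <= a then G t else H t.

(** Away from [a] the glued function agrees locally with one piece. At [a] the quotients of both
    pieces have the same limit, and every quotient of the glued function is a quotient of one of
    them. *)
Lemma is_derive_glue a G H g h :
  (forall t, is_derive t (1 : R) G (g t)) -> (forall t, is_derive t (1 : R) H (h t)) ->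
  G a = H a -> g a = h a ->
  forall t, is_derive t (1 : R) (glue a G H) (glue a g h t).
Proof.
move=> dG dH GH gh t; rewrite {2}/glue; case: (ltgtP t a) => [ta|ta|->].
- apply: near_eq_is_derive (dG t).
  by near=> u; rewrite /glue ltW//; near: u; exact: lt_nbhsl.
- apply: near_eq_is_derive (dH t).
  by near=> u; rewrite /glue leNgt; have -> : a < u by near: u; exact: lt_nbhsr.
have cG : (fun u : R => u^-1 *: ((G \o shift a) (u *: (1 : R)) - G a)) @ 0^' --> g a.
  by case: (dG a) => D1 <-; exact: D1.
have cH : (fun u : R => u^-1 *: ((H \o shift a) (u *: (1 : R)) - H a)) @ 0^' --> g a.
  by rewrite gh; case: (dH a) => D1 <-; exact: D1.
suff cF : (fun u : R => u^-1 *: ((glue a G H \o shift a) (u *: (1 : R)) - glue a G H a)) @ 0^'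
    --> g a.
  by split; [apply/cvg_ex; exists (g a)|exact: cvg_lim cF].
move=> A lA; have GA := cG A lA; have HA := cH A lA.
suff : \forall u \near (0 : R)^', A (u^-1 * (glue a G H (u * 1 + a) - glue a G H a)) by [].
near=> u; rewrite mulr1; have [u0|u0] := leP u 0.
  have : A (u^-1 * (G (u * 1 + a) - G a)) by near: u; exact: GA.
  by rewrite /glue lexx gerDr u0 mulr1.
have : A (u^-1 * (H (u * 1 + a) - H a)) by near: u; exact: HA.
by rewrite /glue lexx leNgt ltrDr u0 /= GH mulr1.
Unshelve. all: by end_near. Qed.

(** One differentiation leaves a factor [('X - c%:P) ^+ m] out of the power [m.+1], so the induction
    on [k] keeps [m] and [q] free. *)
Lemma derivn_root_XsubC_exp (c : R) m q k : (k < m)%N ->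
  (('X - c%:P) ^+ m * q)^`(k).[c] = 0.
Proof.
elim: k m q => [|k IH] [//|m] q km.
  by rewrite derivn0 hornerM horner_exp !hornerE subrr expr0n mul0r.
rewrite derivSn derivM deriv_exp derivXsubC mul1r/=.
have -> : ('X - c%:P) ^+ m *+ m.+1 * q + ('X - c%:P) ^+ m.+1 * q^`() =
    ('X - c%:P) ^+ m * (q *+ m.+1 + ('X - c%:P) * q^`()).
  by move: ('X - c%:P) => p; rewrite exprSr mulrDr -mulrA mulrnAl mulrnAr.
exact: IH.
Qed.

(* Equal to 0 to order M at 0 and to 1 to order M at 1. *)
Definition step_poly M : {poly R} := 1 - (1 - 'X ^+ M) ^+ M.

(** The polynomial is divisible by 'X^M (geometric sum in 1 - 'X^M), and its difference from 1 is
    divisible by ('X - 1)^M. *)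
Lemma step_poly_flat M (c : R) k : c = 0 \/ c = 1 -> (0 < k < M)%N ->
  (step_poly M)^`(k).[c] = 0.
Proof.
move=> c01 /andP[k0 kM].
have dC (a : R) : (a%:P)^`(k) = 0 by case: k k0 {kM} => // k _; rewrite derivnC.
case: c01 => ->.
- suff [q ->] : exists q, step_poly M = ('X - 0%:P) ^+ M * q.
    exact: derivn_root_XsubC_exp.
  rewrite subr0 /step_poly; exists (\sum_(i < M) (1 - 'X ^+ M) ^+ i).
  have := subrX1 (1 - 'X ^+ M : {poly R}) M.
  rewrite addrAC subrr add0r => /(congr1 -%R).
  by rewrite opprB mulNr opprK.
- suff [q qE] : exists q, (1 - 'X ^+ M) ^+ M = ('X - 1%:P) ^+ M * q :> {poly R}.
    rewrite /step_poly derivnB hornerD qE -[1]/(1%:P) dC horner0 add0r hornerN.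
    by rewrite derivn_root_XsubC_exp// oppr0.
  exists ((- \sum_(i < M) 'X ^+ i) ^+ M); rewrite -exprMn; congr (_ ^+ M).
  by rewrite mulrN -subrX1 opprB.
Qed.

Lemma step_poly0 M : (0 < M)%N -> (step_poly M).[0] = 0.
Proof.
by move=> M0; rewrite /step_poly !hornerE expr0n gtn_eqF// subr0 expr1n subrr.
Qed.

Lemma step_poly1 M : (0 < M)%N -> (step_poly M).[1] = 1.
Proof.
by move=> M0; rewrite /step_poly !hornerE expr1n subrr expr0n gtn_eqF// subr0.
Qed.

Lemma step_poly_itv M t : 0 <= t <= 1 -> 0 <= (step_poly M).[t] <= 1.
Proof.
move=> /andP[t0 t1]; rewrite /step_poly !hornerE.
have tM : 0 <= t ^+ M <= 1 by rewrite exprn_ge0// exprn_ile1.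
have : 0 <= (1 - t ^+ M) ^+ M <= 1 by rewrite exprn_ge0 ?exprn_ile1//; lra.
lra.
Qed.

(** The index [k] is the order of the derivative. Every later estimate uses finitely many
    derivatives, so finite smoothness of order governed by [M] is enough. For 0 < k < M both outer
    constants are 0 by [step_poly_flat]. *)
Definition step M k t : R :=
  glue 1 (glue 0 (cst (step_poly M)^`(k).[0]) (horner (step_poly M)^`(k)))
         (cst (step_poly M)^`(k).[1]) t.

Lemma is_derive_step M k t : (k.+1 < M)%N ->
  is_derive t (1 : R) (step M k) (step M k.+1 t).
Proof.
move=> kM; have f0 := @step_poly_flat M 0 k.+1 (or_introl erefl) kM.
have f1 := @step_poly_flat M 1 k.+1 (or_intror erefl) kM.
have d0 (c : R) u : (step_poly M)^`(k.+1).[c] = 0 ->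
    is_derive u (1 : R) (cst (step_poly M)^`(k).[c]) (cst (step_poly M)^`(k.+1).[c] u).
  by move=> ->; exact: is_derive_cst.
have dp u : is_derive u (1 : R) (horner (step_poly M)^`(k)) (step_poly M)^`(k.+1).[u].
  exact: is_derive_poly.
have dg u := is_derive_glue (fun u => d0 _ u f0) dp erefl erefl u.
apply: (is_derive_glue dg (fun u => d0 _ u f1)); by rewrite /glue ler10.
Qed.

Lemma step_itvE M k t : exists2 u, 0 <= u <= 1 & step M k t = (step_poly M)^`(k).[u].
Proof.
rewrite /step /glue; case: (leP t 1) => t1; last by exists 1 => //; rewrite ler01 lexx.
case: (leP t 0) => t0; last by exists t => //; rewrite t1 ltW.
by exists 0 => //; rewrite ler01 lexx.
Qed.

Lemma step_bounded M k : exists2 B, 0 <= B & forall t, `|step M k t| <= B.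
Proof.
exists (\sum_(i < size (step_poly M)^`(k)) `|((step_poly M)^`(k))`_i|).
  by apply: sumr_ge0.
move=> t; have [u /andP[u0 u1] ->] := step_itvE M k t.
rewrite horner_coef; apply: (le_trans (ler_norm_sum _ _ _)).
apply: ler_sum => i _; rewrite normrM ler_piMr//.
by rewrite normrX ger0_norm// exprn_ile1.
Qed.

Lemma step_le0 M k t : (k < M)%N -> t <= 0 -> step M k t = 0.
Proof.
move=> kM t0; rewrite /step /glue t0 (le_trans t0 ler01)/=.
by case: k kM => [|k] kM; [exact: step_poly0|apply: step_poly_flat; [left|]].
Qed.

Lemma step_ge1 M t : (0 < M)%N -> 1 <= t -> step M 0 t = 1.
Proof.
move=> M0 t1; rewrite /step /glue; case: (leP t 1) => t1'; last exact: step_poly1.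
have -> : t = 1 by lra.
by rewrite ler10 step_poly1.
Qed.

Lemma step_itv M t : 0 <= step M 0 t <= 1.
Proof. by have [u u01 ->] := step_itvE M 0 t; exact: step_poly_itv. Qed.

End SmoothStep.

(** * Functions with bounded pure derivatives at a given scale *)

Section DerivativeClass.
Variables (R : realType) (d : nat).
Local Notation V := 'rV[R]_d.
Implicit Types (F G : V -> R) (S T : set V) (x z : V) (j : 'I_d).

Definition evec j : V := delta_mx 0 j.

(* Functions vanishing off [S] whose first [n] derivatives in direction [j],
   each divided by [sg], are continuous and bounded by [A]. *)
Fixpoint dcl (sg : R) j (n : nat) (A : R) S F : Prop :=
  [/\ continuous F, forall x, `|F x| <= A, forall x, ~ S x -> F x = 0 &
   if n is n'.+1 then
     exists F', (forall x, is_derive x (evec j) F (sg * F' x)) /\ dcl sg j n' A S F'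
   else True].

Lemma dcl_base sg j n A S F : dcl sg j n A S F ->
  [/\ continuous F, forall x, `|F x| <= A & forall x, ~ S x -> F x = 0].
Proof. by case: n => [|n] [? ? ? _]. Qed.

Lemma dcl_ge0 sg j n A S F : dcl sg j n A S F -> 0 <= A.
Proof. by case/dcl_base => _ /(_ 0) + _; exact: le_trans. Qed.

Lemma dclW sg j n A S F : dcl sg j n.+1 A S F -> dcl sg j n A S F.
Proof.
elim: n F => [|n IH] F [cF FA FS [F' [dF F'n]]]; first by split.
by split => //; exists F'; split => //; exact: IH.
Qed.

Lemma le_dcl sg j n A B S T F : A <= B -> S `<=` T ->
  dcl sg j n A S F -> dcl sg j n B T F.
Proof.
move=> AB ST; elim: n F => [|n IH] F [cF FA FS F'n]; split => //.
- by move=> x; exact: le_trans AB.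
- by move=> x Tx; apply: FS => /ST.
- by move=> x; exact: le_trans AB.
- by move=> x Tx; apply: FS => /ST.
- by case: F'n => F' [dF F'n]; exists F'; split => //; exact: IH.
Qed.

Lemma dclD sg j n A B S F G : dcl sg j n A S F -> dcl sg j n B S G ->
  dcl sg j n (A + B) S (fun x => F x + G x).
Proof.
elim: n F G => [|n IH] F G [cF FA FS F'n] [cG GB GS G'n]; split => //.
- by move=> x; exact: (cvgD (cF x) (cG x)).
- by move=> x; apply: le_trans (ler_normD _ _) _; rewrite lerD.
- by move=> x Sx; rewrite FS// GS// addr0.
- by move=> x; exact: (cvgD (cF x) (cG x)).
- by move=> x; apply: le_trans (ler_normD _ _) _; rewrite lerD.
- by move=> x Sx; rewrite FS// GS// addr0.
- case: F'n => F' [dF F'n]; case: G'n => G' [dG G'n].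
  exists (fun x => F' x + G' x); split; last exact: IH.
  by move=> x; rewrite mulrDr; exact: is_deriveD.
Qed.

(** By Leibniz' rule each differentiation replaces a product by a sum of two products, whence the
    factor 2^n. *)
Lemma dclM sg j n A B S T F G : dcl sg j n A S F -> dcl sg j n B T G ->
  dcl sg j n (2 ^+ n * (A * B)) (S `&` T) (fun x => F x * G x).
Proof.
elim: n F G => [|n IH] F G Fn Gn; have [cF FA FS] := dcl_base Fn;
  have [cG GB GS] := dcl_base Gn;
  have A0 := dcl_ge0 Fn; have B0 := dcl_ge0 Gn.
all: have cFG : continuous (fun x => F x * G x)
  by move=> x; exact: (cvgM (cF x) (cG x)).
all: have FGS x : ~ (S `&` T) x -> F x * G x = 0
  by move=> /not_andP[Sx|Tx]; [rewrite FS// mul0r|rewrite GS// mulr0].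
all: have FGB x : `|F x * G x| <= A * B by rewrite normrM ler_pM.
  by split => // x; rewrite mul1r.
split => //.
  move=> x; apply: le_trans (FGB x) _; rewrite ler_peMl ?mulr_ge0//.
  by rewrite exprn_ege1// ler1n.
have Fn' := dclW Fn; have Gn' := dclW Gn.
case: Fn => _ _ _ [F' [dF F'n]]; case: Gn => _ _ _ [G' [dG G'n]].
exists (fun x => F' x * G x + F x * G' x); split; last first.
  rewrite (_ : 2 ^+ n.+1 * _ = 2 ^+ n * (A * B) + 2 ^+ n * (A * B)).
    by apply: dclD; exact: IH.
  by rewrite exprS; ring.
move=> x; have := is_deriveM (dF x) (dG x).
rewrite (_ : _ *: _ + _ = sg * (F' x * G x + F x * G' x))//.
rewrite -[F x *: (sg * G' x)]/(F x * (sg * G' x)).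
by rewrite -[G x *: (sg * F' x)]/(G x * (sg * F' x)); ring.
Qed.

Lemma dcl_cst sg j n c : dcl sg j n `|c| setT (fun=> c).
Proof.
have cc (k : R) : continuous (fun _ : V => k) by move=> x; exact: (@cvg_cst _ k _ (nbhs x) _).
have d0 x (k : R) : is_derive x (evec j) (fun=> k) (sg * 0).
  by rewrite mulr0; exact: is_derive_cst.
have z m : dcl sg j m `|c| setT (fun=> 0).
  have z0 (x : V) : `|0 : R| <= `|c| by rewrite normr0.
  elim: m => [|m IH]; first by split => //; exact: cc.
  by split => //; exists (fun=> 0).
have Tc (x : V) : ~ setT x -> c = 0 by case.
case: n => [|n]; first by split => //; exact: cc.
by split => //; exists (fun=> 0).
Qed.

(** The clauses on [F] itself are repeated outside [dcl] because for d = 0 there is no direction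
    [j]. *)
Definition dcls sg n A S F := [/\ continuous F, forall x, `|F x| <= A,
  forall x, ~ S x -> F x = 0 & forall j, dcl sg j n A S F].

Lemma dcls_ge0 sg n A S F : dcls sg n A S F -> 0 <= A.
Proof. by case=> _ /(_ 0) + _ _; exact: le_trans. Qed.

Lemma le_dcls sg n A B S T F : A <= B -> S `<=` T ->
  dcls sg n A S F -> dcls sg n B T F.
Proof.
move=> AB ST [cF FA FS Fj]; split => //.
- by move=> x; exact: le_trans AB.
- by move=> x Tx; apply: FS => /ST.
- by move=> j; exact: le_dcl (Fj j).
Qed.

Lemma dclsD sg n A B S F G : dcls sg n A S F -> dcls sg n B S G ->
  dcls sg n (A + B) S (fun x => F x + G x).
Proof.
move=> [cF FA FS Fj] [cG GB GS Gj]; split => //.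
- by move=> x; exact: (cvgD (cF x) (cG x)).
- by move=> x; apply: le_trans (ler_normD _ _) _; rewrite lerD.
- by move=> x Sx; rewrite FS// GS// addr0.
- by move=> j; exact: dclD.
Qed.

Lemma dclsM sg n A B S T F G : dcls sg n A S F -> dcls sg n B T G ->
  dcls sg n (2 ^+ n * (A * B)) (S `&` T) (fun x => F x * G x).
Proof.
move=> Fn Gn; have A0 := dcls_ge0 Fn; have B0 := dcls_ge0 Gn.
case: Fn Gn => [cF FA FS Fj] [cG GB GS Gj]; split => //.
- by move=> x; exact: (cvgM (cF x) (cG x)).
- move=> x; apply: (@le_trans _ _ (A * B)); first by rewrite normrM ler_pM.
  by rewrite ler_peMl ?mulr_ge0// exprn_ege1// ler1n.
- by move=> x /not_andP[Sx|Tx]; [rewrite FS// mul0r|rewrite GS// mulr0].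
- by move=> j; exact: dclM.
Qed.

Lemma dcls_cst sg n c : dcls sg n `|c| setT (fun=> c).
Proof.
split.
- by move=> x; exact: (@cvg_cst _ c _ (nbhs x) _).
- by [].
- by move=> x [].
- by move=> j; exact: dcl_cst.
Qed.

Lemma dclsZ sg n c A S F : dcls sg n A S F ->
  dcls sg n (2 ^+ n * (`|c| * A)) S (fun x => c * F x).
Proof.
move=> Fn; by apply: le_dcls (dclsM (dcls_cst sg n c) Fn) => // x [].
Qed.

Lemma dcls_prod sg n B (I : eqType) (r : seq I) (S : I -> set V) (F : I -> V -> R) :
  (forall i, dcls sg n B (S i) (F i)) ->
  dcls sg n ((2 ^+ n * B) ^+ size r) [set x | forall i, i \in r -> S i x]
    (fun x => \prod_(i <- r) F i x).
Proof.
move=> FB; elim: r => [|i r IH].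
  rewrite (_ : (fun x => \prod_(k <- [::]) F k x) = fun=> 1); last first.
    by apply/funext => x; rewrite big_nil.
  rewrite /= expr0 -[X in dcls _ _ X](normr1 R).
  by apply: le_dcls (dcls_cst _ _ _) => // x _ i.
rewrite (_ : (fun x => \prod_(k <- i :: r) F k x) =
    fun x => F i x * \prod_(k <- r) F k x); last first.
  by apply/funext => x; rewrite big_cons.
rewrite /= exprS -mulrA; apply: le_dcls (dclsM (FB i) IH) => //.
move=> x [Sx Srx] k; rewrite inE => /predU1P[->//|]; exact: Srx.
Qed.

End DerivativeClass.

(** * Bump functions adapted to cubes *)

Section Bump.
Variables (R : realType) (d : nat).
Local Notation V := 'rV[R]_d.
Implicit Types (x z : V) (i j : 'I_d).

Lemma is_derive_affine (a b t : R) : is_derive t (1 : R) (fun u : R => a + b * u) b.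
Proof.
have := is_deriveD (is_derive_cst a t (1 : R)) (is_deriveZ b (is_derive_id t (1 : R))).
by rewrite add0r -[b *: _]/(b * 1) mulr1.
Qed.

(** For [e] = 1 or -1 the argument is at least 1 if |x_i - z_i| <= s, and at most 0 once x_i lies 2s
    or more beyond z_i in the direction -e. The two signs together cut off on both sides. *)
Definition ramp M k (e s : R) i z x : R := step M k (2 + e * ((x 0 i - z 0 i) / s)).

Lemma continuous_ramp M k e s i z : (k.+1 < M)%N -> continuous (ramp M k e s i z).
Proof.
move=> kM x.
have c1 (a : R) : (fun _ : V => a) @ x --> a by exact: (@cvg_cst _ a _ (nbhs x) _).
have cin : (fun x : V => 2 + e * ((x 0 i - z 0 i) / s)) @ x --> 2 + e * ((x 0 i - z 0 i) / s).
  exact: (cvgD (c1 2) (cvgM (c1 e)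
    (cvgM (cvgB (@coord_continuous _ _ _ 0 i x) (c1 (z 0 i))) (c1 s^-1)))).
have cst : {for 2 + e * ((x 0 i - z 0 i) / s), continuous (@step R M k)}.
  apply: differentiable_continuous; apply/derivable1_diffP.
  by case: (is_derive_step (2 + e * ((x 0 i - z 0 i) / s)) kM).
exact: (continuous_cvg _ cst cin).
Qed.

Lemma is_derive_ramp M k e s i j z x : (k.+1 < M)%N ->
  is_derive x (evec R j) (ramp M k e s i z)
    (s^-1 * ((e * (i == j)%:R) * ramp M k.+1 e s i z x)).
Proof.
move=> kM; apply/is_derive_line0.
pose a := 2 + e * ((x 0 i - z 0 i) / s); pose b := e * ((i == j)%:R / s).
have -> : (fun u : R => ramp M k e s i z (x + u *: evec R j)) =
    step M k \o (fun u => a + b * u).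
  apply/funext => u; rewrite /ramp /= !mxE /=; congr step.
  by rewrite /a /b; ring.
have := @is_derive1_comp R (step M k) (fun u => a + b * u) 0 _ _
  (is_derive_step (a + b * 0) kM) (is_derive_affine a b 0).
by rewrite mulr0 addr0 (_ : _ * b = s^-1 * (e * (i == j)%:R * ramp M k.+1 e s i z x))// /ramp -/a /b; ring.
Qed.

(** The factor [c] makes the induction close: each differentiation multiplies it by
    [e * (i == j)%:R], again of modulus at most 1. *)
Lemma dcl_ramp M (B : R) k n (c e s : R) i j z :
  (forall l t, (l < M)%N -> `|step M l t| <= B) ->
  `|c| <= 1 -> `|e| <= 1 -> (k + n.+1 < M)%N ->
  dcl s^-1 j n B [set x | 0 < 2 + e * ((x 0 i - z 0 i) / s)]
    (fun x => c * ramp M k e s i z x).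
Proof.
move=> stB + e1; elim: n k c => [|n IH] k c c1 kM.
all: have kM' : (k.+1 < M)%N by apply: leq_trans kM; rewrite ltnS addnS ltnS leq_addr.
all: have cr : continuous (fun x => c * ramp M k e s i z x)
  by move=> x; exact: (cvgM (@cvg_cst _ c _ (nbhs x) _) (@continuous_ramp M k e s i z kM' x)).
all: have br x : `|c * ramp M k e s i z x| <= B
  by rewrite normrM -[leRHS]mul1r ler_pM// stB// ltnW.
all: have sr x : ~ 0 < 2 + e * ((x 0 i - z 0 i) / s) -> c * ramp M k e s i z x = 0
  by move/negP; rewrite -leNgt => le0; rewrite /ramp step_le0 ?mulr0// ltnW.
  by split.
split => //; exists (fun x => (c * (e * (i == j)%:R)) * ramp M k.+1 e s i z x); split.
  move=> x; apply: (is_derive_eq (is_deriveZ c (is_derive_ramp e s i j z x kM'))).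
  by rewrite -[LHS]/(c * (s^-1 * (e * (i == j)%:R * ramp M k.+1 e s i z x))); ring.
apply: IH; last by rewrite addSnnS.
rewrite !normrM; apply: mulr_ile1 => //; apply: mulr_ile1 => //.
by case: eqP => _; rewrite ?normr1 ?normr0.
Qed.

Definition bump M (s : R) z x : R :=
  \prod_(i <- enum 'I_d) (ramp M 0 1 s i z x * ramp M 0 (-1) s i z x).

Lemma bump_itv M s z x : 0 <= bump M s z x <= 1.
Proof.
rewrite /bump; elim: (enum _) => [|i r IH]; first by rewrite big_nil ler01 lexx.
rewrite big_cons; have := @step_itv R M (2 + 1 * ((x 0 i - z 0 i) / s)).
have := @step_itv R M (2 + -1 * ((x 0 i - z 0 i) / s)).
rewrite /ramp; move: (step _ _ _) (step _ _ _) (\prod_(_ <- _) _) IH => u v w.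
move=> /andP[w0 w1] /andP[u0 u1] /andP[v0 v1].
by rewrite !mulr_ge0//= !mulr_ile1// ?mulr_ge0// mulr_ile1.
Qed.

Lemma bump_eq1 M s z x : (0 < M)%N -> 0 < s -> `|x - z| <= s -> bump M s z x = 1.
Proof.
move=> M0 s0 xz; rewrite /bump big1_seq// => i _.
have := le_trans (coord_le_norm (x - z) i) xz; rewrite !mxE ler_norml => xzi.
have /andP[l r] : -1 <= (x 0 i - z 0 i) / s <= 1.
  by rewrite ler_pdivlMr// ler_pdivrMr// mulN1r mul1r.
by rewrite /ramp !step_ge1 ?mul1r//; lra.
Qed.


(** The constant is uniform in [s] and [z]: all these bumps are translated dilates of one function,
    and the class with parameter [s^-1] measures derivatives in units of 1 / s. *)
Lemma dcls_bump n : exists2 C : R, 0 <= C & forall s z, 0 < s ->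
  dcls s^-1 n C [set x | `|x - z| < s *+ 2] (bump n.+3 s z).
Proof.
have [B B0 stB] : exists2 B : R, 0 <= B & forall l t, (l < n.+3)%N -> `|step n.+3 l t| <= B.
  have /choice[b bP] l : exists b : R, 0 <= b /\ forall t, `|step n.+3 l t| <= b.
    by have [b b0 ?] := step_bounded R n.+3 l; exists b.
  exists (\sum_(l < n.+3) b l); first by apply: sumr_ge0 => l _; case: (bP l).
  move=> l t ln; apply: le_trans ((bP l).2 t) _.
  by rewrite (bigD1 (Ordinal ln))//= lerDl sumr_ge0// => k _; case: (bP k).
pose C := (2 ^+ n * (2 ^+ n * (B * B))) ^+ size (enum 'I_d).
have C0 : 0 <= C by rewrite exprn_ge0// !mulr_ge0// exprn_ge0.
exists (Num.max 1 C); first by rewrite le_max ler01.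
move=> s z s0.
have sub : [set x | forall i, i \in enum 'I_d ->
    ([set x : V | 0 < 2 + 1 * ((x 0 i - z 0 i) / s)] `&`
     [set x : V | 0 < 2 + -1 * ((x 0 i - z 0 i) / s)]) x] `<=`
    [set x | `|x - z| < s *+ 2].
  move=> x /= h; apply: rV_norm_lt => [|i]; first lra.
  have [] := h i (mem_enum _ i); rewrite /= !mxE.
  move: (x 0 i - z 0 i) => u; rewrite mul1r mulN1r => h1 h2.
  have : - 2 < u / s < 2 by lra.
  by rewrite ltr_pdivlMr// ltr_pdivrMr// ltr_norml => /andP[? ?]; lra.
apply: (@le_dcls _ _ _ _ C) sub _; first by rewrite le_max lexx orbT.
apply: dcls_prod => i.
have ramps e : `|e| <= 1 -> dcls s^-1 n B
    [set x : V | 0 < 2 + e * ((x 0 i - z 0 i) / s)] (ramp n.+3 0 e s i z).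
  move=> e1.
  have E : (fun x => 1 * ramp n.+3 0 e s i z x) = ramp n.+3 0 e s i z.
    by apply/funext => x; rewrite mul1r.
  split.
  - exact: continuous_ramp.
  - by move=> x; exact: stB.
  - by move=> x /negP; rewrite -leNgt => le0; rewrite /ramp step_le0.
  - move=> j; rewrite -E; by apply: dcl_ramp => //; rewrite normr1.
by apply: dclsM; apply: ramps; rewrite ?normrN normr1.
Qed.

End Bump.

(** * Oscillatory integrals and integration by parts *)

Section Oscillation.
Variables (R : realType) (d : nat).
Local Notation V := 'rV[R]_d.
Local Notation L := (LebRd R d).
Local Notation lam := (@lebRd R d).
Implicit Types (F : V -> R) (x z zeta : V) (i j : 'I_d) (al sg s r A : R).

(** Differentiation only shifts [al] by pi / 2, so the family is closed under it; the sine is the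
    phase -pi / 2. *)
Definition osc zeta al x : R := cos (dotv x zeta + al).

Lemma osc_le1 zeta al x : `|osc zeta al x| <= 1.
Proof. by rewrite ler_norml cos_geN1 cos_le1. Qed.

Lemma measurable_dotv d' (T : measurableType d') (f g : T -> V) :
  (forall i, measurable_fun setT (fun t => f t 0 i)) ->
  (forall i, measurable_fun setT (fun t => g t 0 i)) ->
  measurable_fun setT (fun t => dotv (f t) (g t)).
Proof.
move=> mf mg; rewrite /dotv.
by apply: measurable_sum => i; apply: measurable_funM; [exact: mf|exact: mg].
Qed.

Lemma measurable_osc d' (T : measurableType d') (f g : T -> V) al :
  (forall i, measurable_fun setT (fun t => f t 0 i)) ->
  (forall i, measurable_fun setT (fun t => g t 0 i)) ->
  measurable_fun setT (fun t => osc (g t) al (f t)).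
Proof.
move=> mf mg; apply: (@measurableT_comp _ _ _ _ _ _ (@cos R)).
  by apply: continuous_measurable_fun; exact: continuous_cos.
by apply: measurable_funD => //; exact: measurable_dotv.
Qed.

Lemma dotv_line x zeta j (u : R) :
  dotv (x + u *: evec R j) zeta = dotv x zeta + zeta 0 j * u.
Proof.
rewrite /dotv; under eq_bigr do rewrite !mxE /= mulrDl.
rewrite big_split /=; congr (_ + _).
rewrite (bigD1 j)//= eqxx mulr1 big1 ?addr0 1?mulrC// => i ij.
by rewrite (negbTE ij) mulr0 mul0r.
Qed.

Lemma is_derive_osc zeta al j x :
  is_derive x (evec R j) (osc zeta al) (zeta 0 j * osc zeta (al + pi / 2) x).
Proof.
apply/is_derive_line0.
have -> : (fun u : R => osc zeta al (x + u *: evec R j)) =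
    cos \o (fun u => (dotv x zeta + al) + zeta 0 j * u).
  by apply/funext => u; rewrite /osc dotv_line /= addrAC.
have := @is_derive1_comp R cos (fun u => (dotv x zeta + al) + zeta 0 j * u) 0 _ _
  (is_derive_cos _) (is_derive_affine _ _ 0).
by rewrite mulr0 addr0 /osc addrA cosDpihalf mulrC.
Qed.

Lemma continuous_osc zeta al : continuous (osc zeta al).
Proof.
move=> x.
have cd : (fun x => dotv x zeta + al) @ x --> dotv x zeta + al.
  suff cs : (fun x => dotv x zeta) @ x --> dotv x zeta.
    exact: (cvgD cs (@cvg_cst _ al _ (nbhs x) _)).
  rewrite /dotv; elim: (index_enum _) => [|i r IH].
    rewrite big_nil; under eq_fun do rewrite big_nil.
    exact: (@cvg_cst _ 0 _ (nbhs x) _).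
  rewrite big_cons; under eq_fun do rewrite big_cons.
  have ci := @coord_continuous _ _ _ 0 i x.
  exact: (cvgD (cvgM ci (@cvg_cst _ (zeta 0 i) _ (nbhs x) _)) IH).
exact: (continuous_cvg _ (@continuous_cos R _) cd).
Qed.

Lemma evec_norm j : `|evec R j| <= 1.
Proof.
by apply: rV_norm_le => // i; rewrite !mxE /=; case: eqP => _; rewrite ?normr1 ?normr0.
Qed.

Lemma osc_Rintegrable zeta al F z r A : continuous F -> (forall x, `|F x| <= A) ->
  (forall x, ~ `|x - z| < r -> F x = 0) ->
  Rintegrable lam (fun x => osc zeta al x * F x).
Proof.
move=> cF FA F0; apply: (@bounded_supp_Rintegrable R d _ z r A).
- apply: measurable_funM; apply: continuous_measurable => //; exact: continuous_osc.
- by move=> x; rewrite normrM -[leRHS]mul1r ler_pM// osc_le1.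
- by move=> x xz; rewrite F0// mulr0.
Qed.

(** The integral of the derivative of [osc zeta (al - pi / 2) * F] vanishes, and the derivative of
    its oscillating factor is [zeta 0 j * osc zeta al]. *)
Lemma osc_ibp sg j A z r F F' zeta al : continuous F -> (forall x, `|F x| <= A) ->
  (forall x, ~ `|x - z| < r -> F x = 0) -> continuous F' ->
  (forall x, `|F' x| <= A) -> (forall x, ~ `|x - z| < r -> F' x = 0) ->
  (forall x, is_derive x (evec R j) F (sg * F' x)) ->
  zeta 0 j * \int[lam]_x (osc zeta al x * F x) =
  - sg * \int[lam]_x (osc zeta (al - pi / 2) x * F' x).
Proof.
move=> cF FA F0 cF' F'A F'0 dF.
have A0 : 0 <= A by apply: le_trans (FA 0).
pose be := al - pi / 2.
have be_al : be + pi / 2 = al by rewrite /be subrK.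
have iF := osc_Rintegrable zeta al cF FA F0.
have iF' := osc_Rintegrable zeta be cF' F'A F'0.
have cZ (k : R) x : (fun _ : V => k) @ x --> k by exact: (@cvg_cst _ k _ (nbhs x) _).
have := @Rintegral_derive_eq0 R d (fun x => osc zeta be x * F x)
  (fun x => zeta 0 j * (osc zeta al x * F x) + sg * (osc zeta be x * F' x))
  (evec R j) z r (`|zeta 0 j| * A + `|sg| * A + A) (evec_norm j).
rewrite (RintegralD _ (RintegrableZ _ iF) (RintegrableZ _ iF'))// !RintegralZl//.
move=> h; apply/eqP; rewrite mulNr -addr_eq0; apply/eqP; apply: h.
- by move=> x; exact: (cvgM (@continuous_osc zeta be x) (cF x)).
- move=> x; exact: (cvgD (cvgM (cZ _ _) (cvgM (@continuous_osc zeta al x) (cF x)))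
    (cvgM (cZ _ _) (cvgM (@continuous_osc zeta be x) (cF' x)))).
- move=> x; have D := is_deriveM (is_derive_osc zeta be j x) (dF x).
  apply: (is_derive_eq D); rewrite be_al.
  rewrite -[LHS]/(osc zeta be x * (sg * F' x) + F x * (zeta 0 j * osc zeta al x)).
  by ring.
- move=> x; apply: (le_trans (ler_normD _ _)).
  have := osc_le1 zeta al x; have := osc_le1 zeta be x; move=> o1 o2.
  have h1 : `|osc zeta al x * F x| <= A by rewrite normrM -[leRHS]mul1r ler_pM.
  have h2 : `|osc zeta be x * F' x| <= A by rewrite normrM -[leRHS]mul1r ler_pM.
  have := ler_wpM2l (normr_ge0 (zeta 0 j)) h1.
  have := ler_wpM2l (normr_ge0 sg) h2.
  by rewrite -!normrM; lra.
- move=> x; have o1 := osc_le1 zeta be x.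
  have h1 : `|osc zeta be x * F x| <= A by rewrite normrM -[leRHS]mul1r ler_pM.
  by rewrite (le_trans h1)// lerDr addr_ge0// mulr_ge0.
- by move=> x xz; rewrite F0// mulr0.
Qed.

Lemma normr_Rintegral_osc_le A z r F zeta al : 0 <= r -> continuous F ->
  (forall x, `|F x| <= A) -> (forall x, ~ `|x - z| < r -> F x = 0) ->
  `|\int[lam]_x (osc zeta al x * F x)| <= A * (r *+ 2) ^+ d.
Proof.
move=> r0 cF FA F0.
have mF := measurable_funM (continuous_measurable (@continuous_osc zeta al))
  (continuous_measurable cF).
apply: (@bounded_supp_Rintegral_le R d _ z r A r0 mF).
- by move=> x; rewrite normrM -[leRHS]mul1r ler_pM// osc_le1.
- by move=> x xz; rewrite -[LHS]/(osc zeta al x * F x) F0// mulr0.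
Qed.

(** Each integration by parts trades one factor [|zeta 0 j| / sg] for one normalised derivative of
    [F], which obeys the same bound [A]. *)
Lemma osc_decay sg j n A z r F zeta al : 0 < sg -> 0 <= r ->
  dcl sg j n A [set x | `|x - z| < r] F ->
  (`|zeta 0 j| / sg) ^+ n * `|\int[lam]_x (osc zeta al x * F x)| <= A * (r *+ 2) ^+ d.
Proof.
move=> sg0 r0; elim: n F al => [|n IH] F al Fn.
  have [cF FA F0] := dcl_base Fn; rewrite expr0 mul1r.
  exact: normr_Rintegral_osc_le r0 cF FA F0.
case: Fn => cF FA F0 [F' [dF F'n]]; have [cF' F'A F'0] := dcl_base F'n.
have := IH F' (al - pi / 2) F'n; apply: le_trans.
rewrite exprSr -mulrA ler_wpM2l//; first by rewrite exprn_ge0// divr_ge0// ltW.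
have := osc_ibp zeta al cF FA F0 cF' F'A F'0 dF => /(congr1 Num.Def.normr).
rewrite !normrM normrN (gtr0_norm sg0) mulrAC => ->.
by rewrite mulrAC mulfV ?gt_eqF// mul1r.
Qed.

(** The trivial bound and the bound after d+1 integrations by parts are added, which gives the
    factor 2. Integrating in a direction where the sup norm of [zeta] is attained is what lets pure
    derivatives suffice. The support has side 4 s, whence 4^d. *)
Lemma osc_kappa A z s F zeta al : 0 < s ->
  dcls s^-1 d.+1 A [set x | `|x - z| < s *+ 2] F ->
  `|\int[lam]_x (osc zeta al x * F x)| <= (2 * 4 ^+ d) * A * kappa s zeta.
Proof.
move=> s0 [cF FA F0 Fj].
have A0 : 0 <= A by apply: le_trans (FA 0).
set I := `| _ |.
have IA : I <= A * (s *+ 2 *+ 2) ^+ d.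
  have s20 : 0 <= s *+ 2 by rewrite mulrn_wge0// ltW.
  exact: normr_Rintegral_osc_le s20 cF FA F0.
have IA' : (s * `|zeta|) ^+ d.+1 * I <= A * (s *+ 2 *+ 2) ^+ d.
  have [->|[j ->]] := rV_norm_attained zeta.
    by rewrite normr0 mulr0 expr0n mul0r mulr_ge0// exprn_ge0// !mulrn_wge0// ltW.
  have := @osc_decay s^-1 j d.+1 A z (s *+ 2) F zeta al.
  by rewrite invrK mulrC [_ * s]mulrC mulrC; apply=> //; rewrite ?invr_gt0// mulrn_wge0// ltW.
have -> : 2 * 4 ^+ d * A * kappa s zeta =
    (A * (s *+ 2 *+ 2) ^+ d * 2) / (1 + (s * `|zeta|) ^+ d.+1).
  have -> : s *+ 2 *+ 2 = 4 * s by ring.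
  rewrite /kappa (exprMn d 4 s); move: ((1 + _)^-1) (s ^+ d) (4 ^+ d) => D u v; ring.
rewrite ler_pdivlMr; last by rewrite ltr_pwDl// exprn_ge0// mulr_ge0// ltW.
rewrite mulrDr mulr1 [I * _]mulrC mulr_natr mulr2n.
exact: lerD.
Qed.

End Oscillation.

(** * Joint measurability and Schur's test *)

Section MeasurabilityTools.
Variables (R : realType) (d : nat).
Local Notation V := 'rV[R]_d.
Local Notation L := (LebRd R d).
Local Notation lam := (@lebRd R d).

Lemma measurable_coord1 i : measurable_fun setT (fun p : L * L => (p.1 : V) 0 i).
Proof. exact: (measurableT_comp (@measurable_coord R d i) measurable_fst). Qed.

Lemma measurable_coord2 i : measurable_fun setT (fun p : L * L => (p.2 : V) 0 i).
Proof. exact: (measurableT_comp (@measurable_coord R d i) measurable_snd). Qed.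

Lemma measurable_comp1 (f : V -> R) : measurable_fun setT (f : L -> R) ->
  measurable_fun setT (fun p : L * L => f p.1).
Proof. by move=> mf; exact: (measurableT_comp mf measurable_fst). Qed.

Lemma measurable_comp2 (f : V -> R) : measurable_fun setT (f : L -> R) ->
  measurable_fun setT (fun p : L * L => f p.2).
Proof. by move=> mf; exact: (measurableT_comp mf measurable_snd). Qed.

Lemma measurable_osc12 al : measurable_fun setT (fun p : L * L => osc (p.2 : V) al p.1).
Proof. by apply: measurable_osc => i; [exact: measurable_coord1|exact: measurable_coord2]. Qed.

Lemma oscC (x y : V) al : osc x al y = osc y al x.
Proof. by rewrite /osc /dotv; under eq_bigr do rewrite mulrC. Qed.

Lemma measurable_continuous_diff (F : V -> R) : continuous F ->
  measurable_fun setT (fun p : L * L => F (p.2 - p.1 : V)).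
Proof.
move=> cF; apply: (@measurable_fun_continuous_comp R d _ (L * L)%type (fun p => p.2 - p.1 : V)) => // i.
under eq_fun do rewrite !mxE.
by apply: measurable_funB; [exact: measurable_coord2|exact: measurable_coord1].
Qed.

Lemma normr_Rintegral_EFin_le (f : V -> R) : Rintegrable lam f ->
  ((`|\int[lam]_x f x|)%:E <= \int[lam]_x (`|f x|)%:E)%E.
Proof.
move=> fi; rewrite EFin_normr_Rintegral//.
have mf : measurable_fun setT (fun x : L => (f x)%:E).
  by apply/measurable_EFinP; exact: Rintegrable_meas fi.
exact: (le_abse_integral lam measurableT mf).
Qed.

End MeasurabilityTools.

Section Schur.
Variables (R : realType) (d : nat).
Local Notation V := 'rV[R]_d.
Local Notation L := (LebRd R d).
Local Notation lam := (@lebRd R d).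

Definition kappa_mass : R := 2 ^+ d.+1 * 2 ^+ d * 2.

(** Bound [|G x| * |G y|] by half the sum of the squares. In each half the kernel is integrated in
    the variable absent from [G], after an exchange of integrals in the second. *)
Lemma schur_kappa (s : R) (G : V -> R) : 0 < s -> measurable_fun setT (G : L -> R) ->
  (\int[lam]_x \int[lam]_y (`|G x| * `|G y| * kappa s (y - x))%:E <=
   kappa_mass%:E * \int[lam]_x (G x ^+ 2)%:E)%E.
Proof.
move=> s0 mG; have s0' := ltW s0.
have mG2 : measurable_fun setT (fun x : L => G x ^+ 2) by exact: measurable_funX.
have mk : measurable_fun setT (fun p : L * L => kappa s (p.2 - p.1 : V)).
  apply: measurable_continuous_diff.
  rewrite (_ : @kappa R d s = fun x => kappa s (x - 0)); first exact: continuous_kappa.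
  by apply/funext => u; rewrite subr0.
have k0 (x y : V) : 0 <= kappa s (y - x) by exact: kappa_ge0.
have p0 (x y : V) : 0 <= `|G x| * `|G y| * kappa s (y - x).
  by apply: mulr_ge0; [apply: mulr_ge0|exact: k0].
pose D1 (p : L * L) := ((G p.1 ^+ 2 / 2 * kappa s (p.2 - p.1 : V))%:E)%E.
pose D2 (p : L * L) := ((G p.2 ^+ 2 / 2 * kappa s (p.2 - p.1 : V))%:E)%E.
have mD1 : measurable_fun setT D1.
  apply/measurable_EFinP/measurable_funM => //.
  by apply: measurable_funM => //; exact: (measurable_comp1 mG2).
have mD2 : measurable_fun setT D2.
  apply/measurable_EFinP/measurable_funM => //.
  by apply: measurable_funM => //; exact: (measurable_comp2 mG2).
have D10 p : (0 <= D1 p)%E by rewrite lee_fin; apply: mulr_ge0; [rewrite divr_ge0 ?sqr_ge0|exact: k0].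
have D20 p : (0 <= D2 p)%E by rewrite lee_fin; apply: mulr_ge0; [rewrite divr_ge0 ?sqr_ge0|exact: k0].
have mD1x (x : L) : measurable_fun setT (fun y : L => D1 (x, y)).
  exact: (measurableT_comp mD1 (pair1_measurable x)).
have mD2x (x : L) : measurable_fun setT (fun y : L => D2 (x, y)).
  exact: (measurableT_comp mD2 (pair1_measurable x)).
have mD2y (y : L) : measurable_fun setT (fun x : L => D2 (x, y)).
  exact: (measurableT_comp mD2 (pair2_measurable y)).
have half0 x : (0 <= (G x ^+ 2 / 2)%:E)%E by rewrite lee_fin divr_ge0 ?sqr_ge0.
apply: (@le_trans _ _ (\int[lam]_x (\int[lam]_y D1 (x, y) + \int[lam]_y D2 (x, y)))%E).
  apply: ge0_le_integralW => x.
    by apply: integral_ge0 => y _; rewrite lee_fin; exact: p0.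
  rewrite -ge0_integralD//; apply: ge0_le_integralW => y.
    by rewrite lee_fin; exact: p0.
  rewrite -EFinD lee_fin -mulrDl; apply: ler_wpM2r; first exact: k0.
  have := sqr_ge0 (`|G x| - `|G y|); rewrite sqrrB !real_normK ?num_real//.
  by move: (`|G x| * `|G y|) => u; lra.
have mF1 : measurable_fun setT (fun x : L => \int[lam]_y D1 (x, y))%E.
  exact: (measurable_fun_fubini_tonelli_F (m2 := lam) D1 mD1 D10).
have mF2 : measurable_fun setT (fun x : L => \int[lam]_y D2 (x, y))%E.
  exact: (measurable_fun_fubini_tonelli_F (m2 := lam) D2 mD2 D20).
have F10 (x : L) : (0 <= \int[lam]_y D1 (x, y))%E by apply: integral_ge0 => y _; exact: D10.
have F20 (x : L) : (0 <= \int[lam]_y D2 (x, y))%E by apply: integral_ge0 => y _; exact: D20.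
rewrite (ge0_integralD lam measurableT (fun x _ => F10 x) mF1 (fun x _ => F20 x) mF2).
have mh : measurable_fun setT (fun x : L => (G x ^+ 2 / 2)%:E).
  by apply/measurable_EFinP; apply: measurable_funM.
have e1 : (\int[lam]_x \int[lam]_y D1 (x, y) <=
    \int[lam]_x (kappa_mass%:E * (G x ^+ 2 / 2)%:E))%E.
  apply: ge0_le_integralW => x; first exact: integral_ge0.
  under eq_integral do rewrite /D1/= EFinM.
  have mkx : measurable_fun setT (fun y : L => (kappa s (y - x))%:E).
    exact/measurable_EFinP/continuous_measurable/continuous_kappa.
  have kx (y : L) : (0 <= (kappa s (y - x))%:E)%E by rewrite lee_fin.
  have g0 : 0 <= G x ^+ 2 / 2 by rewrite divr_ge0 ?sqr_ge0.
  rewrite (ge0_integralZl_EFin lam measurableT (fun y _ => kx y) mkx g0).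
  by rewrite muleC lee_wpmul2r//; exact: integral_kappa_le.
have e2 : (\int[lam]_x \int[lam]_y D2 (x, y) <=
    \int[lam]_x (kappa_mass%:E * (G x ^+ 2 / 2)%:E))%E.
  rewrite (fubini_tonelli (m1 := lam) (m2 := lam) D2 mD2 D20).
  apply: ge0_le_integralW => y; first exact: integral_ge0.
  under eq_integral do rewrite /D2/= EFinM -opprB kappaN.
  have mky : measurable_fun setT (fun x : L => (kappa s (x - y))%:E).
    exact/measurable_EFinP/continuous_measurable/continuous_kappa.
  have ky (x : L) : (0 <= (kappa s (x - y))%:E)%E by rewrite lee_fin.
  have g0 : 0 <= G y ^+ 2 / 2 by rewrite divr_ge0 ?sqr_ge0.
  rewrite (ge0_integralZl_EFin lam measurableT (fun x _ => ky x) mky g0).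
  by rewrite muleC lee_wpmul2r//; exact: integral_kappa_le.
apply: (le_trans (leeD e1 e2)).
have km0 : 0 <= kappa_mass by rewrite /kappa_mass !mulr_ge0// exprn_ge0.
rewrite (ge0_integralZl_EFin lam measurableT (fun x _ => half0 x) mh km0).
rewrite -ge0_muleDr; [|exact: integral_ge0..].
apply: lee_wpmul2l; first by rewrite lee_fin.
rewrite -(ge0_integralD lam measurableT (fun x _ => half0 x) mh (fun x _ => half0 x) mh).
apply: ge0_le_integralW => x.
  by rewrite -EFinD lee_fin addr_ge0// divr_ge0 ?sqr_ge0.
by rewrite -EFinD lee_fin; move: (G x ^+ 2) => u; lra.
Qed.

End Schur.

(** * The local L^2 bound on the frequency side *)

Section Bessel.
Variables (R : realType) (d : nat).
Local Notation V := 'rV[R]_d.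
Local Notation L := (LebRd R d).
Local Notation lam := (@lebRd R d).
Local Notation cube z r := [set x : L | `|(x : V) - z| < r].

Definition wave (b : V -> V -> R) (G : V -> R) al (x : V) : R :=
  \int[lam]_xi (osc x al xi * (b x xi * G xi)).

Variables (s A C1 : R) (z : V) (b : V -> V -> R) (G phi : V -> R).
Hypotheses (s0 : 0 < s) (mb : measurable_fun setT (fun p : L * L => b p.1 p.2))
  (bA : forall xi, dcls s^-1 d.+1 A setT (b ^~ xi))
  (mG : Rintegrable lam G)
  (phiP : dcls s^-1 d.+1 C1 (cube z (s *+ 2)) phi).

Let c al x xi : R := osc x al xi * (b x xi * G xi).

Let A0 : 0 <= A. Proof. exact: dcls_ge0 (bA 0). Qed.
Let C10 : 0 <= C1. Proof. exact: dcls_ge0 phiP. Qed.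
Let b_le x xi : `|b x xi| <= A. Proof. by have [_ + _ _] := bA xi; exact. Qed.

Let c_le al x xi : `|c al x xi| <= A * `|G xi|.
Proof.
rewrite /c !normrM; apply: (@le_trans _ _ (1 * (`|b x xi| * `|G xi|))).
  by apply: ler_wpM2r; [exact: mulr_ge0|exact: osc_le1].
by rewrite mul1r; apply: ler_wpM2r.
Qed.

Let mc al : measurable_fun setT (fun p : L * L => c al p.1 p.2).
Proof.
apply: measurable_funM.
  by under eq_fun do rewrite oscC; exact: measurable_osc12.
by apply: (measurable_funM mb); apply: measurable_comp2; exact: Rintegrable_meas mG.
Qed.

Let absG : Rintegrable lam (fun x => `|G x|). Proof. exact: Rintegrable_norm. Qed.

Let iG : Rintegrable lam (fun x => A * `|G x|). Proof. exact: RintegrableZ. Qed.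

Lemma wave_int al x : Rintegrable lam (fun xi => osc x al xi * (b x xi * G xi)).
Proof.
apply: (@le_Rintegrable _ L R lam _ _ _ (c_le al x) iG).
exact: (measurableT_comp (mc al) (pair1_measurable (x : L))).
Qed.

Let M := A * \int[lam]_xi `|G xi|.

Let M0 : 0 <= M.
Proof. by rewrite mulr_ge0// Rintegral_ge0. Qed.

Lemma measurable_wave al : measurable_fun setT (wave b G al : L -> R).
Proof. exact: measurable_Rintegral_param (mc al). Qed.

Lemma wave_le al x : `|wave b G al x| <= A * \int[lam]_xi `|G xi|.
Proof.
rewrite -(@RintegralZl _ L R lam setT _ A measurableT absG).
exact: (normr_Rintegral_le (Rintegrable_meas (wave_int al x)) (c_le al x) iG).
Qed.

(** The addition formula for the cosine, so that all phases are controlled by the pair 0 and -pi /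
    2. *)
Lemma wave_phase al x : wave b G al x =
  cos al * wave b G 0 x - sin al * wave b G (- (pi / 2)) x.
Proof.
rewrite /wave -!RintegralZl//; try exact: wave_int.
rewrite -RintegralB//; last 2 first.
- by apply: RintegrableZ; exact: wave_int.
- by apply: RintegrableZ; exact: wave_int.
apply: eq_Rintegral => xi _; rewrite /osc cosD addr0.
by rewrite -[X in sin al * (X * _)]/(cos (_ - _)) cosBpihalf; ring.
Qed.

Lemma wave_phi_int al be : Rintegrable lam (fun x => phi x * (wave b G al x * wave b G be x)).
Proof.
have [cphi phiC phi0 _] := phiP.
apply: (@bounded_supp_Rintegrable R d _ z (s *+ 2) (C1 * (M * M))).
- apply: measurable_funM; first exact: continuous_measurable.
  by apply: measurable_funM; exact: measurable_wave.
- by move=> x; rewrite !normrM !ler_pM ?mulr_ge0//; exact: wave_le.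
- by move=> x xz; rewrite phi0 ?mul0r.
Qed.

(* Expand the square as a double integral over the frequencies and integrate
   in [x] first. *)
Let P al xi := \int[lam]_x (phi x * wave b G al x * c al x xi).
Let Q al xi eta := \int[lam]_x (phi x * c al x xi * c al x eta).

Let g1 : V -> R := fun x => C1 * \1_(cube z (s *+ 2)) x.

Let g1_int : Rintegrable lam g1. Proof. exact: Rintegrable_cube. Qed.

Let phi_g1 x : `|phi x| <= g1 x.
Proof.
have [_ phiC phi0 _] := phiP; rewrite /g1 indicE.
have [xz|/negP xz] := boolP (x \in _); first by rewrite mulr1.
by rewrite mulr0 phi0 ?normr0//; move: xz; rewrite inE.
Qed.

Let mphi : measurable_fun setT (phi : L -> R).
Proof. by have [cphi _ _ _] := phiP; exact: continuous_measurable. Qed.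

Let P_fubini al : \int[lam]_x (phi x * (wave b G al x * wave b G al x)) =
  \int[lam]_xi P al xi /\ Rintegrable lam (P al).
Proof.
pose F x xi := phi x * wave b G al x * c al x xi.
have mF : measurable_fun setT (fun p : L * L => F p.1 p.2).
  apply: (measurable_funM _ (mc al)).
  apply: (@measurable_comp1 R d (fun x => phi x * wave b G al x)).
  exact: (measurable_funM mphi (measurable_wave al)).
have gi : Rintegrable lam (fun x => M * g1 x) by exact: RintegrableZ.
have FM x xi : `|F x xi| <= (M * g1 x) * (A * `|G xi|).
  rewrite /F [leLHS]normrM; apply: (ler_pM (normr_ge0 _) (normr_ge0 _) _ (c_le al x xi)).
  by rewrite normrM mulrC; apply: ler_pM => //; exact: wave_le.
have E x : phi x * (wave b G al x * wave b G al x) = \int[lam]_xi F x xi.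
  by rewrite mulrA -RintegralZl//; exact: wave_int.
split.
  under eq_Rintegral do rewrite E.
  exact: (Rintegral_Fubini mF gi iG FM).
have mF' : measurable_fun setT (fun p : L * L => F p.2 p.1).
  exact: (measurableT_comp mF (@measurable_swap _ _ L L)).
by apply: (Rintegrable_param mF' iG gi) => x y; rewrite [leRHS]mulrC; exact: FM.
Qed.

Let Q_fubini al xi : P al xi = \int[lam]_eta Q al xi eta /\ Rintegrable lam (Q al xi).
Proof.
pose F x eta := phi x * c al x xi * c al x eta.
have mcx : measurable_fun setT (fun x : L => c al x xi).
  exact: (measurableT_comp (mc al) (pair2_measurable (xi : L))).
have mF : measurable_fun setT (fun p : L * L => F p.1 p.2).
  apply: (measurable_funM _ (mc al)).
  apply: (@measurable_comp1 R d (fun x => phi x * c al x xi)).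
  exact: (measurable_funM mphi mcx).
have gi : Rintegrable lam (fun x => (A * `|G xi|) * g1 x) by exact: RintegrableZ.
have FM x eta : `|F x eta| <= ((A * `|G xi|) * g1 x) * (A * `|G eta|).
  rewrite /F [leLHS]normrM; apply: (ler_pM (normr_ge0 _) (normr_ge0 _) _ (c_le al x eta)).
  by rewrite normrM mulrC; apply: ler_pM => //; exact: c_le.
split.
  rewrite /P -(Rintegral_Fubini mF gi iG FM); apply: eq_Rintegral => x _.
  rewrite /F RintegralZl//; last exact: wave_int.
  by rewrite -/(wave b G al x); ring.
have mF' : measurable_fun setT (fun p : L * L => F p.2 p.1).
  exact: (measurableT_comp mF (@measurable_swap _ _ L L)).
by apply: (Rintegrable_param mF' iG gi) => x y; rewrite [leRHS]mulrC; exact: FM.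
Qed.

(** The first factor comes from [osc_kappa], [C1] from the bump, and each 2^(d+1) from one of the
    two product rules in [phi x * (b x xi * b x eta)]. *)
Let C2 := (2 * 4 ^+ d) * (2 ^+ d.+1 * (C1 * 2 ^+ d.+1)).

(** The phases must be added: cos cos + sin sin is the cosine of the difference, so the integral in
    [x] oscillates with frequency [eta - xi]. One phase alone would also produce frequency
    [eta + xi], with no decay in [eta - xi]. *)
Let Q_le xi eta : `|Q 0 xi eta + Q (- (pi / 2)) xi eta| <=
  C2 * A ^+ 2 * (`|G xi| * `|G eta| * kappa s (eta - xi)).
Proof.
have cA al x xi' : `|c al x xi'| <= A * `|G xi'| by exact: c_le.
have Qi al : Rintegrable lam (fun x => phi x * c al x xi * c al x eta).
  apply: (@le_Rintegrable _ L R lam _ (fun x : V => (A * `|G xi|) * (A * `|G eta|) * g1 x)).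
  - apply: measurable_funM.
      apply: (measurable_funM mphi).
      exact: (measurableT_comp (mc al) (pair2_measurable (xi : L))).
    exact: (measurableT_comp (mc al) (pair2_measurable (eta : L))).
  - move=> x; rewrite -mulrA normrM mulrC; apply: ler_pM => //.
    by rewrite normrM; apply: ler_pM.
  - exact: RintegrableZ.
have -> : Q 0 xi eta + Q (- (pi / 2)) xi eta = (G xi * G eta) *
    \int[lam]_x (osc (eta - xi) 0 x * (phi x * (b x xi * b x eta))).
  have [cphi phiC phi0 _] := phiP.
  rewrite -RintegralD//; try exact: Qi.
  have [cbx _ _ _] := bA xi; have [cbe _ _ _] := bA eta.
  rewrite -RintegralZl//; last first.
    apply: (@osc_Rintegrable R d _ _ _ z (s *+ 2) (C1 * (A * A))).
    + move=> x; exact: (cvgM (cphi x) (cvgM (cbx x) (cbe x))).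
    + by move=> x; rewrite !normrM !ler_pM ?mulr_ge0.
    + by move=> x xz; rewrite phi0 ?mul0r.
  apply: eq_Rintegral => x _; rewrite /c ![osc x _ _]oscC /osc !addr0 !cosBpihalf.
  have -> : dotv x (eta - xi) = dotv x eta - dotv x xi.
    by rewrite /dotv -sumrB; apply: eq_bigr => i _; rewrite !mxE mulrBr.
  by rewrite cosB; ring.
rewrite !normrM.
have H := dclsM phiP (dclsM (bA xi) (bA eta)).
have {H}H : dcls s^-1 d.+1 (2 ^+ d.+1 * (C1 * (2 ^+ d.+1 * (A * A))))
    [set x | `|x - z| < s *+ 2] (fun x => phi x * (b x xi * b x eta)).
  by apply: le_dcls H => // x [].
have := osc_kappa (eta - xi) 0 s0 H.
move/(ler_wpM2l (mulr_ge0 (normr_ge0 (G xi)) (normr_ge0 (G eta)))) => h.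
apply: le_trans h _; rewrite le_eqVlt; apply/orP; left; apply/eqP.
by rewrite /C2; move: (kappa _ _) (2 ^+ d.+1) (4 ^+ d) => u v w; ring.
Qed.

(** Two applications of Fubini, with product majorants, lead to the double integral of the sum of
    the [Q]; [Q_le] then reduces it to [schur_kappa]. *)
Lemma wave_bessel_phi :
  ((\int[lam]_x (phi x * (wave b G 0 x ^+ 2 + wave b G (- (pi / 2)) x ^+ 2)))%:E <=
   (C2 * A ^+ 2)%:E * (kappa_mass R d)%:E * \int[lam]_x (G x ^+ 2)%:E)%E.
Proof.
have C20 : 0 <= C2 * A ^+ 2 by rewrite !mulr_ge0// ?exprn_ge0.
have [E0 P0] := P_fubini 0; have [E1 P1] := P_fubini (- (pi / 2)).
have -> : \int[lam]_x (phi x * (wave b G 0 x ^+ 2 + wave b G (- (pi / 2)) x ^+ 2)) =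
    \int[lam]_xi (P 0 xi + P (- (pi / 2)) xi).
  rewrite RintegralD// -E0 -E1 -RintegralD//; try exact: wave_phi_int.
  by apply: eq_Rintegral => x _; rewrite mulrDr !expr2.
apply: (@le_trans _ _ (`|\int[lam]_xi (P 0 xi + P (- (pi / 2)) xi)|)%:E).
  by rewrite lee_fin ler_norm.
apply: le_trans (normr_Rintegral_EFin_le (RintegrableD P0 P1)) _.
rewrite -muleA; apply: (@le_trans _ _ ((C2 * A ^+ 2)%:E *
  \int[lam]_x \int[lam]_y (`|G x| * `|G y| * kappa s (y - x))%:E)%E); last first.
  apply: lee_wpmul2l; first by rewrite lee_fin.
  by apply: schur_kappa => //; exact: Rintegrable_meas mG.
have p0 (x y : V) : 0 <= `|G x| * `|G y| * kappa s (y - x).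
  by apply: mulr_ge0; [apply: mulr_ge0|apply: kappa_ge0; exact: ltW].
have mG' := Rintegrable_meas mG.
have mk : measurable_fun setT
    (fun p : L * L => (`|G p.1| * `|G p.2| * kappa s (p.2 - p.1 : V))%:E).
  apply/measurable_EFinP; apply: measurable_funM.
    apply: measurable_funM.
      by apply: (@measurable_comp1 R d (fun x => `|G x|)); exact: measurableT_comp.
    by apply: (@measurable_comp2 R d (fun x => `|G x|)); exact: measurableT_comp.
  apply: measurable_continuous_diff.
  rewrite (_ : @kappa R d s = fun x => kappa s (x - 0)).
    by apply: continuous_kappa; exact: ltW.
  by apply/funext => u; rewrite subr0.
have pk (x : L) : (0 <= \int[lam]_y (`|G x| * `|G y| * kappa s (y - x))%:E)%E.
  by apply: integral_ge0 => y _; rewrite lee_fin; exact: p0.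
have mF : measurable_fun setT
    (fun x : L => \int[lam]_y (`|G x| * `|G y| * kappa s (y - x))%:E)%E.
  by apply: (measurable_fun_fubini_tonelli_F (m2 := lam) _ mk) => p; rewrite lee_fin; exact: p0.
rewrite -(ge0_integralZl_EFin lam measurableT (fun x _ => pk x) mF C20).
apply: ge0_le_integralW => xi; first by rewrite lee_fin.
have [F0 Q0] := Q_fubini 0 xi; have [F1 Q1] := Q_fubini (- (pi / 2)) xi.
rewrite F0 F1 -RintegralD//.
apply: le_trans (normr_Rintegral_EFin_le (RintegrableD Q0 Q1)) _.
have mk1 : measurable_fun setT (fun y : L => (`|G xi| * `|G y| * kappa s (y - xi))%:E).
  exact: (measurableT_comp mk (pair1_measurable (xi : L))).
have pk1 (y : L) : (0 <= (`|G xi| * `|G y| * kappa s (y - xi))%:E)%E.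
  by rewrite lee_fin; exact: p0.
rewrite -(ge0_integralZl_EFin lam measurableT (fun y _ => pk1 y) mk1 C20).
apply: ge0_le_integralW => eta; first by rewrite lee_fin.
by rewrite -EFinM lee_fin; exact: Q_le.
Qed.

End Bessel.

(** * Local energies and the Bessel inequality for all phases *)

Section Energy.
Variables (R : realType) (d : nat).
Local Notation V := 'rV[R]_d.
Local Notation L := (LebRd R d).
Local Notation lam := (@lebRd R d).
Implicit Types (F G : V -> R) (z : V) (s : R).

Definition energy z s F : \bar R :=
  (\int[lam]_x (\1_[set x : V | `|x - z| < s] x * F x ^+ 2)%:E)%E.

Lemma energy_meas z s F : measurable_fun setT (F : L -> R) ->
  measurable_fun setT (fun x : L => (\1_[set x : V | `|x - z| < s] x * F x ^+ 2)%:E).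
Proof.
move=> mF; apply/measurable_EFinP; apply: measurable_funM.
  by apply: measurable_indic; exact: measurable_cube.
exact: (measurable_funX 2 mF).
Qed.

Lemma le_energy z s F G : measurable_fun setT (G : L -> R) ->
  (forall x, `|x - z| < s -> `|F x| <= `|G x|) ->
  (energy z s F <= energy z s G)%E.
Proof.
move=> mG FG; apply: ge0_le_integralW => x; first by rewrite lee_fin mulr_ge0// sqr_ge0.
rewrite lee_fin indicE; have [xz|xz] := boolP (x \in _); last by rewrite !mul0r.
move: xz; rewrite inE !mul1r => /FG h.
by rewrite -(real_normK (num_real (F x))) -(real_normK (num_real (G x))) lerXn2r ?nnegrE.
Qed.

Lemma energyD z s F G : measurable_fun setT (F : L -> R) -> measurable_fun setT (G : L -> R) ->
  (energy z s (fun x => F x + G x)%R <= 2%:E * energy z s F + 2%:E * energy z s G)%E.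
Proof.
move=> mF mG.
have p (H : V -> R) (x : L) : (0 <= (\1_[set x : V | `|x - z| < s] x * H x ^+ 2)%:E)%E.
  by rewrite lee_fin mulr_ge0// sqr_ge0.
have mE (H : V -> R) (mH : measurable_fun setT (H : L -> R)) := @energy_meas z s H mH.
have two : (0 : R) <= 2 by [].
rewrite /energy.
rewrite -(ge0_integralZl_EFin lam measurableT (fun x _ => p F x) (mE F mF) two).
rewrite -(ge0_integralZl_EFin lam measurableT (fun x _ => p G x) (mE G mG) two).
rewrite -(ge0_integralD lam measurableT).
- apply: ge0_le_integralW => x; first exact: (p (fun x => F x + G x)).
  rewrite -!EFinM -EFinD lee_fin.
  have e0 : 0 <= \1_[set x : V | `|x - z| < s] x :> R by [].
  move: (\1_ _ x) (F x) (G x) e0 => e u v e0; rewrite -subr_ge0.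
  have -> : 2 * (e * u ^+ 2) + 2 * (e * v ^+ 2) - e * (u + v) ^+ 2 = e * (u - v) ^+ 2 by ring.
  by rewrite mulr_ge0// sqr_ge0.
- by move=> x _; rewrite mule_ge0.
- by apply: measurable_funeM; exact: mE.
- by move=> x _; rewrite mule_ge0.
- by apply: measurable_funeM; exact: mE.
Qed.

Lemma energyM_le z s F (q : V -> R) : measurable_fun setT (F : L -> R) ->
  (forall x, `|x - z| < s -> `|q x| <= 1) ->
  (energy z s (fun x => q x * F x)%R <= energy z s F)%E.
Proof.
move=> mF q1; apply: le_energy => // x xz.
by rewrite normrM ler_piMl// q1.
Qed.

End Energy.

Section BesselInequality.
Variables (R : realType) (d : nat).
Local Notation V := 'rV[R]_d.
Local Notation L := (LebRd R d).
Local Notation lam := (@lebRd R d).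

(** The bump equals 1 on the cube and so dominates its indicator, and [wave_phase] reduces the phase
    [al] to the two phases of [wave_bessel_phi]. *)
Lemma bessel_exists : exists2 C : R, 0 <= C &
  forall (s A : R) (z : V) (b : V -> V -> R) (G : V -> R) al, 0 < s ->
  measurable_fun setT (fun p : L * L => b p.1 p.2) ->
  (forall xi, dcls s^-1 d.+1 A setT (b ^~ xi)) -> Rintegrable lam G ->
  (energy z s (wave b G al) <= (C * A ^+ 2)%:E * \int[lam]_x (G x ^+ 2)%:E)%E.
Proof.
have [C1 C10 bumpP] := @dcls_bump R d d.+1.
pose C2 : R := 2 * 4 ^+ d * (2 ^+ d.+1 * (C1 * 2 ^+ d.+1)).
have C20 : 0 <= C2 by rewrite !mulr_ge0// exprn_ge0.
have km0 : 0 <= kappa_mass R d by rewrite /kappa_mass !mulr_ge0// exprn_ge0.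
exists (C2 * kappa_mass R d); first exact: mulr_ge0.
move=> s A z b G al s0 mb bA mG.
have := wave_bessel_phi s0 mb bA mG (bumpP s z s0).
rewrite -EFinM mulrAC => h; apply: le_trans h.
have pint al' be := wave_phi_int mb bA mG (bumpP s z s0) al' be.
have phiI : Rintegrable lam (fun x => bump d.+4 s z x *
    (wave b G 0 x ^+ 2 + wave b G (- (pi / 2)) x ^+ 2)).
  under eq_fun do rewrite mulrDr !expr2.
  by apply: RintegrableD; exact: pint.
rewrite EFin_Rintegral//; apply: ge0_le_integralW => x.
  by rewrite lee_fin mulr_ge0// sqr_ge0.
rewrite lee_fin; have /andP[b0 b1] := bump_itv d.+4 s z x.
have w0 : 0 <= wave b G 0 x ^+ 2 + wave b G (- (pi / 2)) x ^+ 2 by rewrite addr_ge0 ?sqr_ge0.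
rewrite indicE; have [xz|xz] := boolP (x \in _); last by rewrite mul0r mulr_ge0.
move: xz; rewrite inE => /ltW xz; rewrite bump_eq1// !mul1r.
rewrite (wave_phase mb bA mG).
(* The pair of waves is rotated by the angle [al]; this square of the other rotated component is
   exactly what is dropped. *)
have := sqr_ge0 (sin al * wave b G 0 x + cos al * wave b G (- (pi / 2)) x).
have := cos2Dsin2 al; move: (wave b G 0 x) (wave b G (- (pi / 2)) x) (cos al) (sin al) => u v c s'.
move=> cs h; rewrite -subr_ge0.
have -> : u ^+ 2 + v ^+ 2 - (c * u - s' * v) ^+ 2 =
  (s' * u + c * v) ^+ 2 + (1 - (c ^+ 2 + s' ^+ 2)) * (u ^+ 2 + v ^+ 2) by ring.
by rewrite cs subrr mul0r addr0.
Qed.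

End BesselInequality.

(** * The operator in physical space and its commutation with coordinates *)

Section Multipliers.
Variables (R : realType) (d : nat).
Local Notation V := 'rV[R]_d.
Local Notation L := (LebRd R d).
Local Notation lam := (@lebRd R d).
Local Notation cube z r := [set x : L | `|(x : V) - z| < r].
Implicit Types (b : V -> V -> R) (v : V -> R).

(** Real form, without the power of 2 pi, of the operator with symbol [b] applied to [v]: the inner
    integral is the Fourier transform of [v] merged with the phase in [x]. *)
Definition psi b v al (x : V) : R :=
  \int[lam]_xi (b x xi * \int[lam]_y (osc xi al (x - y) * v y)).

Definition supported_in (l : R) b := forall x xi : V, ~ `|xi| < l -> b x xi = 0.

Lemma osc_comp_int v (f : V -> V) (xi : V) al : Rintegrable lam v ->
  (forall i, measurable_fun setT (fun y : L => f y 0 i)) ->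
  Rintegrable lam (fun y => osc xi al (f y) * v y).
Proof.
move=> vi mf; apply: (@le_Rintegrable _ L R lam _ (fun y : V => `|v y|)).
- by apply: measurable_funM (Rintegrable_meas vi); exact: measurable_osc.
- by move=> y; rewrite normrM ler_piMl// osc_le1.
- exact: Rintegrable_norm.
Qed.

Lemma measurable_coordB (x : V) i : measurable_fun setT (fun y : L => (x - y : V) 0 i).
Proof.
under eq_fun do rewrite !mxE.
by apply: measurable_funB; [exact: measurable_cst|exact: measurable_coord].
Qed.

Definition vhat v al (xi : V) : R := \int[lam]_y (osc xi al y * v y).

Lemma measurable_vhat v al : Rintegrable lam v -> measurable_fun setT (vhat v al : L -> R).
Proof.
move=> vi; apply: (@measurable_Rintegral_param _ _ L L R lam (fun xi y => osc (xi : V) al y * v y)).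
apply: measurable_funM.
  by apply: measurable_osc => i; [exact: measurable_coord2|exact: measurable_coord1].
by apply: measurable_comp2; exact: Rintegrable_meas vi.
Qed.

Lemma vhat_le v al (xi : V) : Rintegrable lam v -> `|vhat v al xi| <= \int[lam]_y `|v y|.
Proof.
move=> vi; apply: normr_Rintegral_le.
- by apply: Rintegrable_meas; apply: (osc_comp_int _ _ vi (f := id)) => i; exact: measurable_coord.
- by move=> y; rewrite normrM ler_piMl// osc_le1.
- exact: Rintegrable_norm.
Qed.

Lemma osc_shift (x y xi : V) al : osc xi al (x - y) =
  osc xi al x * osc xi 0 y + osc xi (al - pi / 2) x * osc xi (- (pi / 2)) y.
Proof.
rewrite /osc !addr0 addrA !cosBpihalf.
have -> : dotv (x - y) xi = dotv x xi - dotv y xi.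
  by rewrite /dotv -sumrB; apply: eq_bigr => i _; rewrite !mxE mulrBl.
by rewrite addrAC cosB.
Qed.

Lemma psi_inner v al (x xi : V) : Rintegrable lam v ->
  \int[lam]_y (osc xi al (x - y) * v y) =
  osc xi al x * vhat v 0 xi + osc xi (al - pi / 2) x * vhat v (- (pi / 2)) xi.
Proof.
move=> vi.
have oi be : Rintegrable lam (fun y => osc xi be y * v y).
  by apply: (osc_comp_int _ _ vi (f := id)) => i; exact: measurable_coord.
rewrite /vhat -(@RintegralZl _ L R lam setT _ (osc xi al x) measurableT (oi 0)).
rewrite -(@RintegralZl _ L R lam setT _ (osc xi (al - pi / 2) x) measurableT (oi _)).
rewrite -(RintegralD measurableT (RintegrableZ _ (oi 0)) (RintegrableZ _ (oi _))).
by apply: eq_Rintegral => y _; rewrite osc_shift; ring.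
Qed.

(** For integrable [v] the transform [vhat] is bounded, and the truncation makes it integrable, as
    [wave] requires. A symbol supported in |xi| < l does not see the truncation. *)
Definition cut l v al : V -> R := fun xi => \1_[set x : V | `|x - 0| < l] xi * vhat v al xi.

Lemma cut_int l v al : Rintegrable lam v -> Rintegrable lam (cut l v al).
Proof.
move=> vi; apply: (@bounded_supp_Rintegrable R d _ 0 l (\int[lam]_y `|v y|)).
- apply: measurable_funM (measurable_vhat al vi).
  by apply: measurable_indic; exact: measurable_cube.
- move=> xi; rewrite normrM indicE; case: (_ \in _); last first.
    by rewrite normr0 mul0r Rintegral_ge0.
  by rewrite normr1 mul1r; exact: vhat_le.
- by move=> xi xl; rewrite /cut indicE memNset ?mul0r.
Qed.

Lemma mul_cut l b v al (x xi : V) : supported_in l b ->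
  b x xi * vhat v al xi = b x xi * cut l v al xi.
Proof.
move=> bl; rewrite /cut indicE; have [xl|/negP xl] := boolP (xi \in _); first by rewrite mul1r.
by rewrite bl ?mul0r//; move: xl; rewrite inE /= subr0.
Qed.

Lemma psi_wave l (s A : R) b v al (x : V) :
  measurable_fun setT (fun p : L * L => b p.1 p.2) ->
  (forall xi, dcls s^-1 d.+1 A setT (b ^~ xi)) -> supported_in l b -> Rintegrable lam v ->
  psi b v al x = wave b (cut l v 0) al x + wave b (cut l v (- (pi / 2))) (al - pi / 2) x.
Proof.
move=> mb bA bl vi; rewrite /psi /wave.
have i0 := wave_int mb bA (cut_int l 0 vi) al x.
have i1 := wave_int mb bA (cut_int l (- (pi / 2)) vi) (al - pi / 2) x.
rewrite -(RintegralD _ i0 i1)//; apply: eq_Rintegral => xi _.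
rewrite psi_inner// mulrDr; congr (_ + _).
  by rewrite mulrCA (mul_cut _ _ _ _ bl) oscC.
by rewrite mulrCA (mul_cut _ _ _ _ bl) oscC.
Qed.

Lemma measurable_psi l (s A : R) b v al :
  measurable_fun setT (fun p : L * L => b p.1 p.2) ->
  (forall xi, dcls s^-1 d.+1 A setT (b ^~ xi)) -> supported_in l b -> Rintegrable lam v ->
  measurable_fun setT (psi b v al : L -> R).
Proof.
move=> mb bA bl vi.
rewrite (_ : psi b v al = fun x => wave b (cut l v 0) al x +
    wave b (cut l v (- (pi / 2))) (al - pi / 2) x); last first.
  by apply/funext => x; exact: (psi_wave al x mb bA bl vi).
exact: (measurable_funD (measurable_wave mb (cut_int l 0 vi) al)
  (measurable_wave mb (cut_int l (- (pi / 2)) vi) (al - pi / 2))).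
Qed.

(** The Bessel bound is used twice: for [b] acting on [cut], and for the constant symbol 1 on the
    frequency cube of radius [l], with space and frequency exchanged, where it plays the part of
    Plancherel's inequality. Uniformity in the scale removes [l] from the constant; the factor 4
    comes from splitting into two waves. *)
Lemma psi_bessel : exists2 C : R, 0 <= C &
  forall (s A l : R) (z : V) b v al, 0 < s -> 0 < l ->
  measurable_fun setT (fun p : L * L => b p.1 p.2) ->
  (forall xi, dcls s^-1 d.+1 A setT (b ^~ xi)) -> supported_in l b -> Rintegrable lam v ->
  (energy z s (psi b v al) <= (C * A ^+ 2)%:E * \int[lam]_x (v x ^+ 2)%:E)%E.
Proof.
have [C C0 bes] := @bessel_exists R d.
exists (4 * C ^+ 2); first by rewrite mulr_ge0// exprn_ge0.
move=> s A l z b v al s0 l0 mb bA bl vi.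
set Iv := (\int[lam]_x (v x ^+ 2)%:E)%E.
have cutE be : (\int[lam]_x (cut l v be x ^+ 2)%:E <= C%:E * Iv)%E.
  have h := bes l 1 0 (fun _ _ => 1) v be l0 (measurable_cst _) _ vi.
  apply: le_trans (le_trans (h _) _); last by rewrite expr1n mulr1.
    rewrite le_eqVlt; apply/orP; left; apply/eqP.
    apply: eq_integral => x _; congr EFin.
    rewrite /cut exprMn; congr (_ * _ ^+ 2).
      by rewrite indicE; case: (_ \in _); rewrite ?expr1n ?expr0n.
    by rewrite /vhat /wave; apply: eq_Rintegral => y _; rewrite mul1r oscC.
  by move=> xi; have := @dcls_cst R d l^-1 d.+1 1; rewrite normr1; exact.
have A20 : 0 <= C * A ^+ 2 by rewrite mulr_ge0// sqr_ge0.
have waveE be be' : (energy z s (wave b (cut l v be) be') <= (C * A ^+ 2)%:E * (C%:E * Iv))%E.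
  apply: le_trans (bes s A z b (cut l v be) be' s0 mb bA (cut_int l be vi)) _.
  by apply: lee_wpmul2l; [rewrite lee_fin|exact: cutE].
rewrite (_ : psi b v al = fun x => wave b (cut l v 0) al x +
    wave b (cut l v (- (pi / 2))) (al - pi / 2) x); last first.
  by apply/funext => x; exact: (psi_wave al x mb bA bl vi).
apply: le_trans (energyD _ _ (measurable_wave mb (cut_int l 0 vi) al)
  (measurable_wave mb (cut_int l (- (pi / 2)) vi) (al - pi / 2))) _.
apply: (@le_trans _ _ (2%:E * ((C * A ^+ 2)%:E * (C%:E * Iv)) +
   2%:E * ((C * A ^+ 2)%:E * (C%:E * Iv)))%E).
  by apply: leeD; apply: lee_wpmul2l => //; exact: waveE.
have K0 : (0 <= (2 * (C * A ^+ 2) * C)%:E)%E by rewrite lee_fin mulr_ge0// mulr_ge0.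
rewrite !muleA -!EFinM -(ge0_muleDl _ K0 K0) -EFinD.
by rewrite (_ : 2 * (C * A ^+ 2) * C + 2 * (C * A ^+ 2) * C = 4 * C ^+ 2 * A ^+ 2)//; ring.
Qed.

(** As [b x] is bounded with bounded support, [|b x xi| * |v y|] is an integrable majorant. Fubini
    then exhibits an integral kernel, on which a factor [y 0 j] of [v] can act. *)
Lemma psi_kernel (x : V) A l b v al : (forall xi, `|b x xi| <= A) ->
  measurable_fun setT (b x : L -> R) -> supported_in l b -> Rintegrable lam v ->
  psi b v al x = \int[lam]_y (v y * \int[lam]_xi (osc (x - y) al xi * b x xi)) /\
  Rintegrable lam (fun y => v y * \int[lam]_xi (osc (x - y) al xi * b x xi)).
Proof.
move=> bA mbx bl vi.
pose F (xi y : V) := b x xi * (osc xi al (x - y) * v y).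
have bi : Rintegrable lam (b x).
  by apply: (@bounded_supp_Rintegrable R d _ 0 l A) => // xi; rewrite subr0; exact: bl.
have bi' := Rintegrable_norm bi.
have vi' := Rintegrable_norm vi.
have mF : measurable_fun setT (fun p : L * L => F p.1 p.2).
  apply: measurable_funM; first exact: (measurable_comp1 mbx).
  apply: measurable_funM; last by apply: measurable_comp2; exact: Rintegrable_meas vi.
  apply: measurable_osc => i; last exact: measurable_coord1.
  exact: (measurableT_comp (measurable_coordB x i) measurable_snd).
have FM xi y : `|F xi y| <= `|b x xi| * `|v y|.
  rewrite /F !normrM; apply: ler_wpM2l => //.
  by rewrite ler_piMl// osc_le1.
have mF' : measurable_fun setT (fun p : L * L => F p.2 p.1).
  exact: (measurableT_comp mF (@measurable_swap _ _ L L)).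
have bo y : Rintegrable lam (fun xi => osc (x - y) al xi * b x xi).
  by apply: (osc_comp_int _ _ bi (f := id)) => i; exact: measurable_coord.
have E y : \int[lam]_xi F xi y = v y * \int[lam]_xi (osc (x - y) al xi * b x xi).
  rewrite -(@RintegralZl _ L R lam setT _ (v y) measurableT (bo y)).
  apply: eq_Rintegral => xi _.
  by rewrite /F [osc (x - y) al xi]oscC; ring.
split.
  transitivity (\int[lam]_xi \int[lam]_y F xi y).
    apply: eq_Rintegral => xi _; rewrite /F (@RintegralZl _ L R lam)//.
    by apply: (osc_comp_int _ _ vi (f := fun y => x - y)) => i; exact: measurable_coordB.
  rewrite (Rintegral_Fubini mF bi' vi' FM).
  by apply: eq_Rintegral => y _; exact: E.
have FI : Rintegrable lam (fun y => \int[lam]_xi F xi y).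
  apply: (@Rintegrable_param _ _ L L R lam lam (fun y xi => F xi y) mF' _ _ vi' bi') => y xi.
  by rewrite [leRHS]mulrC; exact: FM.
suff -> : (fun y => v y * \int[lam]_xi (osc (x - y) al xi * b x xi)) =
    fun y => \int[lam]_xi F xi y by [].
by apply/funext => y; rewrite E.
Qed.

Lemma psi_commute (s A l : R) (z x : V) b b' v j al : 0 < s ->
  continuous (b x) -> continuous (b' x) -> (forall xi, `|b x xi| <= A) ->
  (forall xi, `|b' x xi| <= A) -> supported_in l b -> supported_in l b' ->
  (forall xi, is_derive xi (evec R j) (b x) (s * b' x xi)) ->
  Rintegrable lam v -> Rintegrable lam (fun y => (y 0 j - z 0 j) / s * v y) ->
  psi b (fun y => (y 0 j - z 0 j) / s * v y) al x =
  (x 0 j - z 0 j) / s * psi b v al x + psi b' v (al - pi / 2) x.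
Proof.
move=> s0 cb cb' bA b'A bl b'l db vi qvi.
have s1 : s != 0 by rewrite gt_eqF.
have mb := continuous_measurable cb; have mb' := continuous_measurable cb'.
have [-> _] := psi_kernel al bA mb bl qvi.
have [-> i1] := psi_kernel al bA mb bl vi.
have [-> i2] := psi_kernel (al - pi / 2) b'A mb' b'l vi.
rewrite -(@RintegralZl _ L R lam setT _ ((x 0 j - z 0 j) / s) measurableT i1).
rewrite -(RintegralD measurableT (RintegrableZ _ i1) i2).
apply: eq_Rintegral => y _.
have b0 (xi : V) : ~ `|xi - 0| < l -> b x xi = 0 by rewrite subr0; exact: bl.
have b0' (xi : V) : ~ `|xi - 0| < l -> b' x xi = 0 by rewrite subr0; exact: b'l.
have := osc_ibp (x - y) al cb bA b0 cb' b'A b0' db.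
rewrite !mxE; move: (Rintegral _ _ _) (Rintegral _ _ _) => I' I H.
have -> : I' = - ((x 0 j - y 0 j) * I) / s by rewrite H; field.
by field.
Qed.

End Multipliers.

(** * Weighted local bounds *)

Section WeightedEstimate.
Variables (R : realType) (d : nat).
Local Notation V := 'rV[R]_d.
Local Notation L := (LebRd R d).
Local Notation lam := (@lebRd R d).
Implicit Types (b : V -> V -> R) (v : V -> R) (s A l : R) (j : 'I_d) (z : V).

(** A class stable under multiplication by polynomials and by bounded measurable functions, so that
    f / weight and its products with powers of coordinates stay in it. *)
Definition rapid v := measurable_fun setT (v : L -> R) /\
  forall n : nat, exists C : R, forall x, `|x| ^+ n * `|v x| <= C.

Lemma rapid_int v : rapid v -> Rintegrable lam v.
Proof.
move=> [mv decv].
have [C0 h0] := decv 0%N; have [C1 h1] := decv d.+1.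
apply: (@le_Rintegrable _ L R lam _ (fun x : V => (C0 + C1) * kappa 1 (x - 0))) => //.
- move=> x; rewrite /kappa subr0 expr1n !mul1r ler_pdivlMr.
    by rewrite mulrDr mulr1 mulrC; have := h0 x; have := h1 x; rewrite expr0 mul1r mulrC; lra.
  by rewrite ltr_pwDl// exprn_ge0.
- by apply: RintegrableZ; exact: kappa_Rintegrable.
Qed.

Lemma rapidM (g : V -> R) M v : measurable_fun setT (g : L -> R) ->
  (forall x, `|g x| <= M) -> rapid v -> rapid (fun x => g x * v x).
Proof.
move=> mg gM [mv decv]; split; first exact: (measurable_funM mg mv).
move=> n; have [C h] := decv n; exists (M * C) => x.
by rewrite normrM mulrCA; apply: ler_pM => //; rewrite mulr_ge0// exprn_ge0.
Qed.

Lemma continuous_qcoord s j z : continuous (fun y : V => (y 0 j - z 0 j) / s).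
Proof.
move=> y; have cc (k : R) : (fun _ : V => k) @ y --> k by exact: (@cvg_cst _ k _ (nbhs y) _).
exact: (cvgM (cvgB (@coord_continuous _ _ _ 0 j y) (cc (z 0 j))) (cc s^-1)).
Qed.

Lemma measurable_qcoord s j z : measurable_fun setT (fun y : L => (y 0 j - z 0 j) / s).
Proof. by have := continuous_measurable (@continuous_qcoord s j z); exact. Qed.

Lemma rapid_coord s j z v : rapid v -> rapid (fun y : V => (y 0 j - z 0 j) / s * v y).
Proof.
move=> [mv decv]; split.
  exact: (measurable_funM (measurable_qcoord s j z) mv).
move=> n; have [C h] := decv n; have [C' h'] := decv n.+1.
exists ((C' + `|z| * C) * `|s^-1|) => x.
rewrite !normrM; apply: (@le_trans _ _ (`|x| ^+ n * (((`|x| + `|z|) * `|s^-1|) * `|v x|))).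
  apply: ler_wpM2l; first exact: exprn_ge0.
  apply: ler_wpM2r => //; apply: ler_wpM2r => //.
  by apply: (le_trans (ler_normB _ _)); apply: lerD; exact: coord_le_norm.
rewrite (_ : _ * _ = (`|x| ^+ n.+1 * `|v x| + `|z| * (`|x| ^+ n * `|v x|)) * `|s^-1|).
  by rewrite ler_wpM2r// lerD// ler_wpM2l.
by rewrite exprS; ring.
Qed.

Lemma rapid_coordX s j z k v : rapid v -> rapid (fun y : V => ((y 0 j - z 0 j) / s) ^+ k * v y).
Proof.
move=> rv; elim: k => [|k IH].
  have -> : (fun y : V => ((y 0 j - z 0 j) / s) ^+ 0 * v y) = v; last by [].
  by apply/funext => y; rewrite mul1r.
have -> : (fun y : V => ((y 0 j - z 0 j) / s) ^+ k.+1 * v y) =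
    fun y : V => (y 0 j - z 0 j) / s * (((y 0 j - z 0 j) / s) ^+ k * v y).
  by apply/funext => y; rewrite exprS mulrA.
exact: rapid_coord.
Qed.

Lemma rapidD v w : rapid v -> rapid w -> rapid (fun x => v x + w x).
Proof.
move=> [mv hv] [mw hw]; split; first exact: (measurable_funD mv mw).
move=> n; have [C h] := hv n; have [C' h'] := hw n; exists (C + C') => x.
apply: (@le_trans _ _ (`|x| ^+ n * (`|v x| + `|w x|))).
  by rewrite ler_wpM2l ?exprn_ge0// ler_normD.
by rewrite mulrDr lerD.
Qed.

(** The two kinds of derivative scale inversely: [n] in xi_j, in units of [s], for commutations, and
    d+1 in [x], in units of 1 / s, for the Bessel bound, which must hold for every
    xi_j-derivative. *)
Fixpoint symc s A l j n b : Prop :=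
  [/\ measurable_fun setT (fun p : L * L => b p.1 p.2),
   forall xi, dcls s^-1 d.+1 A setT (b ^~ xi), supported_in l b,
   forall x, continuous (b x) &
   if n is n'.+1 then
     exists b', (forall x xi, is_derive xi (evec R j) (b x) (s * b' x xi)) /\
                symc s A l j n' b'
   else True].

Lemma symc_base s A l j n b : symc s A l j n b ->
  [/\ measurable_fun setT (fun p : L * L => b p.1 p.2),
   forall xi, dcls s^-1 d.+1 A setT (b ^~ xi), supported_in l b &
   forall x, continuous (b x)].
Proof. by case: n => [|n] []. Qed.

Lemma symcW s A l j n b : symc s A l j n.+1 b -> symc s A l j n b.
Proof.
elim: n b => [|n IH] b [mb bA bl cb [b' [db b'n]]]; first by split.
by split => //; exists b'; split => //; exact: IH.
Qed.

(** Commute one factor (y_j - z_j) / s at a time. It comes out as (x_j - z_j) / s, at most 1 in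
    modulus on the cube, plus a term with the differentiated symbol. Both keep one power less, and
    adding them costs the factor 4. *)
Lemma psi_weighted : exists2 C : R, 0 <= C &
  forall s A l j n b z v al, 0 < s -> 0 < l -> symc s A l j n b -> rapid v ->
  (energy z s (psi b (fun y : V => ((y 0 j - z 0 j) / s) ^+ n * v y)%R al) <=
   (4 ^+ n * C * A ^+ 2)%:E * \int[lam]_x (v x ^+ 2)%:E)%E.
Proof.
have [C C0 bes] := @psi_bessel R d; exists C => // s A l j n b z v al s0 l0.
elim: n b al => [|n IH] b al bn rv.
  have [mb bA bl cb] := symc_base bn.
  have -> : (fun y : V => ((y 0 j - z 0 j) / s) ^+ 0 * v y) = v.
    by apply/funext => y; rewrite mul1r.
  by rewrite expr0 mul1r; exact: (bes _ _ _ _ _ _ _ s0 l0 mb bA bl (rapid_int rv)).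
have [mb bA bl cb] := symc_base bn; have bn1 := symcW bn.
case: bn => _ _ _ _ [b' [db b'n]]; have [mb' b'A b'l cb'] := symc_base b'n.
have b_le x xi : `|b x xi| <= A by have [_ + _ _] := bA xi; exact.
have b'_le x xi : `|b' x xi| <= A by have [_ + _ _] := b'A xi; exact.
pose w (y : V) := ((y 0 j - z 0 j) / s) ^+ n * v y.
have rw : rapid w by exact: rapid_coordX.
have rqw : rapid (fun y : V => (y 0 j - z 0 j) / s * w y) by exact: rapid_coord.
have E x : psi b (fun y : V => ((y 0 j - z 0 j) / s) ^+ n.+1 * v y) al x =
    (x 0 j - z 0 j) / s * psi b w al x + psi b' w (al - pi / 2) x.
  rewrite -(psi_commute al s0 (cb x) (cb' x) (b_le x) (b'_le x) bl b'l (db x)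
    (rapid_int rw) (rapid_int rqw)).
  by congr (psi b _ al x); apply/funext => y; rewrite /w exprS mulrA.
rewrite (_ : psi b _ al = fun x => (x 0 j - z 0 j) / s * psi b w al x +
    psi b' w (al - pi / 2) x); last by apply/funext => x; exact: E.
have m1 := measurable_psi al mb bA bl (rapid_int rw).
have m2 := measurable_psi (al - pi / 2) mb' b'A b'l (rapid_int rw).
have mq := measurable_qcoord s j z.
apply: (le_trans (energyD z s (measurable_funM mq m1) m2)).
have q1 (x : V) : `|x - z| < s -> `|(x 0 j - z 0 j) / s| <= 1.
  move=> xz; rewrite normrM normfV (gtr0_norm s0) ler_pdivrMr// mul1r ltW//.
  by apply: le_lt_trans xz; have := coord_le_norm (x - z) j; rewrite !mxE.
have e1 := le_trans (energyM_le m1 q1) (IH b al bn1 rv).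
have e2 := IH b' (al - pi / 2) b'n rv.
set Iv := (\int[lam]_x (v x ^+ 2)%:E)%E in e1 e2 *.
apply: (@le_trans _ _ (2%:E * ((4 ^+ n * C * A ^+ 2)%:E * Iv) +
    2%:E * ((4 ^+ n * C * A ^+ 2)%:E * Iv))%E).
  by apply: leeD; apply: lee_wpmul2l.
have K0 : (0 <= (2 * (4 ^+ n * C * A ^+ 2))%:E)%E.
  by rewrite lee_fin mulr_ge0// mulr_ge0 ?sqr_ge0// mulr_ge0// exprn_ge0.
rewrite !muleA -!EFinM -(ge0_muleDl _ K0 K0) -EFinD (exprS 4 n).
by rewrite (_ : 2 * (4 ^+ n * C * A ^+ 2) + 2 * (4 ^+ n * C * A ^+ 2) =
   4 * 4 ^+ n * C * A ^+ 2)//; move: (4 ^+ n) => u; ring.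
Qed.

Lemma psiD A l b v w al (x : V) : (forall xi, `|b x xi| <= A) ->
  measurable_fun setT (b x : L -> R) -> supported_in l b ->
  Rintegrable lam v -> Rintegrable lam w ->
  psi b (fun y => v y + w y) al x = psi b v al x + psi b w al x.
Proof.
move=> bA mbx bl vi wi.
have [-> _] := psi_kernel al bA mbx bl (RintegrableD vi wi).
have [-> i1] := psi_kernel al bA mbx bl vi.
have [-> i2] := psi_kernel al bA mbx bl wi.
by rewrite -(RintegralD measurableT i1 i2); apply: eq_Rintegral => y _; rewrite mulrDl.
Qed.

(** Even powers keep it at least 1, and the coordinate attaining the sup norm makes it dominate (|y
    - z| / s)^(2n). *)
Definition weight n s z (y : V) : R := 1 + \sum_(j < d) ((y 0 j - z 0 j) / s) ^+ n.*2.

Lemma weight_ge1 n s z y : 1 <= weight n s z y.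
Proof.
by rewrite lerDl sumr_ge0// => j _; rewrite -mul2n exprM exprn_ge0// sqr_ge0.
Qed.

Lemma continuous_weightV n s z : continuous (fun y => (weight n s z y)^-1).
Proof.
move=> y; have n0 : weight n s z y != 0 by rewrite gt_eqF// (lt_le_trans ltr01)// weight_ge1.
suff cw : (fun y : V => \sum_(j < d) ((y 0 j - z 0 j) / s) ^+ n.*2) @ y -->
    \sum_(j < d) ((y 0 j - z 0 j) / s) ^+ n.*2.
  exact: (cvgV n0 (cvgD (@cvg_cst _ (1 : R) _ (nbhs y) _) cw)).
elim: (index_enum _) => [|j r IH].
  rewrite big_nil; under eq_fun do rewrite big_nil.
  exact: (@cvg_cst _ (0 : R) _ (nbhs y) _).
rewrite big_cons; under eq_fun do rewrite big_cons.
exact: (cvgD (continuous_cvg _ (@exprn_continuous R n.*2 _) (@continuous_qcoord s j z y)) IH).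
Qed.

(* Write [f = u + sum_j q_j^(2n) u] with [q_j = (y_j - z_j) / s] and
   [u = f / weight]: commuting the powers of [q_j], which are bounded on the
   cube, through the operator only costs [xi_j]-derivatives of the symbol. *)
Lemma psi_local n : exists2 C : R, 0 <= C &
  forall s A l b z f al, 0 < s -> 0 < l ->
  measurable_fun setT (fun p : L * L => b p.1 p.2) ->
  (forall xi, dcls s^-1 d.+1 A setT (b ^~ xi)) -> supported_in l b ->
  (forall x, continuous (b x)) -> (forall j, symc s A l j n.*2 b) -> rapid f ->
  (energy z s (psi b f al) <=
   (C * A ^+ 2)%:E * \int[lam]_x ((f x / weight n s z x) ^+ 2)%:E)%E.
Proof.
have [C0 C00 bes] := @psi_bessel R d; have [C1 C10 wei] := psi_weighted.
(* [K k] is the constant once [k] coordinates have been added to [u], each addition doubling both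
   energies; it depends on [n] and [d] only. *)
pose K : nat -> R := fix K k := if k is k'.+1 then 2 * (4 ^+ n.*2 * C1) + 2 * K k' else C0.
have K0 k : 0 <= K k.
  by elim: k => //= k IH; rewrite addr_ge0// mulr_ge0// mulr_ge0// exprn_ge0.
exists (K (size (index_enum 'I_d))) => //.
move=> s A l b z f al s0 l0 mb bA bl cb bsym rf.
pose u y := (weight n s z y)^-1 * f y.
have w1 y : 0 < weight n s z y by apply: lt_le_trans (weight_ge1 _ _ _ _).
have ru : rapid u.
  apply: (@rapidM _ 1) rf; first by have := continuous_measurable (@continuous_weightV n s z); exact.
  by move=> y; rewrite gtr0_norm ?invr_gt0// invf_le1// weight_ge1.
have -> : (\int[lam]_x ((f x / weight n s z x) ^+ 2)%:E =
    \int[lam]_x (u x ^+ 2)%:E)%E.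
  by apply: eq_integral => x _; rewrite /u mulrC.
set Iu := (\int[lam]_x (u x ^+ 2)%:E)%E.
have Iu0 : (0 <= Iu)%E by apply: integral_ge0 => x _; rewrite lee_fin sqr_ge0.
have b_le x xi : `|b x xi| <= A by have [_ + _ _] := bA xi; exact.
pose q (j : 'I_d) (y : V) := ((y 0 j - z 0 j) / s) ^+ n.*2 * u y.
have rq j : rapid (q j) by exact: rapid_coordX.
have -> : f = fun y => u y + \sum_(j <- index_enum 'I_d) q j y.
  apply/funext => y; rewrite /q -mulr_suml -{1}[u y]mul1r -mulrDl.
  by rewrite -/(weight n s z y) /u mulrA mulfV ?mul1r// gt_eqF.
suff [] : (energy z s (psi b (fun y => u y + \sum_(j <- index_enum 'I_d) q j y)%R al) <=
     (K (size (index_enum 'I_d)) * A ^+ 2)%:E * Iu)%E /\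
     rapid (fun y => u y + \sum_(j <- index_enum 'I_d) q j y) by [].
elim: (index_enum _) => [|j r [IH rr]].
  have -> : (fun y => u y + \sum_(j <- [::]) q j y) = u.
    by apply/funext => y; rewrite big_nil addr0.
  by split => //; exact: (bes _ _ _ _ _ _ _ s0 l0 mb bA bl (rapid_int ru)).
have -> : (fun y => u y + \sum_(k <- j :: r) q k y) =
    fun y => q j y + (u y + \sum_(k <- r) q k y).
  by apply/funext => y; rewrite big_cons addrCA.
split; last exact: rapidD.
have mbx x := continuous_measurable (cb x).
rewrite (_ : psi b _ al = fun x => psi b (q j) al x +
    psi b (fun y => u y + \sum_(j <- r) q j y) al x); last first.
  by apply/funext => x; exact: (psiD al (b_le x) (mbx x) bl (rapid_int (rq j)) (rapid_int rr)).
apply: (le_trans (energyD z s (measurable_psi al mb bA bl (rapid_int (rq j)))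
  (measurable_psi al mb bA bl (rapid_int rr)))).
have e1 := wei s A l j n.*2 b z u al s0 l0 (bsym j) ru.
apply: (@le_trans _ _ (2%:E * ((4 ^+ n.*2 * C1 * A ^+ 2)%:E * Iu) +
    2%:E * ((K (size r) * A ^+ 2)%:E * Iu))%E).
  by apply: leeD; apply: lee_wpmul2l.
have P0 : (0 <= (2 * (4 ^+ n.*2 * C1 * A ^+ 2))%:E)%E.
  by rewrite lee_fin mulr_ge0// mulr_ge0 ?sqr_ge0// mulr_ge0// exprn_ge0.
have P1 : (0 <= (2 * (K (size r) * A ^+ 2))%:E)%E.
  by rewrite lee_fin mulr_ge0// mulr_ge0 ?sqr_ge0.
rewrite !muleA -!EFinM -(ge0_muleDl _ P0 P1) -EFinD /=.
by rewrite (_ : 2 * (4 ^+ n.*2 * C1 * A ^+ 2) + 2 * (K (size r) * A ^+ 2) =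
  (2 * (4 ^+ n.*2 * C1) + 2 * K (size r)) * A ^+ 2)//; move: (4 ^+ n.*2) => u'; ring.
Qed.

End WeightedEstimate.

(** * Averaging the local bounds over all cubes *)

Section Averaging.
Variables (R : realType) (d : nat).
Local Notation V := 'rV[R]_d.
Local Notation L := (LebRd R d).
Local Notation lam := (@lebRd R d).
Local Open Scope ereal_scope.

Definition cube_sup (w : V -> R) (s : R) (z : V) : \bar R :=
  ereal_sup [set (w x)%:E | x in [set x : V | (`|x - z| < s)%R]].

Lemma cube_sup_ge0 w s z : (0 < s)%R -> (forall x, 0 <= w x)%R -> 0 <= cube_sup w s z.
Proof.
move=> s0 w0; apply: (@le_trans _ _ (w z)%:E); first by rewrite lee_fin.
by apply: ereal_sup_ubound; exists z => //=; rewrite subrr normr0.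
Qed.

(** The cubes being open, a point at which [w] exceeds [t] remains in the cubes around nearby
    centres. Superlevel sets are thus open for every [w]. *)
Lemma measurable_cube_sup w s : measurable_fun setT (cube_sup w s : L -> \bar R).
Proof.
apply: (measurability _ (ErealGenOInfty.measurableE R)) => _ [_ [t ->] <-].
rewrite setTI; apply: open_measurableRd.
rewrite openE => z /=; rewrite in_itv/= andbT => /ereal_sup_gt[_ [x xz <-] tx].
apply/nbhs_ballP; exists (s - `|x - z|)%R => /=; first by rewrite subr_gt0.
move=> y; rewrite -ball_normE /= => zy.
rewrite in_itv/= andbT; apply: (lt_le_trans tx).
apply: ereal_sup_ubound; exists x => //=.
rewrite (_ : x - y = (x - z) + (z - y))%R; last by rewrite addrA subrK.
by apply: (le_lt_trans (ler_normD _ _)); rewrite addrC -ltrBrDr.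
Qed.

Variables (s : R) (w g f2 k : V -> R).
Hypotheses (s0 : (0 < s)%R) (w0 : forall x, (0 <= w x)%R)
  (mw : measurable_fun setT (w : L -> R))
  (g0 : forall x, (0 <= g x)%R) (mg : measurable_fun setT (g : L -> R))
  (f20 : forall x, (0 <= f2 x)%R) (mf2 : measurable_fun setT (f2 : L -> R))
  (k0 : forall x, (0 <= k x)%R) (ck : continuous k).
Hypothesis local_bound : forall z,
  \int[lam]_x (\1_[set x : V | `|x - z| < s] x * g x)%R%:E <=
  \int[lam]_y (f2 y * k (y - z))%R%:E.

Let W := cube_sup w s.
Let W0 z : 0 <= W z. Proof. exact: cube_sup_ge0. Qed.

Let mWk : measurable_fun setT (fun p : L * L => W p.1 * (k (p.2 - p.1 : V)%R)%:E).
Proof.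
apply: emeasurable_funM; first exact: (measurableT_comp (@measurable_cube_sup w s) measurable_fst).
by apply/measurable_EFinP; exact: measurable_continuous_diff.
Qed.

Let mWfk : measurable_fun setT
  (fun p : L * L => (f2 p.2)%:E * (W p.1 * (k (p.2 - p.1 : V)%R)%:E)).
Proof.
by apply: emeasurable_funM mWk; apply/measurable_EFinP; exact: (measurable_comp2 mf2).
Qed.

Let Wk0 z y : 0 <= W z * (k (y - z)%R)%:E.
Proof. by rewrite mule_ge0// lee_fin. Qed.

Let gw x : R := (g x * w x)%R.
Let mgw : measurable_fun setT (gw : L -> R). Proof. exact: (measurable_funM mg mw). Qed.
Let gw0 x : (0 <= gw x)%R. Proof. by rewrite mulr_ge0. Qed.

Let m1gw : measurable_fun setT
  (fun p : L * L => (\1_[set u : V | (`|u| < s)%R] (p.2 - p.1)%R * gw p.2)%R%:E).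
Proof.
apply/measurable_EFinP/measurable_funM; last exact: (measurable_comp2 mgw).
rewrite (_ : (fun p => _) = \1_[set p : L * L | (`|(p.2 - p.1 : V)| < s)%R]); last first.
  by apply/funext => p; rewrite !indicE; congr (_%:R); apply/idP/idP; rewrite !inE.
apply: measurable_indic.
have h := @measurable_preimage_cube R d _ (L * L)%type (fun p => (p.2 - p.1 : V)%R) _ 0%R s.
rewrite (_ : mkset _ = [set p : L * L | (`|(p.2 - p.1 : V) - 0| < s)%R]).
  apply: h => i; under eq_fun do rewrite !mxE.
  by apply: measurable_funB; [exact: measurable_coord2|exact: measurable_coord1].
by apply/seteqP; split => p /=; rewrite subr0.
Qed.

(* [w x] is the mean over [z] of [1_{|x - z| < s} w x], and on that cube it is
   at most [cube_sup w s z]. *)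
Lemma averaging_inequality :
  (s ^+ d)%:E * lam [set x : V | (`|x| < 1)%R] * \int[lam]_x (g x * w x)%R%:E <=
  \int[lam]_y ((f2 y)%:E * \int[lam]_z (W z * (k (y - z)%R)%:E)).
Proof.
have v0 : 0 <= (s ^+ d)%:E * lam [set x : V | (`|x| < 1)%R].
  by rewrite mule_ge0// lee_fin exprn_ge0// ltW.
have p1 (p : L * L) : 0 <= (\1_[set u : V | (`|u| < s)%R] (p.2 - p.1)%R * gw p.2)%R%:E.
  by rewrite lee_fin mulr_ge0.
have mgwE : measurable_fun setT (fun x : L => (gw x)%:E) by exact/measurable_EFinP.
have gwE0 (x : L) : 0 <= (gw x)%:E by rewrite lee_fin.
rewrite -/(gw _) -(ge0_integralZl lam measurableT mgwE (fun x _ => gwE0 x) v0).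
have E x : (s ^+ d)%:E * lam [set x : V | (`|x| < 1)%R] * (gw x)%:E =
    \int[lam]_z (\1_[set u : V | (`|u| < s)%R] (x - z)%R * gw x)%R%:E.
  have mc : measurable ([set z : L | (`|(z : V) - x| < s)%R] : set L) by exact: measurable_cube.
  transitivity (\int[lam]_z ((gw x)%:E * (\1_[set z : V | (`|z - x| < s)%R] z)%:E)).
    have m1 : measurable_fun setT (fun z : L => (\1_[set z : V | (`|z - x| < s)%R] z : R)%:E).
      by apply/measurable_EFinP; exact: measurable_indic.
    have p (z : L) : 0 <= (\1_[set z : V | (`|z - x| < s)%R] z : R)%:E by rewrite lee_fin.
    rewrite (ge0_integralZl_EFin lam measurableT (fun z _ => p z) m1 (gw0 x)).
    by rewrite integral_indic// setIT muleC; congr (_ * _); rewrite -(lebRd_cube x s0).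
  apply: eq_integral => z _; rewrite -EFinM mulrC; congr (_ * _)%:E.
  have EB : (z \in [set z : V | (`|z - x| < s)%R]) = ((x - z)%R \in [set u : V | (`|u| < s)%R]).
    by apply/idP/idP; rewrite !inE /= distrC.
  by rewrite !indicE EB.
under eq_integral do rewrite E.
rewrite -(fubini_tonelli (m1 := lam) (m2 := lam) _ m1gw p1) /=.
have pT (p : L * L) : 0 <= (f2 p.2)%:E * (W p.1 * (k (p.2 - p.1 : V)%R)%:E).
  by rewrite mule_ge0// lee_fin.
have -> : \int[lam]_y ((f2 y)%:E * \int[lam]_z (W z * (k (y - z)%R)%:E)) =
    \int[lam]_y \int[lam]_z ((f2 y)%:E * (W z * (k (y - z)%R)%:E)).
  apply: eq_integral => y _.
  have mz : measurable_fun setT (fun z : L => W z * (k (y - z)%R)%:E).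
    exact: (measurableT_comp mWk (pair2_measurable (y : L))).
  by rewrite (ge0_integralZl_EFin lam measurableT (fun z _ => Wk0 z y) mz (f20 y)).
rewrite -(fubini_tonelli (m1 := lam) (m2 := lam) _ mWfk pT) /=.
apply: ge0_le_integralW => z; first by apply: integral_ge0 => x _; exact: p1 (z, x).
have m1g : measurable_fun setT (fun x : L => (\1_[set x : V | `|x - z| < s] x * g x)%R%:E).
  apply/measurable_EFinP; apply: measurable_funM mg.
  by apply: measurable_indic; exact: measurable_cube.
have p1g (x : L) : 0 <= (\1_[set x : V | `|x - z| < s] x * g x)%R%:E.
  by rewrite lee_fin mulr_ge0.
apply: (@le_trans _ _ (W z * \int[lam]_x (\1_[set x : V | `|x - z| < s] x * g x)%R%:E)).
  rewrite -(ge0_integralZl lam measurableT m1g (fun x _ => p1g x) (W0 z)).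
  apply: ge0_le_integralW => x; first exact: p1 (z, x).
  rewrite !indicE; have [xz|xz] := pselect (`|x - z| < s)%R; last first.
    by rewrite /= memNset// memNset// !mul0r mule0.
  rewrite !mem_set// !mul1r /gw mulrC EFinM; apply: lee_wpmul2r; first by rewrite lee_fin.
  by apply: ereal_sup_ubound; exists x.
have mfk : measurable_fun setT (fun y : L => (f2 y * k (y - z))%R%:E).
  apply/measurable_EFinP; apply: (measurable_funM mf2).
  exact: (measurableT_comp (measurable_continuous_diff ck) (pair1_measurable (z : L))).
have pfk (y : L) : 0 <= (f2 y * k (y - z))%R%:E by rewrite lee_fin mulr_ge0.
apply: (le_trans (lee_wpmul2l (W0 z) (local_bound z))).
rewrite -(ge0_integralZl lam measurableT mfk (fun y _ => pfk y) (W0 z)).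
apply: ge0_le_integralW => y; first by rewrite mule_ge0.
by rewrite EFinM muleCA.
Qed.

End Averaging.

(** * Euclidean norm against sup norm; degenerate measure *)

Section NormComparison.
Variables (R : realType) (d : nat).
Local Notation V := 'rV[R]_d.
Local Notation L := (LebRd R d).
Local Notation lam := (@lebRd R d).
Implicit Types x : V.

Lemma enorm_ge0 x : 0 <= enorm x.
Proof. exact: sqrtr_ge0. Qed.

Lemma norm_le_enorm x : `|x| <= enorm x.
Proof.
apply: rV_norm_le => [|i]; first exact: enorm_ge0.
rewrite -sqrtr_sqr /enorm ler_wsqrtr// /dotv (bigD1 i)//= -expr2 lerDl.
by apply: sumr_ge0 => j _; rewrite -expr2 sqr_ge0.
Qed.

(** The crude constant d+1 avoids the root of d and stays invertible for d = 0; the scale [s] and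
    the cutoff radii are divided by it. *)
Lemma enorm_le_norm x : enorm x <= d.+1%:R * `|x|.
Proof.
have n0 : 0 <= d.+1%:R * `|x| by rewrite mulr_ge0.
rewrite -(ger0_norm n0) -sqrtr_sqr /enorm ler_wsqrtr//.
apply: (@le_trans _ _ (\sum_(i < d) `|x| ^+ 2)).
  apply: ler_sum => i _; rewrite -expr2 -(real_normK (num_real _)).
  by rewrite lerXn2r ?nnegrE// coord_le_norm.
rewrite sumr_const card_ord exprMn -[leLHS]mulr_natl.
apply: ler_wpM2r; first exact: sqr_ge0.
by rewrite -natrX ler_nat expnS expn1; apply: leq_trans (leqnSn d) (leq_pmulr _ _).
Qed.

(** By [lebRd_cube] every cube is then null, and countably many cubes cover the space. *)
Lemma integral_lebRd_null : lam [set x : V | `|x| < 1] = 0%E ->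
  forall f : V -> \bar R, measurable_fun setT (f : L -> \bar R) -> (\int[lam]_x f x = 0)%E.
Proof.
move=> v0 f mf; apply: null_set_integral => //.
apply/eqP; rewrite eq_le measure_ge0 andbT.
pose F k : set L := [set x : V | `|x - 0| < k.+1%:R].
apply: (@le_trans _ _ (lam (\bigcup_k F k))).
  apply: le_outer_measure => x _; exists (Num.truncn `|x : V|) => //.
  by rewrite /F /= subr0; exact: truncnS_gt.
apply: (le_trans (outer_measure_sigma_subadditive (@leb_outer R d) F)).
rewrite eseries0// => k _ _; rewrite /F.
have := @lebRd_cube R d 0 k.+1%:R (ltr0Sn _ k); rewrite v0 mule0; exact.
Qed.

End NormComparison.

(** * The frequency cutoff to an annulus *)

Section Cutoff.
Variables (R : realType) (d : nat).
Local Notation V := 'rV[R]_d.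
Implicit Types (F : V -> R) (S U : set V) (sg A K c : R) (j : 'I_d).

Lemma dcl_scale sg j n A K c S F : `|c| <= K ->
  dcl sg j n A S F -> dcl sg j n (K * A) S (fun x => c * F x).
Proof.
move=> cK; elim: n F => [|n IH] F Fn; have A0 := dcl_ge0 Fn.
all: case: Fn => cF FA FS F'n.
all: have ccF : continuous (fun x => c * F x)
  by move=> x; exact: (cvgM (@cvg_cst _ c _ (nbhs x) _) (cF x)).
all: have cFA x : `|c * F x| <= K * A by rewrite normrM ler_pM.
all: have cFS x : ~ S x -> c * F x = 0 by move=> Sx; rewrite FS ?mulr0.
  by split.
split => //; case: F'n => F' [dF F'n].
exists (fun x => c * F' x); split; last exact: IH.
by move=> x; apply: (is_derive_eq (is_deriveZ c (dF x))); rewrite -[LHS]/(c * (sg * F' x)); ring.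
Qed.

(** Changing the unit multiplies each normalised derivative by another [sg / sg'], which is at most
    [K]. *)
Lemma dcl_rescale sg sg' j n A K S F : 0 < sg -> 0 < sg' -> sg <= K * sg' -> 1 <= K ->
  dcl sg j n A S F -> dcl sg' j n (K ^+ n * A) S F.
Proof.
move=> sg0 sg'0 sgK K1; have K0 : 0 <= K by exact: le_trans K1.
elim: n F => [|n IH] F Fn; have A0 := dcl_ge0 Fn; case: Fn => cF FA FS F'n.
  by split => // x; rewrite expr0 mul1r.
have KA x : `|F x| <= K ^+ n.+1 * A.
  by apply: (le_trans (FA x)); rewrite ler_peMl// exprn_ege1.
split => //; case: F'n => F' [dF F'n].
exists (fun x => sg / sg' * F' x); split.
  by move=> x; rewrite mulrA mulrCA mulfV ?gt_eqF// mulr1.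
rewrite exprS -mulrA; apply: dcl_scale; last exact: IH.
by rewrite gtr0_norm ?divr_gt0// ler_pdivrMr.
Qed.

(** A function vanishing on an open set has vanishing derivative there, so the support shrinks at
    every order. It serves for 1 - [bump], which a priori lives on the whole space. *)
Lemma dcl_zero_on_open sg j n A S U F : sg != 0 -> open U -> (forall x, U x -> F x = 0) ->
  dcl sg j n A S F -> dcl sg j n A (S `\` U) F.
Proof.
move=> sg0 oU; elim: n F => [|n IH] F FU [cF FA FS F'n].
all: have FS' x : ~ (S `\` U) x -> F x = 0
  by move=> /not_andP[/FS//|/contrapT/FU].
  by split.
split => //; case: F'n => F' [dF F'n]; exists F'; split => //; apply: IH => // x Ux.
have d0 : is_derive x (evec R j) F 0.
  apply: near_eq_is_derive (is_derive_cst 0 x (evec R j)).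
  have : \forall y \near x, U y by exact: open_nbhs_nbhs.
  by apply: filterS => y /FU ->.
have := @derive_val _ _ _ _ _ _ _ d0; rewrite (@derive_val _ _ _ _ _ _ _ (dF x)) => /eqP.
by rewrite mulf_eq0 (negbTE sg0) => /eqP.
Qed.

Lemma dcl_subr1 sg j n A S F : dcl sg j n A S F ->
  dcl sg j n (1 + A) setT (fun x => 1 - F x).
Proof.
move=> Fn; have N1 : `|-1 : R| <= 1 by rewrite normrN normr1.
have := dclD (dcl_cst sg j n 1) (le_dcl (lexx _) (@subsetT _ S) (dcl_scale N1 Fn)).
rewrite normr1 mul1r (_ : (fun x => 1 + -1 * F x) = fun x => 1 - F x)//.
by apply/funext => x; rewrite mulN1r.
Qed.

(* Smooth, equal to 1 for [p <= |xi| <= q] and to 0 for [|xi| < p / 2] or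
   [|xi| >= 2 q] in sup norm. *)
Definition cutoff n (p q : R) (xi : V) : R :=
  bump n.+3 q 0 xi * (1 - bump n.+3 (p / 2) 0 xi).

Lemma cutoff_eq1 n p q xi : 0 < p -> 0 < q -> p <= `|xi| <= q -> cutoff n p q xi = 1.
Proof.
move=> p0 q0 /andP[pxi xiq]; rewrite /cutoff bump_eq1 ?subr0// mul1r.
(* The inner bump is supported within twice its radius p / 2, hence vanishes for |xi| >= p. *)
have [C _ /(_ (p / 2) 0)] := @dcls_bump R d n.
move=> []; first by rewrite divr_gt0.
move=> _ _ -> //; first by rewrite subr0.
by rewrite /= subr0; apply/negP; rewrite -leNgt; lra.
Qed.

(** The two bumps vary at rates 1 / q and 2 / p, which the last two hypotheses bound by [K * s]; so
    both can be rescaled to the unit [s] at a cost depending on [K] only. *)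
Lemma cutoff_dcls n K : 1 <= K -> exists2 B : R, 0 <= B &
  forall p q s : R, 0 < p -> 0 < q -> 0 < s ->
  (p / 2)^-1 <= K * s -> q^-1 <= K * s ->
  dcls s n B [set xi : V | p / 2 <= `|xi| < q *+ 2] (cutoff n p q).
Proof.
move=> K1; have K0 : 0 <= K by exact: le_trans K1.
have [C C0 bumpP] := @dcls_bump R d n.
pose B := 2 ^+ n * (K ^+ n * C * (1 + K ^+ n * C)).
have B0 : 0 <= B by rewrite !mulr_ge0 ?exprn_ge0// addr_ge0// mulr_ge0 ?exprn_ge0.
exists (C * (1 + C) + B); first by rewrite addr_ge0// mulr_ge0// addr_ge0.
move=> p q s p0 q0 s0 pK qK.
have p20 : 0 < p / 2 by rewrite divr_gt0.
have [cq qC qS djq] := bumpP q 0 q0; have [cp pC pS djp] := bumpP (p / 2) 0 p20.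
have oU : open [set xi : V | `|xi| < p / 2].
  rewrite (_ : mkset _ = ball (0 : V) (p / 2)); first exact: ball_open.
  by apply/seteqP; split => xi /=; rewrite -ball_normE /= sub0r normrN.
have U0 (xi : V) : [set xi : V | `|xi| < p / 2] xi -> 1 - bump n.+3 (p / 2) 0 xi = 0.
  by move=> /= /ltW h; rewrite bump_eq1 ?subr0// subrr.
split.
- move=> xi; exact: (cvgM (cq xi) (cvgB (@cvg_cst _ (1 : R) _ (nbhs xi) _) (cp xi))).
- move=> xi; apply: (@le_trans _ _ (C * (1 + C))); last by rewrite lerDl.
  rewrite normrM ler_pM// (le_trans (ler_normB _ _))// normr1.
  by have := pC xi; lra.
- move=> xi /= Sxi; rewrite /cutoff; have [xip|pxi] := ltP `|xi| (p / 2).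
    by rewrite U0 ?mulr0.
  by rewrite qS ?mul0r//= subr0 => xq; apply: Sxi; rewrite pxi xq.
move=> j.
have bq := dcl_rescale (etrans (invr_gt0 q) q0) s0 qK K1 (djq j).
have bp := dcl_rescale (etrans (invr_gt0 (p / 2)) p20) s0 pK K1 (djp j).
have s0' : s != 0 by rewrite gt_eqF.
have := dclM bq (dcl_zero_on_open s0' oU U0 (dcl_subr1 bp)).
apply: le_dcl => [|xi [] /= + [_ /negP]]; first by rewrite lerDr mulr_ge0// addr_ge0.
by rewrite subr0 -leNgt => -> ->.
Qed.

End Cutoff.

(** * Partial derivatives of a symbol on the joint space *)

Section JointDerivatives.
Variables (R : realType) (d : nat).
Local Notation V := 'rV[R]_d.
Local Notation L := (LebRd R d).
Local Notation lam := (@lebRd R d).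
Implicit Types (G : 'rV[R]_(d + d) -> R) (x xi : V) (j k : 'I_d).

Lemma smooth_pdiffs n t (G : 'rV[R]_n -> R) : smooth G -> smooth (pdiffs t G).
Proof. by move=> sG u x; have := sG (u ++ t) x; rewrite /pdiffs foldr_cat. Qed.

Lemma smooth_continuous n (G : 'rV[R]_n -> R) : smooth G -> continuous G.
Proof. by move=> sG x; apply: differentiable_continuous; exact: (sG [::] x). Qed.

Lemma measurable_joint G : continuous G ->
  measurable_fun setT (fun p : L * L => G (row_mx (p.1 : V) p.2)).
Proof.
move=> cG.
apply: (@measurable_fun_continuous_comp R _ _ (L * L)%type (fun p => row_mx (p.1 : V) p.2)) => // i.
have [k ->|k ->] := split_ordP i.
  by under eq_fun do rewrite row_mxEl; exact: measurable_coord1.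
by under eq_fun do rewrite row_mxEr; exact: measurable_coord2.
Qed.

Lemma continuous_row_mxl xi : continuous (fun x => row_mx x xi).
Proof.
move=> x A /nbhs_ballP[e /= e0 eA]; apply/nbhs_ballP; exists e => //= y.
rewrite -ball_normE /= => xy; apply: eA; rewrite -ball_normE /=.
apply: rV_norm_lt => // i; rewrite !mxE; case: fintype.splitP => k _.
  by have := le_lt_trans (coord_le_norm (x - y) k) xy; rewrite !mxE.
by rewrite subrr normr0.
Qed.

Lemma continuous_row_mxr x : continuous (fun xi => row_mx x xi).
Proof.
move=> xi A /nbhs_ballP[e /= e0 eA]; apply/nbhs_ballP; exists e => //= y.
rewrite -ball_normE /= => xy; apply: eA; rewrite -ball_normE /=.
apply: rV_norm_lt => // i; rewrite !mxE; case: fintype.splitP => k _.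
  by rewrite subrr normr0.
by have := le_lt_trans (coord_le_norm (xi - y) k) xy; rewrite !mxE.
Qed.

Lemma continuous_joint_l G xi : continuous G -> continuous (fun x => G (row_mx x xi)).
Proof. by move=> cG x; exact: (continuous_cvg _ (cG _) (@continuous_row_mxl xi x)). Qed.

Lemma continuous_joint_r G x : continuous G -> continuous (fun xi => G (row_mx x xi)).
Proof. by move=> cG xi; exact: (continuous_cvg _ (cG _) (@continuous_row_mxr x xi)). Qed.

Lemma is_derive_pdiff i G z : smooth G -> is_derive z (delta_mx 0 i) G (pdiff i G z).
Proof. by move=> sG; apply/derivableP/diff_derivable; exact: (sG [::] z). Qed.

Lemma is_derive_joint_l k G x xi : smooth G ->
  is_derive x (evec R k) (fun x => G (row_mx x xi)) (pdiff (lshift d k) G (row_mx x xi)).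
Proof.
move=> sG; apply/is_derive_line0.
have -> : (fun u : R => G (row_mx (x + u *: evec R k) xi)) =
    fun u : R => G (row_mx x xi + u *: delta_mx 0 (lshift d k)).
  apply/funext => u; congr G; apply/rowP => i; rewrite !mxE.
  case: fintype.splitP => i' ii'; rewrite ?mxE /=.
    by congr (_ + _ * (_ : bool)%:R); rewrite -val_eqE /= -[RHS]val_eqE /= ii'.
  rewrite -val_eqE /= ii' gtn_eqF ?mulr0 ?addr0//.
  by rewrite (leq_trans (ltn_ord k))// leq_addr.
exact: ((is_derive_line0 _ _ _ _).1 (is_derive_pdiff _ _ sG)).
Qed.

Lemma is_derive_joint_r j G x xi : smooth G ->
  is_derive xi (evec R j) (fun xi => G (row_mx x xi)) (pdiff (@rshift d d j) G (row_mx x xi)).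
Proof.
move=> sG; apply/is_derive_line0.
have -> : (fun u : R => G (row_mx x (xi + u *: evec R j))) =
    fun u : R => G (row_mx x xi + u *: delta_mx 0 (@rshift d d j)).
  apply/funext => u; congr G; apply/rowP => i; rewrite !mxE.
  case: fintype.splitP => i' ii'; rewrite ?mxE /=.
    rewrite -val_eqE /= ii' ltn_eqF ?mulr0 ?addr0//.
    by rewrite (leq_trans (ltn_ord i'))// leq_addr.
  by congr (_ + _ * (_ : bool)%:R); rewrite -val_eqE /= -[RHS]val_eqE /= ii' eqn_add2l.
exact: ((is_derive_line0 _ _ _ _).1 (is_derive_pdiff _ _ sG)).
Qed.

(** The factor [s ^+ l] puts the l-th derivative into the unit of the class, so one more
    differentiation merely raises [l]. *)
Lemma dcl_joint_l (s c A : R) k n l G xi : smooth G -> s != 0 ->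
  (forall i x, (i <= l + n)%N ->
     `|c * s ^+ i * pdiffs (nseq i (lshift d k)) G (row_mx x xi)| <= A) ->
  dcl s^-1 k n A setT
    (fun x => c * s ^+ l * pdiffs (nseq l (lshift d k)) G (row_mx x xi)).
Proof.
move=> sG s0; elim: n l => [|n IH] l GA.
all: have sGl := smooth_pdiffs (nseq l (lshift d k)) sG.
all: have cGl : continuous (fun x => c * s ^+ l * pdiffs (nseq l (lshift d k)) G (row_mx x xi))
  by move=> x; exact: (cvgM (@cvg_cst _ (c * s ^+ l) _ (nbhs x) _)
    (@continuous_joint_l _ xi (smooth_continuous sGl) x)).
all: have GlA x : `|c * s ^+ l * pdiffs (nseq l (lshift d k)) G (row_mx x xi)| <= A
  by apply: GA; rewrite leq_addr.
  by split => // x [].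
split => [|x|x []|]; [exact: cGl|exact: GlA|by []|].
exists (fun x => c * s ^+ l.+1 * pdiffs (nseq l.+1 (lshift d k)) G (row_mx x xi)).
split; last by apply: IH => i x il; apply: GA; rewrite addnS -addSn.
move=> x; apply: (is_derive_eq (is_deriveZ (c * s ^+ l) (is_derive_joint_l k x xi sGl))).
rewrite -[LHS]/(c * s ^+ l * pdiffs (nseq l.+1 (lshift d k)) G (row_mx x xi)).
by rewrite exprS; field.
Qed.

(* Like [symc], but without support condition and with bounds only on [S]. *)
Fixpoint prec (s A : R) j (n : nat) (S : set V) (b : V -> V -> R) : Prop :=
  [/\ measurable_fun setT (fun p : L * L => b p.1 p.2),
   forall xi, S xi -> dcls s^-1 d.+1 A setT (b ^~ xi),
   forall x, continuous (b x) &
   if n is n'.+1 then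
     exists b', (forall x xi, is_derive xi (evec R j) (b x) (s * b' x xi)) /\
                prec s A j n' S b'
   else True].

Lemma precW s A j n S b : prec s A j n.+1 S b -> prec s A j n S b.
Proof.
elim: n b => [|n IH] b [mb bA cb [b' [db b'n]]]; first by split.
by split => //; exists b'; split => //; exact: IH.
Qed.

Lemma dcls_joint_l (s c A : R) t G xi : smooth G -> s != 0 ->
  (forall x, `|c * pdiffs t G (row_mx x xi)| <= A) ->
  (forall i k x, (i <= d.+1)%N ->
     `|c * s ^+ i * pdiffs (nseq i (lshift d k) ++ t) G (row_mx x xi)| <= A) ->
  dcls s^-1 d.+1 A setT (fun x => c * pdiffs t G (row_mx x xi)).
Proof.
move=> sG s0 GA GkA; have sGt := smooth_pdiffs t sG.
split => [x||x []|k]; [|exact: GA|by []|].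
  exact: (cvgM (@cvg_cst _ c _ (nbhs x) _)
    (@continuous_joint_l _ xi (smooth_continuous sGt) x)).
have := @dcl_joint_l s c A k d.+1 0 (pdiffs t G) xi sGt s0.
rewrite expr0 mulr1; apply=> i x; rewrite add0n => id.
by have := GkA i k x id; rewrite /pdiffs foldr_cat.
Qed.

(** The derivatives in [xi] are taken first and those in [x] afterwards, which is the order in which
    [symb_deriv] composes them, so the symbol estimates apply as they stand. *)
Lemma prec_joint (s A : R) j S G N n0 n : smooth G -> s != 0 -> (n0 + n <= N)%N ->
  (forall l m k x xi, (l <= d.+1)%N -> (m <= N)%N -> S xi ->
    `|s ^- m * s ^+ l *
      pdiffs (nseq l (lshift d k) ++ nseq m (@rshift d d j)) G (row_mx x xi)| <= A) ->
  prec s A j n S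
    (fun x xi => s ^- n0 * pdiffs (nseq n0 (@rshift d d j)) G (row_mx x xi)).
Proof.
move=> sG s0 + GA; elim: n n0 => [|n IH] n0 n0N.
all: have sGn := smooth_pdiffs (nseq n0 (@rshift d d j)) sG; have cGn := smooth_continuous sGn.
all: have mGn : measurable_fun setT (fun p : L * L =>
    s ^- n0 * pdiffs (nseq n0 (@rshift d d j)) G (row_mx (p.1 : V) p.2))
  by apply: measurable_funM; [exact: measurable_cst|exact: measurable_joint].
all: have cbx x : continuous (fun xi =>
    s ^- n0 * pdiffs (nseq n0 (@rshift d d j)) G (row_mx x xi))
  by move=> xi; exact: (cvgM (@cvg_cst _ (s ^- n0) _ (nbhs xi) _)
    (@continuous_joint_r _ x cGn xi)).
all: have n0N' : (n0 <= N)%N by apply: leq_trans n0N; rewrite leq_addr.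
all: have dGn xi : S xi -> dcls s^-1 d.+1 A setT (fun x =>
    s ^- n0 * pdiffs (nseq n0 (@rshift d d j)) G (row_mx x xi))
  by move=> Sxi; apply: dcls_joint_l => // [x|i k x id];
    [have := GA 0%N n0 j x xi isT n0N' Sxi; rewrite expr0 mulr1|exact: GA].
  by split => // x [].
split => //.
exists (fun x xi => s ^- n0.+1 * pdiffs (nseq n0.+1 (@rshift d d j)) G (row_mx x xi)).
split; last by apply: IH; rewrite addSnnS.
move=> x xi; apply: (is_derive_eq (is_deriveZ (s ^- n0) (is_derive_joint_r j x xi sGn))).
rewrite -[LHS]/(s ^- n0 * pdiffs (nseq n0.+1 (@rshift d d j)) G (row_mx x xi)).
by rewrite exprS; field; rewrite expf_neq0 ?s0.
Qed.

Lemma symcD s A B l j n b1 b2 : symc s A l j n b1 -> symc s B l j n b2 ->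
  symc s (A + B) l j n (fun x xi => b1 x xi + b2 x xi).
Proof.
elim: n b1 b2 => [|n IH] b1 b2 H1 H2.
all: have [m1 A1 l1 c1] := symc_base H1; have [m2 A2 l2 c2] := symc_base H2.
all: have m12 := measurable_funD m1 m2.
all: have A12 xi := dclsD (A1 xi) (A2 xi).
all: have l12 : supported_in l (fun x xi => b1 x xi + b2 x xi)
  by move=> x xi xil; rewrite l1// l2// addr0.
all: have c12 x : continuous (fun xi => b1 x xi + b2 x xi)
  by move=> xi; exact: (cvgD (c1 x xi) (c2 x xi)).
  by split => // x [].
case: H1 => _ _ _ _ [b1' [d1 b1n]]; case: H2 => _ _ _ _ [b2' [d2 b2n]].
split => //; exists (fun x xi => b1' x xi + b2' x xi); split; last exact: IH.
by move=> x xi; rewrite mulrDr; exact: is_deriveD.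
Qed.

(** In [x] the cutoff is a constant factor, which costs 2^(d+1); in [xi] Leibniz' rule costs 2^n.
    Bounds for [b] on [S] suffice since [chi] and its derivatives vanish elsewhere. *)
Lemma symcM s A B l j n S b (chi : V -> R) : 0 <= A -> S `<=` [set xi : V | `|xi| < l] ->
  prec s A j n S b -> dcl s j n B S chi ->
  symc s (2 ^+ n * (2 ^+ d.+1 * (B * A))) l j n (fun x xi => b x xi * chi xi).
Proof.
move=> A0 Sl; elim: n b chi => [|n IH] b chi bn chin; have B0 := dcl_ge0 chin.
all: have [cchi chiB chiS] := dcl_base chin.
all: have [mb bA cb] : [/\ measurable_fun setT (fun p : L * L => b p.1 p.2),
   forall xi, S xi -> dcls s^-1 d.+1 A setT (b ^~ xi) & forall x, continuous (b x)]
   by case: bn.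
all: have mbchi : measurable_fun setT (fun p : L * L => b p.1 p.2 * chi p.2)
  by exact: (measurable_funM mb (measurable_comp2 (continuous_measurable cchi))).
all: have lbchi : supported_in l (fun x xi => b x xi * chi xi)
  by move=> x xi xil; rewrite chiS ?mulr0// => /Sl.
all: have cbchi x : continuous (fun xi => b x xi * chi xi)
  by move=> xi; exact: (cvgM (cb x xi) (cchi xi)).
all: have dbchi xi : dcls s^-1 d.+1 (2 ^+ d.+1 * (B * A)) setT (fun x => b x xi * chi xi).
  1, 3: have [Sxi|Sxi] := pselect (S xi).
  1, 3: rewrite (_ : (fun x => _) = fun x => chi xi * b x xi);
    last by apply/funext => x; rewrite mulrC.
  1, 2: apply: le_dcls (dclsZ (chi xi) (bA _ Sxi)) => //;
    rewrite ler_wpM2l ?exprn_ge0// ler_wpM2r//.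
  1, 2: rewrite (_ : (fun x => _) = fun=> 0); last by apply/funext => x; rewrite chiS ?mulr0.
  1, 2: apply: le_dcls (@dcls_cst R d s^-1 d.+1 0) => //;
    by rewrite normr0 mulr_ge0 ?exprn_ge0// mulr_ge0.
- by split => //; rewrite expr0 mul1r.
- have bn1 := precW bn; have chin1 := dclW chin.
  case: bn => _ _ _ [b' [db b'n]]; case: chin => _ _ _ [chi' [dchi chi'n]].
  split => //.
    move=> xi; apply: le_dcls (dbchi xi) => //.
    by rewrite ler_peMl ?mulr_ge0 ?exprn_ge0// exprn_ege1// ler1n.
  exists (fun x xi => b' x xi * chi xi + b x xi * chi' xi); split.
    move=> x xi; apply: (is_derive_eq (is_deriveM (db x xi) (dchi xi))).
    rewrite -[LHS]/(b x xi * (s * chi' xi) + chi xi * (s * b' x xi)).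
    by ring.
  rewrite (_ : 2 ^+ n.+1 * _ = 2 ^+ n * (2 ^+ d.+1 * (B * A)) + 2 ^+ n * (2 ^+ d.+1 * (B * A))).
    by apply: symcD; exact: IH.
  by rewrite (exprS 2 n); move: (2 ^+ n) (2 ^+ d.+1) => u v; ring.
Qed.

End JointDerivatives.

(** * Hormander symbols, rescaled and truncated *)

Section SymbolBounds.
Variables (R : realType) (d : nat).
Local Notation V := 'rV[R]_d.
Implicit Types (x xi : V) (j k : 'I_d).

Lemma exists_uniform_bound (I : finType) (P : I -> R -> Prop) :
  (forall i, exists C, P i C) -> (forall i C C', C <= C' -> P i C -> P i C') ->
  exists2 C : R, 0 <= C & forall i, P i C.
Proof.
move=> /choice[c Pc] Pmono; exists (\sum_i `|c i|); first exact: sumr_ge0.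
move=> i; apply: Pmono (Pc i); apply: le_trans (ler_norm _) _.
by rewrite (bigD1 i)//= lerDl sumr_ge0.
Qed.

Lemma mseq_single n (k : 'I_n) l : mseq (fun i => if i == k then l else 0%N) = nseq l k.
Proof.
suff H (s : seq 'I_n) : uniq s ->
    flatten [seq nseq (if i == k then l else 0%N) i | i <- s] = if k \in s then nseq l k else [::].
  by rewrite /mseq H ?enum_uniq// mem_enum.
elim: s => //= i s IH /andP[is_ us]; rewrite IH// inE eq_sym.
have [ik|ik]//= := eqVneq k i.
by rewrite -ik in is_ *; rewrite (negbTE is_) cats0.
Qed.

Lemma msize_single n (k : 'I_n) l : msize (fun i => if i == k then l else 0%N) = l.
Proof. by rewrite /msize -big_mkcond big_pred1_eq. Qed.

Lemma mseq0 n : mseq (fun _ : 'I_n => 0%N) = [::].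
Proof. by rewrite /mseq; elim: (enum 'I_n). Qed.

Lemma normr_cRe (z : R[i]) : `|complex.Re z| <= cabs z.
Proof. by rewrite -sqrtr_sqr ler_wsqrtr// lerDl sqr_ge0. Qed.

Lemma normr_cIm (z : R[i]) : `|complex.Im z| <= cabs z.
Proof. by rewrite -sqrtr_sqr ler_wsqrtr// lerDr sqr_ge0. Qed.

(** The bound without derivatives stands apart because for d = 0 there are no directions [k], [j] to
    instantiate the second clause. *)
Definition symbol_bound (m rho : R) N (C : R) (F : 'rV[R]_(d + d) -> R) :=
  (forall x xi, `|F (row_mx x xi)| <= C * (1 + enorm xi) `^ m) /\
  forall l n k j x xi, (l <= N)%N -> (n <= N)%N ->
    `|pdiffs (nseq l (lshift d k) ++ nseq n (@rshift d d j)) F (row_mx x xi)| <=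
    C * (1 + enorm xi) `^ (m - rho * n%:R + rho * l%:R).

(** The multi-indices concentrated in one direction for [x] and one for [xi], of order at most [N],
    are finitely many, so one constant serves them all. *)
Lemma hormander_symbol_bound m rho N a : hormander m rho rho a ->
  exists2 C : R, 0 <= C & symbol_bound m rho N C (cRe (joint a)) /\
                          symbol_bound m rho N C (cIm (joint a)).
Proof.
move=> [_ ha].
have [Cb hb] := ha (fun=> 0%N) (fun=> 0%N).
have [|i C C' CC' hC x xi|C C0 hC] := @exists_uniform_bound
    ('I_N.+1 * 'I_N.+1 * 'I_d * 'I_d)%type (fun i C => forall x xi,
    cabs (cpdiffs (nseq i.1.1.1 (lshift d i.1.2) ++ nseq i.1.1.2 (@rshift d d i.2))
      (joint a) (row_mx x xi)) <=
    C * (1 + enorm xi) `^ (m - rho * i.1.1.2%:R + rho * i.1.1.1%:R)).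
- move=> [[[l n] k] j] /=.
  have [C hC] := ha (fun i => if i == k then l : nat else 0%N)
                    (fun i => if i == j then n : nat else 0%N).
  exists C => x xi; have := hC x xi.
  by rewrite /symb_deriv !mseq_single !msize_single !map_nseq.
- by apply: le_trans (hC x xi) _; rewrite ler_wpM2r// powR_ge0.
have CbC u : Cb * u `^ m <= (C + `|Cb|) * u `^ m.
  by rewrite ler_wpM2r ?powR_ge0// (le_trans (ler_norm Cb))// lerDr.
have CC u e : C * u `^ e <= (C + `|Cb|) * u `^ e.
  by rewrite ler_wpM2r ?powR_ge0// lerDl.
have hbx x xi : cabs (joint a (row_mx x xi)) <= Cb * (1 + enorm xi) `^ m.
  have := hb x xi; rewrite /symb_deriv !mseq0 /= /msize big1// mulr0 subr0 addr0.
  by rewrite /cpdiffs /=; apply: le_trans.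
exists (C + `|Cb|); first by rewrite addr_ge0.
split; split => [x xi|l n k j x xi lN nN].
- exact: le_trans (le_trans (normr_cRe _) (hbx x xi)) (CbC _).
- have := hC (Ordinal (lN : (l < N.+1)%N), Ordinal (nN : (n < N.+1)%N), k, j) x xi.
  move=> h; exact: le_trans (le_trans (normr_cRe _) h) (CC _ _).
- exact: le_trans (le_trans (normr_cIm _) (hbx x xi)) (CbC _).
- have := hC (Ordinal (lN : (l < N.+1)%N), Ordinal (nN : (n < N.+1)%N), k, j) x xi.
  move=> h; exact: le_trans (le_trans (normr_cIm _) h) (CC _ _).
Qed.

(** Both comparisons are required because the exponent may have either sign. *)
Lemma powR_comparable (M t r e E : R) : 1 <= M -> 0 < r -> r <= M * t -> t <= M * r ->
  `|e| <= E -> t `^ e <= M `^ E * r `^ e.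
Proof.
move=> M1 r0 rt tr eE.
have M0 : 0 < M by exact: lt_le_trans M1.
have t0 : 0 < t by rewrite -(pmulr_rgt0 _ M0) (lt_le_trans r0).
apply: (@le_trans _ _ (M `^ `|e| * r `^ e)); last first.
  by rewrite ler_wpM2r ?powR_ge0// ler_powR.
have [e0|e0] := leP 0 e.
  rewrite (ger0_norm e0) -powRM ?(ltW M0) ?(ltW r0)//.
  by apply: ge0_ler_powR; rewrite ?nnegrE ?(ltW t0)// mulr_ge0 ?(ltW M0) ?(ltW r0).
have -> : e = - `|e| by rewrite ltr0_norm// opprK.
rewrite normrN normr_id 2!powRN ler_pdivlMr ?powR_gt0//.
rewrite mulrC ler_pdivrMr ?powR_gt0// -powRM ?(ltW M0) ?(ltW t0)//.
by apply: ge0_ler_powR; rewrite ?nnegrE ?(ltW r0)// mulr_ge0 ?(ltW M0) ?(ltW t0).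
Qed.


Definition admissible s A l n (b : V -> V -> R) :=
  [/\ measurable_fun setT (fun p : LebRd R d * LebRd R d => b p.1 p.2),
      forall xi, dcls s^-1 d.+1 A setT (b ^~ xi), supported_in l b,
      forall x, continuous (b x) &
      forall j, symc s A l j n.*2 b].

(** With s = r^(-rho) / D, the factor s^(l - n) cancels r^(rho (l - n)) exactly. What remains is r^m
    and a power of [D]. *)
Lemma scaled_powR_bound (m rho r D : R) l n N : 0 < r -> 1 <= D -> (n <= N)%N ->
  (r `^ (- rho) / D) ^- n * (r `^ (- rho) / D) ^+ l * r `^ (m - rho * n%:R + rho * l%:R) <=
  D ^+ N * r `^ m.
Proof.
move=> r0 D1 nN; have D0 : 0 < D by exact: lt_le_trans D1.
have rn0 e : r `^ e != 0 by rewrite gt_eqF// powR_gt0.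
have rX (k : nat) : (r `^ (- rho)) ^+ k = r `^ (- (rho * k%:R)).
  by rewrite -powR_mulrn ?powR_ge0// -powRrM mulNr.
have -> : (r `^ (- rho) / D) ^- n * (r `^ (- rho) / D) ^+ l *
    r `^ (m - rho * n%:R + rho * l%:R) = D ^+ n / D ^+ l * r `^ m.
  have rN0 : r != 0 by rewrite gt_eqF.
  rewrite !expr_div_n !rX !powRD ?rN0 ?implybT// !powRN.
  by field; rewrite !expf_neq0 ?rn0// gt_eqF.
rewrite ler_wpM2r ?powR_ge0// ler_pdivrMr ?exprn_gt0//.
apply: (@le_trans _ _ (D ^+ N)); first exact: ler_weXn2l.
by rewrite ler_peMr ?exprn_ge0 ?(ltW D0)// exprn_ege1.
Qed.

Lemma symbol_bound_scaled (m rho C c1 c2 : R) N : 0 <= rho <= 1 -> 0 < c1 -> 0 < c2 -> 0 <= C ->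
  exists2 A : R, 0 <= A & forall F (r : R), symbol_bound m rho N C F -> 1 <= r ->
    let s := r `^ (- rho) / d.+1%:R in
    forall x xi, c1 * r / d.+1%:R / 2 <= `|xi| < (c2 * r) *+ 2 ->
    `|F (row_mx x xi)| <= A * r `^ m /\
    forall l n k j, (l <= N)%N -> (n <= N)%N ->
      `|s ^- n * s ^+ l *
         pdiffs (nseq l (lshift d k) ++ nseq n (@rshift d d j)) F (row_mx x xi)| <= A * r `^ m.
Proof.
move=> /andP[rho0 rho1] c10 c20 C0.
set D : R := d.+1%:R; have D1 : 1 <= D by rewrite ler1n.
have D0 : 0 < D by exact: lt_le_trans D1.
(* [M] bounds the ratio of [r] and 1 + |xi| in both directions on the enlarged annulus. [E] bounds
   all exponents that occur, as 0 <= rho <= 1. *)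
pose M : R := 1 + 2 * D / c1 + 2 * D * c2; pose E : R := `|m| + N%:R + N%:R.
have M1 : 1 <= M.
  have u1 : 0 <= 2 * D / c1 by rewrite divr_ge0 ?mulr_ge0 ?(ltW D0) ?(ltW c10).
  have u2 : 0 <= 2 * D * c2 by rewrite !mulr_ge0 ?(ltW D0) ?(ltW c20).
  by rewrite /M; lra.
have ME0 : 0 <= C * M `^ E by rewrite mulr_ge0 ?powR_ge0.
exists (C * M `^ E * D ^+ N); first by rewrite mulr_ge0// exprn_ge0// ltW.
move=> F r [F0 FN] r1 s x xi /andP[pxi xiq].
have r0 : 0 < r by exact: lt_le_trans r1.
have tM e : `|e| <= E -> (1 + enorm xi) `^ e <= M `^ E * r `^ e.
  apply: powR_comparable => //.
    have h := norm_le_enorm xi; have e0 := enorm_ge0 xi.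
    apply: (@le_trans _ _ (2 * D / c1 * (1 + enorm xi))).
      have -> : r = 2 * D / c1 * (c1 * r / D / 2) by field; rewrite !gt_eqF.
      rewrite ler_wpM2l// ?divr_ge0 ?mulr_ge0 ?(ltW D0) ?(ltW c10)//.
      by rewrite (le_trans pxi)// (le_trans h)// lerDr.
    rewrite ler_wpM2r ?addr_ge0// /M.
    have u2 : 0 <= 2 * D * c2 by rewrite !mulr_ge0 ?(ltW D0) ?(ltW c20).
    by lra.
  have h := enorm_le_norm xi.
  have u1 : 0 <= 2 * D / c1 * r by rewrite mulr_ge0 ?divr_ge0 ?mulr_ge0 ?(ltW D0) ?(ltW c10) ?(ltW r0).
  have h2 : D * `|xi| <= D * ((c2 * r) *+ 2) by rewrite ler_wpM2l// ltW.
  rewrite /M; rewrite mulr2n in h2; rewrite -/D in h.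
  have -> : (1 + 2 * D / c1 + 2 * D * c2) * r = r + 2 * D / c1 * r + 2 * (D * (c2 * r)).
    by ring.
  by rewrite mulrDr in h2; lra.
have n0 (k : nat) : (k <= N)%N -> rho * k%:R <= N%:R.
  move=> kN; apply: (@le_trans _ _ (1 * k%:R)); first by rewrite ler_wpM2r.
  by rewrite mul1r ler_nat.
split.
  apply: le_trans (F0 x xi) _; rewrite -mulrA -mulrA ler_wpM2l//.
  have mE : `|m| <= E by rewrite /E -addrA lerDl addr_ge0.
  apply: le_trans (tM m mE) _. rewrite ler_wpM2l ?powR_ge0//.
  by rewrite ler_peMl ?powR_ge0// exprn_ege1.
move=> l n k j lN nN.
have s0 : 0 < s by rewrite divr_gt0 ?powR_gt0.
have sp : 0 <= s ^- n * s ^+ l by rewrite mulr_ge0 ?invr_ge0 ?exprn_ge0 ?(ltW s0).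
rewrite normrM (ger0_norm sp).
have eE : `|m - rho * n%:R + rho * l%:R| <= E.
  have := n0 _ lN; have := n0 _ nN.
  have : 0 <= rho * n%:R by rewrite mulr_ge0.
  have : 0 <= rho * l%:R by rewrite mulr_ge0.
  rewrite /E; move: (rho * n%:R) (rho * l%:R) => u v u0 v0 uN vN.
  apply: (le_trans (ler_normD _ _)); rewrite (ger0_norm u0) lerD//.
  by apply: (le_trans (ler_normB _ _)); rewrite (ger0_norm v0) lerD.
apply: le_trans (ler_wpM2l sp (FN l n k j x xi lN nN)) _.
apply: (@le_trans _ _ (C * M `^ E * (s ^- n * s ^+ l * r `^ (m - rho * n%:R + rho * l%:R)))).
  rewrite (_ : s ^- n * s ^+ l * (C * _) = C * (s ^- n * s ^+ l) * (1 + enorm xi) `^ (m - rho * n%:R + rho * l%:R)).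
    rewrite (_ : C * M `^ E * _ = C * (s ^- n * s ^+ l) * (M `^ E * r `^ (m - rho * n%:R + rho * l%:R))).
      by rewrite ler_wpM2l ?tM// mulr_ge0.
    by move: (s ^- n) (s ^+ l) => u v; ring.
  by move: (s ^- n) (s ^+ l) => u v; ring.
by rewrite -[leRHS]mulrA ler_wpM2l// scaled_powR_bound.
Qed.

(** Derivatives of order d+1 in [x] serve the decay kernel and of order 2n in [xi] the powers in the
    weight, whence the maximum. *)
Lemma truncated_symbol (m rho C c1 c2 : R) n :
  0 <= rho <= 1 -> 0 < c1 -> 0 < c2 -> 0 <= C -> exists2 B : R, 0 <= B &
  forall F (r : R), smooth F -> symbol_bound m rho (maxn d.+1 n.*2) C F -> 1 <= r ->
    admissible (r `^ (- rho) / d.+1%:R) (B * r `^ m) ((c2 * r) *+ 2) n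
      (fun x xi => F (row_mx x xi) * cutoff n.*2 (c1 * r / d.+1%:R) (c2 * r) xi).
Proof.
move=> rho01 c10 c20 C0.
have [A A0 FA] := symbol_bound_scaled m (maxn d.+1 n.*2) rho01 c10 c20 C0.
pose D : R := d.+1%:R; have D1 : 1 <= D by rewrite ler1n.
have D0 : 0 < D by exact: lt_le_trans D1.
(* The rates of the cutoff are (2 D / c1) r^(-1) and r^(-1) / c2, and r^(-1) <= D s. *)
pose K : R := 1 + 2 * D ^+ 2 / c1 + D / c2.
have u1 : 0 <= 2 * D ^+ 2 / c1 by rewrite divr_ge0 ?mulr_ge0 ?exprn_ge0 ?(ltW D0) ?(ltW c10).
have u2 : 0 <= D / c2 by rewrite divr_ge0 ?(ltW D0) ?(ltW c20).
have K1 : 1 <= K by rewrite /K; lra.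
have [Bc Bc0 cutB] := @cutoff_dcls R d n.*2 K K1.
exists (2 ^+ n.*2 * (2 ^+ d.+1 * (Bc * A))); first by rewrite !mulr_ge0 ?exprn_ge0.
move=> F r sF bF r1; have r0 : 0 < r by exact: lt_le_trans r1.
have := FA F r bF r1; rewrite -/D.
set s := _ / D; set p := _ / D; set q := c2 * r => /= FS.
have s0 : 0 < s by rewrite divr_gt0 ?powR_gt0.
have p0 : 0 < p by rewrite divr_gt0 ?mulr_gt0.
have q0 : 0 < q by rewrite mulr_gt0.
(* Here [rho <= 1] and [1 <= r] enter: the cutoff varies at scale [r], no finer than the scale r^rho
   of the symbol. *)
have r_rho : r^-1 <= r `^ (- rho).
  rewrite powRN lef_pV2 ?posrE ?powR_gt0//.
  case/andP: rho01 => _ rho1.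
  by have := ler_powR r1 rho1; rewrite powRr1// ltW.
have Ks (t : R) : 0 <= t -> t * D <= K -> t * r^-1 <= K * s.
  move=> t0 tK; apply: (@le_trans _ _ (t * D * s)); last by rewrite ler_wpM2r// ltW.
  rewrite (_ : t * D * s = t * r `^ (- rho)); first by rewrite ler_wpM2l.
  by rewrite /s; field; rewrite gt_eqF.
have pK : (p / 2)^-1 <= K * s.
  rewrite (_ : (p / 2)^-1 = 2 * D / c1 * r^-1).
    apply: Ks; first by rewrite divr_ge0 ?mulr_ge0 ?(ltW D0) ?(ltW c10).
    have -> : 2 * D / c1 * D = 2 * D ^+ 2 / c1 by field; rewrite gt_eqF.
    by rewrite /K; lra.
  by rewrite /p; field; rewrite !gt_eqF.
have qK : q^-1 <= K * s.
  rewrite (_ : q^-1 = c2^-1 * r^-1); last by rewrite /q invfM.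
  apply: Ks; first by rewrite invr_ge0 ltW.
  by rewrite mulrC -/D /K; lra.
have cutd := cutB p q s p0 q0 s0 pK qK.
set S := [set xi : V | p / 2 <= `|xi| < q *+ 2] in cutd.
have Sl : S `<=` [set xi : V | `|xi| < q *+ 2] by move=> xi /= /andP[].
have {}FS xi : S xi -> forall x, `|F (row_mx x xi)| <= A * r `^ m /\
    forall l n0 k j, (l <= maxn d.+1 n.*2)%N -> (n0 <= maxn d.+1 n.*2)%N ->
      `|s ^- n0 * s ^+ l *
         pdiffs (nseq l (lshift d k) ++ nseq n0 (@rshift d d j)) F (row_mx x xi)| <= A * r `^ m.
  by move=> Sxi x; exact: (FS x xi Sxi).
have [ccut cutBc cutS djcut] := cutd.
have cF := smooth_continuous sF.
have A'0 : 0 <= A * r `^ m by rewrite mulr_ge0 ?powR_ge0.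
have s0' : s != 0 by rewrite gt_eqF.
have EB : 2 ^+ n.*2 * (2 ^+ d.+1 * (Bc * A)) * r `^ m =
    2 ^+ n.*2 * (2 ^+ d.+1 * (Bc * (A * r `^ m))).
  by move: (2 ^+ n.*2) (2 ^+ d.+1) => u v; ring.
rewrite EB; split.
- exact: (measurable_funM (measurable_joint cF) (measurable_comp2 (continuous_measurable ccut))).
- move=> xi; have [Sxi|Sxi] := pselect (S xi); last first.
    rewrite (_ : (fun x => _) = fun=> 0); last by apply/funext => x; rewrite cutS ?mulr0.
    apply: le_dcls (@dcls_cst R d s^-1 d.+1 0) => //.
    by rewrite normr0 !mulr_ge0 ?exprn_ge0 ?powR_ge0.
  rewrite (_ : (fun x => _) = fun x => cutoff n.*2 p q xi * (1 * pdiffs [::] F (row_mx x xi)));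
    last by apply/funext => x; rewrite mulrC mul1r.
  apply: le_dcls (dclsZ _ (@dcls_joint_l _ _ s 1 (A * r `^ m) [::] F xi sF s0' _ _)) => //.
  + apply: (@le_trans _ _ (2 ^+ d.+1 * (Bc * (A * r `^ m)))).
      by rewrite ler_wpM2l ?exprn_ge0// ler_wpM2r.
    by rewrite ler_peMl ?exprn_ege1 ?ler1n ?mulr_ge0 ?exprn_ge0 ?powR_ge0.
  + by move=> x; rewrite mul1r; exact: (FS xi Sxi x).1.
  + move=> i k x id.
    have iN : (i <= maxn d.+1 n.*2)%N by rewrite (leq_trans id)// leq_maxl.
    have := (FS xi Sxi x).2 i 0%N k k iN isT.
    by rewrite expr0 invr1.
- by move=> x xi xil; rewrite cutS ?mulr0// => /Sl.
- move=> x xi; exact: (cvgM (@continuous_joint_r _ _ _ x cF xi) (ccut xi)).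
move=> j; apply: (symcM A'0 Sl _ (djcut j)).
rewrite (_ : (fun x xi => _) =
    fun x xi => s ^- 0 * pdiffs (nseq 0 (@rshift d d j)) F (row_mx x xi)); last first.
  by apply/funext => x; apply/funext => xi; rewrite expr0 invr1 mul1r.
apply: (@prec_joint _ _ s (A * r `^ m) j S F n.*2 0 n.*2 sF s0' (leqnn _)).
move=> l n0 k x xi ld n0N Sxi; apply: (FS xi Sxi x).2; first by rewrite (leq_trans ld)// leq_maxl.
by rewrite (leq_trans n0N)// leq_maxr.
Qed.

End SymbolBounds.

(** * Schwartz functions and the Fourier transform in real form *)

Section SchwartzFourier.
Variables (R : realType) (d : nat).
Local Notation V := 'rV[R]_d.
Local Notation L := (LebRd R d).
Local Notation lam := (@lebRd R d).
Implicit Types (f : V -> R[i]) (b : V -> V -> R) (v : V -> R) (x xi : V).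

(** The sup norm is the modulus of a single coordinate, so the monomials x_j^n suffice; the bound
    without monomial covers x = 0. *)
Lemma schwartz_norm_decay f n : schwartz f ->
  exists C : R, forall x, `|x| ^+ n * cabs (f x) <= C.
Proof.
move=> [_ fdec].
have fE x : cpdiffs (mseq (fun=> 0%N)) f x = f x by rewrite mseq0 /cpdiffs /= /cRe /cIm; case: (f x).
have [C0 hC0] := fdec (fun=> 0%N) (fun=> 0%N).
have {}hC0 x : cabs (f x) <= C0.
  by have := hC0 x; rewrite fE /mono big1 ?normr1 ?mul1r.
have [|i C C' CC' h x|C C00 hC] := @exists_uniform_bound R 'I_d
    (fun j C => forall x, `|x 0 j| ^+ n * cabs (f x) <= C).
- move=> j; have [C hC] := fdec (fun i => if i == j then n else 0%N) (fun=> 0%N).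
  exists C => x; have := hC x; rewrite fE /mono (bigD1 j)//= eqxx big1 ?mulr1 ?normrX//.
  by move=> i /negbTE ->; rewrite expr0.
- exact: le_trans (h x) CC'.
exists (C + C0) => x; have [->|[j xj]] := rV_norm_attained x.
  apply: (@le_trans _ _ (1 * cabs (f 0))).
    by rewrite ler_wpM2r ?sqrtr_ge0// normr0 expr0n; case: n {hC} => //=.
  by rewrite mul1r (le_trans (hC0 _))// lerDr.
by rewrite xj (le_trans (hC j x))// lerDl (le_trans _ (hC0 x))// sqrtr_ge0.
Qed.

Lemma schwartz_rapid f : schwartz f -> rapid (cRe f) /\ rapid (cIm f).
Proof.
move=> sf; have [[s1 s2] _] := sf.
have m1 := continuous_measurable (smooth_continuous s1).
have m2 := continuous_measurable (smooth_continuous s2).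
split; split; [exact: m1| |exact: m2|].
all: move=> n; have [C hC] := schwartz_norm_decay n sf; exists C => x; apply: le_trans (hC x).
  by rewrite ler_wpM2l ?exprn_ge0// normr_cRe.
by rewrite ler_wpM2l ?exprn_ge0// normr_cIm.
Qed.

Lemma Rintegral_combine v1 v2 al1 al2 (c1 c2 : R) xi : Rintegrable lam v1 -> Rintegrable lam v2 ->
  \int[lam]_y (c1 * (osc xi al1 y * v1 y) + c2 * (osc xi al2 y * v2 y)) =
  c1 * vhat v1 al1 xi + c2 * vhat v2 al2 xi.
Proof.
move=> i1 i2.
have o (v : V -> R) al (vi : Rintegrable lam v) : Rintegrable lam (fun y => osc xi al y * v y).
  by apply: (osc_comp_int _ _ vi (f := id)) => i; exact: measurable_coord.
rewrite (RintegralD measurableT (RintegrableZ c1 (o _ al1 i1)) (RintegrableZ c2 (o _ al2 i2))).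
by rewrite (@RintegralZl _ L R lam setT _ c1 measurableT (o _ al1 i1))
  (@RintegralZl _ L R lam setT _ c2 measurableT (o _ al2 i2)).
Qed.

Lemma fourier_vhat f xi : rapid (cRe f) -> rapid (cIm f) ->
  fourier f xi = ((2 * pi) ^- d * (vhat (cRe f) 0 xi + vhat (cIm f) (- (pi / 2)) xi) +i*
    ((2 * pi) ^- d * (vhat (cIm f) 0 xi - vhat (cRe f) (- (pi / 2)) xi)))%C.
Proof.
move=> /rapid_int i1 /rapid_int i2.
rewrite /fourier /cint /cRe /cIm /=.
have sinE (y : V) : osc xi (- (pi / 2)) y = sin (dotv y xi).
  by rewrite /osc cosBpihalf.
have -> : (fun y : V => complex.Re (expi (- dotv y xi) * f y)) =
    fun y => 1 * (osc xi 0 y * cRe f y) + 1 * (osc xi (- (pi / 2)) y * cIm f y).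
  apply/funext => y; rewrite sinE /osc addr0 /cRe /cIm /expi cosN sinN.
  by case: (f y) => u v /=; ring.
have -> : (fun y : V => complex.Im (expi (- dotv y xi) * f y)) =
    fun y => 1 * (osc xi 0 y * cIm f y) + (-1) * (osc xi (- (pi / 2)) y * cRe f y).
  apply/funext => y; rewrite sinE /osc addr0 /cRe /cIm /expi cosN sinN.
  by case: (f y) => u v /=; ring.
rewrite (Rintegral_combine _ _ _ _ _ i1 i2) (Rintegral_combine _ _ _ _ _ i2 i1).
apply/eqP; rewrite eq_complex /=; apply/andP; split; apply/eqP; ring.
Qed.

End SchwartzFourier.

(** * The pseudodifferential operator as a sum of real operators *)

Section PsidoDecomposition.
Variables (R : realType) (d : nat).
Local Notation V := 'rV[R]_d.
Local Notation L := (LebRd R d).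
Local Notation lam := (@lebRd R d).
Implicit Types (f : V -> R[i]) (a : V -> V -> R[i]) (b : V -> V -> R) (v : V -> R) (x xi : V).

Definition psi_integrand b v al x xi : R := b x xi * \int[lam]_y (osc xi al (x - y) * v y).

Lemma psi_integrand_int l (s A : R) b v al x :
  measurable_fun setT (fun p : L * L => b p.1 p.2) ->
  (forall xi, dcls s^-1 d.+1 A setT (b ^~ xi)) -> supported_in l b -> Rintegrable lam v ->
  Rintegrable lam (psi_integrand b v al x).
Proof.
move=> mb bA bl vi.
have i0 := wave_int mb bA (cut_int l 0 vi) al x.
have i1 := wave_int mb bA (cut_int l (- (pi / 2)) vi) (al - pi / 2) x.
have := RintegrableD i0 i1; congr (Rintegrable lam _); apply/funext => xi.
rewrite /psi_integrand psi_inner// mulrDr; congr (_ + _).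
  by rewrite [RHS]mulrCA (mul_cut _ _ _ _ bl) oscC.
by rewrite [RHS]mulrCA (mul_cut _ _ _ _ bl) oscC.
Qed.

(* Real part ([be = 0]) and imaginary part ([be = - pi / 2]) of
   [e^{i (x - y).xi} (b1 + i b2) (v1 + i v2)], integrated over [y]. *)
Definition psi4_integrand b1 b2 v1 v2 be x xi : R :=
  psi_integrand b1 v1 be x xi + psi_integrand b1 v2 (be + pi / 2) x xi +
  (psi_integrand b2 v1 (be + pi / 2) x xi + psi_integrand b2 v2 (be + pi) x xi).

(** A phase shift by pi / 2 is multiplication by i, so the shift by pi carries the sign of i * i in
    the term with [b2] and [v2]. *)
Lemma psi4_integrandE b1 b2 v1 v2 be x xi : Rintegrable lam v1 -> Rintegrable lam v2 ->
  psi4_integrand b1 b2 v1 v2 be x xi =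
  b1 x xi * (cos (dotv x xi + be) * (vhat v1 0 xi + vhat v2 (- (pi / 2)) xi) -
             sin (dotv x xi + be) * (vhat v2 0 xi - vhat v1 (- (pi / 2)) xi)) -
  b2 x xi * (sin (dotv x xi + be) * (vhat v1 0 xi + vhat v2 (- (pi / 2)) xi) +
             cos (dotv x xi + be) * (vhat v2 0 xi - vhat v1 (- (pi / 2)) xi)).
Proof.
move=> i1 i2; rewrite /psi4_integrand /psi_integrand !psi_inner//.
rewrite (_ : be + pi - pi / 2 = be + pi / 2); last by field.
rewrite addrK /osc !(addrA _ be) cosBpihalf cosDpihalf cosDpi.
by ring.
Qed.

(** The symbols are compared only after multiplication by the Fourier transform of [f], which lets
    [b1], [b2] be truncations of the parts of [a]. *)
Lemma psido_integrand a f b1 b2 x xi : rapid (cRe f) -> rapid (cIm f) ->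
  (a x xi * fourier f xi = (b1 x xi +i* b2 x xi) * fourier f xi)%C ->
  (expi (dotv x xi) * a x xi * fourier f xi =
   ((2 * pi) ^- d * psi4_integrand b1 b2 (cRe f) (cIm f) 0 x xi) +i*
   ((2 * pi) ^- d * psi4_integrand b1 b2 (cRe f) (cIm f) (- (pi / 2)) x xi))%C.
Proof.
move=> r1 r2 E; rewrite -mulrA E fourier_vhat//.
have [i1 i2] := (rapid_int r1, rapid_int r2).
rewrite !psi4_integrandE// addr0 cosBpihalf sinBpihalf /expi.
by apply/eqP; rewrite eq_complex /=; apply/andP; split; apply/eqP; ring.
Qed.

Definition psi4 b1 b2 v1 v2 be x : R :=
  psi b1 v1 be x + psi b1 v2 (be + pi / 2) x +
  (psi b2 v1 (be + pi / 2) x + psi b2 v2 (be + pi) x).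

Section Admissible.
Variables (s A l : R) (n : nat) (b1 b2 : V -> V -> R).
Hypotheses (ab1 : admissible s A l n b1) (ab2 : admissible s A l n b2).

Lemma Rintegral_psi4 v1 v2 be x : Rintegrable lam v1 -> Rintegrable lam v2 ->
  \int[lam]_xi psi4_integrand b1 b2 v1 v2 be x xi = psi4 b1 b2 v1 v2 be x /\
  Rintegrable lam (psi4_integrand b1 b2 v1 v2 be x).
Proof.
move=> i1 i2; have [m1 d1 l1 _ _] := ab1; have [m2 d2 l2 _ _] := ab2.
have p11 := psi_integrand_int be x m1 d1 l1 i1.
have p12 := psi_integrand_int (be + pi / 2) x m1 d1 l1 i2.
have p21 := psi_integrand_int (be + pi / 2) x m2 d2 l2 i1.
have p22 := psi_integrand_int (be + pi) x m2 d2 l2 i2.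
split; last exact: RintegrableD (RintegrableD p11 p12) (RintegrableD p21 p22).
by rewrite /psi4 (RintegralD measurableT (RintegrableD p11 p12) (RintegrableD p21 p22))
  (RintegralD measurableT p11 p12) (RintegralD measurableT p21 p22).
Qed.

Lemma psido_psi4 a f x : rapid (cRe f) -> rapid (cIm f) ->
  (forall xi, a x xi * fourier f xi = (b1 x xi +i* b2 x xi)%C * fourier f xi) ->
  psido a f x = (((2 * pi) ^- d * psi4 b1 b2 (cRe f) (cIm f) 0 x) +i*
                 ((2 * pi) ^- d * psi4 b1 b2 (cRe f) (cIm f) (- (pi / 2)) x))%C.
Proof.
move=> r1 r2 E; have [i1 i2] := (rapid_int r1, rapid_int r2).
rewrite /psido /cint; under eq_fun do rewrite (psido_integrand r1 r2 (E _)).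
have [e0 p0] := Rintegral_psi4 0 x i1 i2.
have [e1 p1] := Rintegral_psi4 (- (pi / 2)) x i1 i2.
rewrite -e0 -e1 -(@RintegralZl _ L R lam setT _ ((2 * pi) ^- d) measurableT p0).
by rewrite -(@RintegralZl _ L R lam setT _ ((2 * pi) ^- d) measurableT p1).
Qed.

Lemma measurable_psi4 v1 v2 be : Rintegrable lam v1 -> Rintegrable lam v2 ->
  measurable_fun setT (psi4 b1 b2 v1 v2 be : L -> R).
Proof.
move=> i1 i2; have [m1 d1 l1 _ _] := ab1; have [m2 d2 l2 _ _] := ab2.
exact: (measurable_funD
  (measurable_funD (measurable_psi be m1 d1 l1 i1) (measurable_psi (be + pi / 2) m1 d1 l1 i2))
  (measurable_funD (measurable_psi (be + pi / 2) m2 d2 l2 i1) (measurable_psi (be + pi) m2 d2 l2 i2))).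
Qed.

End Admissible.
End PsidoDecomposition.

(** * The local bound for the pseudodifferential operator *)

Section LocalBound.
Variables (R : realType) (d : nat).
Local Notation V := 'rV[R]_d.
Local Notation L := (LebRd R d).
Local Notation lam := (@lebRd R d).
Implicit Types (f : V -> R[i]) (a : V -> V -> R[i]) (b : V -> V -> R) (v : V -> R) (x xi : V).

Lemma energyD_le z s F G (X : \bar R) :
  measurable_fun setT (F : L -> R) -> measurable_fun setT (G : L -> R) ->
  (energy z s F <= X)%E -> (energy z s G <= X)%E ->
  (energy z s (fun x => F x + G x)%R <= 4%:E * X)%E.
Proof.
move=> mF mG FX GX; apply: le_trans (energyD z s mF mG) _.
have two : (0 <= 2%:E :> \bar R)%E by rewrite lee_fin.
apply: le_trans (leeD (lee_wpmul2l two FX) (lee_wpmul2l two GX)) _.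
by rewrite -(ge0_muleDl X two two) -EFinD -natrD.
Qed.

Lemma cabs_sqr (u : R[i]) : cabs u ^+ 2 = complex.Re u ^+ 2 + complex.Im u ^+ 2.
Proof. by rewrite sqr_sqrtr// addr_ge0 ?sqr_ge0. Qed.

Lemma measurable_cabs_sqr f : measurable_fun setT (cRe f : L -> R) ->
  measurable_fun setT (cIm f : L -> R) ->
  measurable_fun setT ((fun x => cabs (f x) ^+ 2) : L -> R).
Proof.
move=> m1 m2; rewrite (_ : (fun x => _) = fun x => cRe f x ^+ 2 + cIm f x ^+ 2).
  exact: (measurable_funD (measurable_funX 2 m1) (measurable_funX 2 m2)).
by apply/funext => x; rewrite cabs_sqr.
Qed.

Lemma normalisation_le1 : `|(2 * pi : R) ^- d| <= 1.
Proof.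
have p1 : 1 <= 2 * pi :> R by have := pi_ge2 R; lra.
rewrite ger0_norm ?invr_ge0 ?exprn_ge0 ?(le_trans _ p1)//.
by rewrite invf_le1 ?exprn_ege1// exprn_gt0// (lt_le_trans _ p1).
Qed.

(** The real and the imaginary part are each a sum of four [psi]; two rounds of [energyD_le] cost 4
    * 4 = 16, and adding the two parts gives 32. *)
Lemma psido_local n : exists2 C : R, 0 <= C &
  forall (s A l : R) a f b1 b2 z, 0 < s -> 0 < l ->
  admissible s A l n b1 -> admissible s A l n b2 -> rapid (cRe f) -> rapid (cIm f) ->
  (forall x xi, a x xi * fourier f xi = (b1 x xi +i* b2 x xi)%C * fourier f xi) ->
  measurable_fun setT ((fun x => cabs (psido a f x) ^+ 2) : L -> R) /\
  (\int[lam]_x (\1_[set x : V | `|x - z| < s] x * cabs (psido a f x) ^+ 2)%:E <=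
   (C * A ^+ 2)%:E * \int[lam]_x ((cabs (f x) / weight n s z x) ^+ 2)%:E)%E.
Proof.
have [C C0 loc] := @psi_local R d n.
exists (32 * C); first by rewrite mulr_ge0.
move=> s A l a f b1 b2 z s0 l0 ab1 ab2 r1 r2 E.
have [i1 i2] := (rapid_int r1, rapid_int r2).
set J := (\int[lam]_x ((cabs (f x) / _) ^+ 2)%:E)%E.
have J0 : (0 <= J)%E by apply: integral_ge0 => x _; rewrite lee_fin sqr_ge0.
pose X := ((C * A ^+ 2)%:E * J)%E.
have CA0 : 0 <= C * A ^+ 2 by rewrite mulr_ge0// sqr_ge0.
have locX b v al : admissible s A l n b -> rapid v -> (forall x, `|v x| <= cabs (f x)) ->
    (energy z s (psi b v al) <= X)%E.
  move=> [mb bA bl cb sb] rv vf; apply: le_trans (loc s A l b z v al s0 l0 mb bA bl cb sb rv) _.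
  apply: lee_wpmul2l; first by rewrite lee_fin.
  apply: ge0_le_integralW => x; first by rewrite lee_fin sqr_ge0.
  rewrite lee_fin -[leLHS]real_normK ?num_real// ler_sqr ?nnegrE//; last first.
    by rewrite divr_ge0 ?sqrtr_ge0// (le_trans ler01)// weight_ge1.
  rewrite normrM ler_pM// normfV ger0_norm// (le_trans ler01)// weight_ge1//.
have loc4 be : (energy z s (psi4 b1 b2 (cRe f) (cIm f) be) <= 16%:E * X)%E.
  have [m1 d1 l1 _ _] := ab1; have [m2 d2 l2 _ _] := ab2.
  have q1 := locX b1 (cRe f) be ab1 r1 (fun x => normr_cRe (f x)).
  have q2 := locX b1 (cIm f) (be + pi / 2) ab1 r2 (fun x => normr_cIm (f x)).
  have q3 := locX b2 (cRe f) (be + pi / 2) ab2 r1 (fun x => normr_cRe (f x)).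
  have q4 := locX b2 (cIm f) (be + pi) ab2 r2 (fun x => normr_cIm (f x)).
  have M1 := measurable_psi be m1 d1 l1 i1.
  have M2 := measurable_psi (be + pi / 2) m1 d1 l1 i2.
  have M3 := measurable_psi (be + pi / 2) m2 d2 l2 i1.
  have M4 := measurable_psi (be + pi) m2 d2 l2 i2.
  have := energyD_le (measurable_funD M1 M2) (measurable_funD M3 M4)
    (energyD_le M1 M2 q1 q2) (energyD_le M3 M4 q3 q4).
  by rewrite muleA -EFinM -natrM.
have mpsi be := measurable_psi4 ab1 ab2 be i1 i2.
have psidoE x := psido_psi4 ab1 ab2 r1 r2 (E x).
have mc be : measurable_fun setT
    ((fun x => (2 * pi) ^- d * psi4 b1 b2 (cRe f) (cIm f) be x) : L -> R).
  exact: (measurable_funM (measurable_cst _) (mpsi be)).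
split.
  apply: measurable_cabs_sqr.
    by rewrite (_ : cRe _ = fun x => (2 * pi) ^- d * psi4 b1 b2 (cRe f) (cIm f) 0 x);
      [exact: mc|apply/funext => x; rewrite /cRe psidoE].
  by rewrite (_ : cIm _ = fun x => (2 * pi) ^- d * psi4 b1 b2 (cRe f) (cIm f) (- (pi / 2)) x);
    [exact: mc|apply/funext => x; rewrite {1}/cIm psidoE].
have locc be : (energy z s (fun x => (2 * pi) ^- d * psi4 b1 b2 (cRe f) (cIm f) be x)%R
    <= 16%:E * X)%E.
  apply: le_trans (loc4 be); apply: (energyM_le (mpsi be)) => x _.
  exact: normalisation_le1.
rewrite (_ : \int[lam]_x _ = energy z s (fun x => (2 * pi) ^- d * psi4 b1 b2 (cRe f) (cIm f) 0 x)%R +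
   energy z s (fun x => (2 * pi) ^- d * psi4 b1 b2 (cRe f) (cIm f) (- (pi / 2)) x)%R)%E; last first.
  rewrite /energy -(ge0_integralD lam measurableT _ (energy_meas z s (mc 0)) _
    (energy_meas z s (mc (- (pi / 2)))));
    try by move=> x _; rewrite lee_fin mulr_ge0// sqr_ge0.
  by apply: eq_integral => x _; rewrite cabs_sqr psidoE /= mulrDr EFinD.
apply: le_trans (leeD (locc _) (locc _)) _.
have p16 : (0 <= 16%:E :> \bar R)%E by rewrite lee_fin.
rewrite -(ge0_muleDl X p16 p16) -EFinD -natrD /X muleA -EFinM mulrA.
exact: lexx.
Qed.

End LocalBound.

(** * Comparison with the averaging operator [Aop] *)

Section ScaleIntegral.
Import HBNNSimple.
Context dsp (T : measurableType dsp) (R : realType) (mu : {measure set T -> \bar R}).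

(** A simple function below [c%:E * g], divided by [c], lies below [g]; so no measurability of [g]
    is involved, and the integrand of [Aop] is allowed. *)
Lemma integralZl_le (c : R) (g : T -> \bar R) : 0 <= c -> (forall x, 0 <= g x)%E ->
  (\int[mu]_x (c%:E * g x) <= c%:E * \int[mu]_x g x)%E.
Proof.
rewrite le_eqVlt => /predU1P[<- g0|c0 g0].
  rewrite mul0e; under eq_integral do rewrite mul0e.
  by rewrite integral0.
rewrite ge0_integralTE//; last by move=> x; rewrite mule_ge0// lee_fin ltW.
apply: ge_ereal_sup => _ [h hg <-].
have ci0 : 0 <= c^-1 by rewrite invr_ge0 ltW.
have mh : measurable_fun setT (fun x : T => (h x)%:E) by exact/measurable_EFinP.
have h0 (x : T) : (0 <= (h x)%:E)%E by rewrite lee_fin.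
have -> : sintegral mu h = (\int[mu]_x (c * (c^-1 * h x))%:E)%E.
  transitivity (\int[mu]_x (h x)%:E)%E.
    by rewrite integral_nnsfun// patch_setT.
  by apply: eq_integral => x _; rewrite mulrA divff ?mul1r// gt_eqF.
have mch : measurable_fun setT (fun x : T => (c^-1 * h x)%:E).
  by apply/measurable_EFinP; apply: measurable_funM; [exact: measurable_cst|exact/measurable_EFinP].
have ch0 (x : T) : (0 <= (c^-1 * h x)%:E)%E by rewrite lee_fin mulr_ge0.
under eq_integral do rewrite EFinM.
rewrite (ge0_integralZl_EFin mu measurableT (fun x _ => ch0 x) mch (ltW c0)).
apply: lee_wpmul2l; first by rewrite lee_fin ltW.
apply: ge0_le_integralW => // x.
have := lee_wpmul2l (_ : (0 <= c^-1%:E)%E) (hg x); rewrite lee_fin => /(_ ci0).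
by rewrite muleA -!EFinM mulVf ?mul1e// gt_eqF.
Qed.

End ScaleIntegral.

Section Kernel.
Variables (R : realType) (d : nat).
Local Notation V := 'rV[R]_d.
Local Notation L := (LebRd R d).
Local Notation lam := (@lebRd R d).

Lemma exprD1_le (v : R) n : 0 <= v -> (1 + v) ^+ n <= 2 ^+ n * (1 + v ^+ n).
Proof.
move=> v0; have [v1|v1] := leP v 1.
  apply: (@le_trans _ _ (2 ^+ n)); first by rewrite lerXn2r ?nnegrE ?addr_ge0//; lra.
  by rewrite ler_peMr ?exprn_ge0// lerDl exprn_ge0.
apply: (@le_trans _ _ ((2 * v) ^+ n)); first by rewrite lerXn2r ?nnegrE ?addr_ge0 ?mulr_ge0//; lra.
by rewrite exprMn ler_wpM2l ?exprn_ge0// lerDr.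
Qed.

(** With t = |u| / s the left side is at most (1 + t^2)^n <= 2^n (1 + t^(2n)), and the coordinate
    attaining the sup norm bounds 1 + t^(2n) by the weight, hence by its square. *)
Lemma kernel_le_weight n (s : R) (u : V) : 0 < s -> (0 < n)%N ->
  (1 + (enorm u / (d.+1%:R * s)) ^+ 2) `^ (n%:R / 2) <= 2 ^+ n * weight n s 0 u ^+ 2.
Proof.
move=> s0 n0; set D : R := d.+1%:R; have D0 : 0 < D by rewrite ltr0n.
pose t := `|u| / s; have t0 : 0 <= t by rewrite divr_ge0// ltW.
have eDt : enorm u / (D * s) <= t.
  rewrite ler_pdivrMr ?mulr_gt0// /t (_ : `|u| / s * (D * s) = D * `|u|).
    exact: enorm_le_norm.
  by field; rewrite gt_eqF.
have e0 : 0 <= enorm u / (D * s) by rewrite divr_ge0 ?enorm_ge0 ?mulr_ge0 ?ltW.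
have et2 : (enorm u / (D * s)) ^+ 2 <= t ^+ 2 by rewrite lerXn2r ?nnegrE.
have w1 := weight_ge1 n s 0 u.
have tw : 1 + (t ^+ 2) ^+ n <= weight n s 0 u.
  have [u0|[j uj]] := rV_norm_attained u.
    by rewrite /t u0 normr0 mul0r expr0n /= expr0n gtn_eqF// addr0 weight_ge1.
  rewrite /weight lerD2l (bigD1 j)//= -exprM mul2n /t uj !mxE subr0 !expr_div_n.
  rewrite -!mul2n !(exprM _ 2 n) real_normK ?num_real// lerDl.
  by apply: sumr_ge0 => i _; rewrite exprM exprn_ge0// sqr_ge0.
apply: (@le_trans _ _ ((1 + t ^+ 2) ^+ n)).
  rewrite -[leRHS]powR_mulrn ?addr_ge0 ?sqr_ge0//.
  apply: (@le_trans _ _ ((1 + t ^+ 2) `^ (n%:R / 2))).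
    by apply: ge0_ler_powR; rewrite ?nnegrE ?lerD2l ?divr_ge0 ?addr_ge0 ?sqr_ge0 ?ler0n.
  apply: ler_powR; first by rewrite lerDl sqr_ge0.
  by rewrite ler_pdivrMr// ler_peMr// ler1n.
apply: le_trans (exprD1_le n (sqr_ge0 t)) _.
rewrite ler_wpM2l ?exprn_ge0// (le_trans tw)// expr2 ler_peMr// (le_trans ler01)//.
Qed.

Lemma ball_sup_ge0 (w : V -> R) (r : R) y : 0 <= r -> (forall x, 0 <= w x) ->
  (0 <= ball_sup w r y)%E.
Proof.
move=> r0 w0; apply: (@le_trans _ _ (w y)%:E); first by rewrite lee_fin.
by apply: ereal_sup_ubound; exists y => //=; rewrite subrr /enorm /dotv big1 ?sqrtr0// => i _;
  rewrite !mxE mul0r.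
Qed.

(** A cube of sup-norm radius [s] lies in the Euclidean ball of radius (d+1) s; the choice of [s] as
    r^(-rho) / (d+1) is made for this inclusion. *)
Lemma cube_sup_le (w : V -> R) (r s : R) z : d.+1%:R * s <= r ->
  (cube_sup w s z <= ball_sup w r z)%E.
Proof.
move=> sr; apply: ge_ereal_sup => _ [x /= xz <-]; apply: ereal_sup_ubound; exists x => //=.
rewrite (le_trans _ sr)// (le_trans (enorm_le_norm _))// ler_wpM2l//.
by rewrite distrC ltW.
Qed.

Lemma weight_shift n (s : R) (z y : V) : weight n s z y = weight n s 0 (y - z).
Proof. by congr (1 + _); apply: eq_bigr => j _; rewrite !mxE subr0. Qed.

End Kernel.

Section WeightedBounds.
Variables (R : realType) (d : nat).
Local Notation V := 'rV[R]_d.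
Local Notation L := (LebRd R d).
Local Notation lam := (@lebRd R d).

(** On the Euclidean annulus the sup norm lies between c1 r / (d+1) and c2 r, where the cutoff is 1;
    these radii are chosen for that. Elsewhere both sides vanish. *)
Lemma truncation_on_support (a : V -> V -> R[i]) f (c1 c2 r : R) n x xi : 0 < c1 -> 0 < c2 -> 0 < r ->
  fourier_supp_annulus f c1 c2 r ->
  let chi := cutoff n (c1 * r / d.+1%:R) (c2 * r) in
  a x xi * fourier f xi =
  (cRe (joint a) (row_mx x xi) * chi xi +i* (cIm (joint a) (row_mx x xi) * chi xi))%C * fourier f xi.
Proof.
move=> c10 c20 r0 fsupp /=; have [->|fxi] := eqVneq (fourier f xi) 0; first by rewrite !mulr0.
have /andP[xi1 xi2] : c1 * r <= enorm xi <= c2 * r by apply: fsupp; exact: subset_closure.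
have D0 : 0 < d.+1%:R :> R by rewrite ltr0n.
rewrite cutoff_eq1 ?divr_gt0 ?mulr_gt0//.
  by rewrite !mulr1 /cRe /cIm /joint row_mxKl row_mxKr; case: (a x xi).
rewrite (le_trans (norm_le_enorm xi) xi2) andbT ler_pdivrMr// [leRHS]mulrC.
exact: le_trans xi1 (enorm_le_norm xi).
Qed.

Lemma weighted_average_bound (s A : R) n (w g f2 : V -> R) :
  0 < s -> (forall x, 0 <= w x) -> measurable_fun setT (w : L -> R) ->
  (forall x, 0 <= g x) -> measurable_fun setT (g : L -> R) ->
  (forall x, 0 <= f2 x) -> measurable_fun setT (f2 : L -> R) -> 0 <= A ->
  (forall z, (\int[lam]_x (\1_[set x : V | (`|x - z| < s)%R] x * g x)%R%:E <=
     A%:E * \int[lam]_x (f2 x * (weight n s 0 (x - z))^-1 ^+ 2)%R%:E)%E) ->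
  ((s ^+ d)%:E * lam [set x : V | (`|x| < 1)%R] * \int[lam]_x (g x * w x)%R%:E <=
   \int[lam]_y ((f2 y)%:E * \int[lam]_z (cube_sup w s z *
      (A * (weight n s 0 (y - z)%R)^-1 ^+ 2)%R%:E)))%E.
Proof.
move=> s0 w0 mw g0 mg f20 mf2 A0 loc.
have cwei := @continuous_weightV R d n s 0.
have ck : continuous (fun u : V => A * (weight n s 0 u)^-1 ^+ 2).
  by move=> u; exact: (cvgM (@cvg_cst _ A _ (nbhs u) _) (cvgM (cwei u) (cwei u))).
have k0 (u : V) : 0 <= A * (weight n s 0 u)^-1 ^+ 2 by rewrite mulr_ge0// sqr_ge0.
apply: (averaging_inequality s0 w0 mw g0 mg f20 mf2 k0 ck) => z.
apply: le_trans (loc z) _.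
have mk : measurable_fun setT (fun x : L => (f2 x * (weight n s 0 ((x : V) - z))^-1 ^+ 2)%:E).
  apply/measurable_EFinP; apply: (measurable_funM mf2).
  have cw : continuous (fun x : V => (weight n s 0 (x - z))^-1).
    rewrite (_ : (fun x => _) = fun x => (weight n s z x)^-1); first exact: continuous_weightV.
    by apply/funext => y; rewrite -weight_shift.
  exact: (measurable_funX 2 (continuous_measurable cw)).
have p (x : L) : (0 <= (f2 x * (weight n s 0 ((x : V) - z))^-1 ^+ 2)%R%:E)%E.
  by rewrite lee_fin mulr_ge0// sqr_ge0.
rewrite -(ge0_integralZl_EFin lam measurableT (fun x _ => p x) mk A0).
apply: ge0_le_integralW => x; first by rewrite mule_ge0.
by rewrite -EFinM lee_fin mulrCA.
Qed.

(** The identity (d+1) s = r^(-rho) matches the arguments of the two kernels. The factor r^(- rho d)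
    undoes the normalisation r^(rho d) in [Aop]; it is later absorbed by the volume of the averaging
    cube. *)
Lemma le_Aop (rho m r s : R) (n : nat) (w : V -> R) y :
  1 <= r -> (0 < n)%N -> (forall x, 0 <= w x) -> s = r `^ (- rho) / d.+1%:R ->
  (\int[lam]_z (cube_sup w s z * (r `^ (2 * m) * (weight n s 0 (y - z)%R)^-1 ^+ 2)%R%:E) <=
   (2 ^+ n * r `^ (- (rho * d%:R)))%R%:E * Aop rho m r n w y)%E.
Proof.
move=> r1 n0 w0 sE; have r0 : 0 < r by exact: lt_le_trans r1.
have D0 : 0 < d.+1%:R :> R by rewrite ltr0n.
have s0 : 0 < s by rewrite sE divr_gt0 ?powR_gt0.
pose H (z : V) := (ball_sup w (r `^ (- rho)) z * (r `^ (rho * d%:R) /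
    (1 + r `^ (2 * rho) * enorm (y - z) ^+ 2) `^ (n%:R / 2))%R%:E)%E.
have H0 z : (0 <= H z)%E.
  by rewrite mule_ge0 ?ball_sup_ge0 ?powR_ge0// lee_fin divr_ge0 ?powR_ge0.
pose c := 2 ^+ n * r `^ (- (rho * d%:R)) * r `^ (2 * m).
have c0 : 0 < c by rewrite !mulr_gt0 ?exprn_gt0 ?powR_gt0.
rewrite /Aop muleA -EFinM -/c; apply: le_trans (integralZl_le lam (ltW c0) H0).
apply: ge0_le_integralW => z.
  by rewrite mule_ge0 ?cube_sup_ge0// lee_fin mulr_ge0 ?powR_ge0 ?sqr_ge0.
rewrite /H muleCA; apply: lee_pmul.
- exact: cube_sup_ge0.
- by rewrite lee_fin mulr_ge0 ?powR_ge0 ?sqr_ge0.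
- by apply: cube_sup_le; rewrite sE mulrC divfK// gt_eqF.
rewrite -EFinM lee_fin; set u := y - z.
have -> : r `^ (2 * rho) * enorm u ^+ 2 = (enorm u / (d.+1%:R * s)) ^+ 2.
  have -> : d.+1%:R * s = r `^ (- rho) by rewrite sE mulrC divfK// gt_eqF.
  rewrite powRN invrK exprMn mulrC; congr (_ * _).
  by rewrite -powR_mulrn ?powR_ge0// -powRrM mulrC.
have ker := kernel_le_weight u s0 n0.
set Q := (1 + _) `^ _ in ker *.
have Q0 : 0 < Q by rewrite powR_gt0// ltr_pwDl// sqr_ge0.
have w1 : 0 < weight n s 0 u by rewrite (lt_le_trans ltr01)// weight_ge1.
rewrite /c powRN.
rewrite (_ : _ * _ * _ * (_ / _) = r `^ (2 * m) * (2 ^+ n / Q)); last first.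
  by field; rewrite !gt_eqF// powR_gt0.
by rewrite ler_wpM2l ?powR_ge0// ler_pdivlMr// exprVn mulrC ler_pdivrMr ?exprn_gt0//.
Qed.

End WeightedBounds.

(** * Assembly of the weighted inequality *)

Theorem theorem4p2 (R : realType) (d : nat) (m rho : R)
  (a : 'rV[R]_d -> 'rV[R]_d -> R[i]) (c1 c2 : R) (N0 : nat) :
  0 <= rho <= 1 -> hormander m rho rho a ->
  0 < c1 -> c1 < c2 -> (d < N0)%N ->
  exists C : R, 0 < C /\
    forall (r : R) (f : 'rV[R]_d -> R[i]) (w : 'rV[R]_d -> R),
      1 <= r -> schwartz f -> fourier_supp_annulus f c1 c2 r ->
      (forall x, 0 <= w x) -> loc_integrable w ->
      (\int[@lebRd R d]_x ((cabs (psido a f x)) ^+ 2 * w x)%R%:E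
        <= C%:E * \int[@lebRd R d]_x (((cabs (f x)) ^+ 2)%R%:E * Aop rho m r N0 w x))%E.
Proof.
move=> rho01 ha c10 c12 dN0.
have c20 : 0 < c2 by exact: lt_trans c12.
have N00 : (0 < N0)%N by exact: leq_ltn_trans dN0.
have [Cs Cs0 [sb1 sb2]] := hormander_symbol_bound (maxn d.+1 N0.*2) ha.
have [B B0 trunc] := @truncated_symbol R d m rho Cs c1 c2 N0 rho01 c10 c20 Cs0.
have [C C0 loc] := @psido_local R d N0.
have [[sm1 sm2] _] := ha.
pose D : R := d.+1%:R; have D0 : 0 < D by rewrite ltr0n.
set lam := @lebRd R d.
have vfin : lam [set x : 'rV[R]_d | `|x| < 1] \is a fin_num.
  have := @lebRd_cube_le R d 0 1 ler01.
  rewrite (_ : [set x : 'rV[R]_d | `|x - 0| < 1] = [set x : 'rV[R]_d | `|x| < 1]); last first.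
    by apply/seteqP; split => x /=; rewrite subr0.
  by move=> h; rewrite ge0_fin_numE// (le_lt_trans h)// ltry.
set v := fine (lam [set x : 'rV[R]_d | `|x| < 1]).
have v0 : 0 <= v by rewrite fine_ge0.
(* [C * B ^+ 2] is the local constant, [2 ^+ N0] compares weight and kernel, and [D ^+ d / v] comes
   from the volume of the averaging cube. Adding 1 ensures positivity, also for v = 0, where the
   quotient is 0 by convention. *)
exists (C * B ^+ 2 * 2 ^+ N0 * D ^+ d / v + 1).
have K0 : 0 <= C * B ^+ 2 * 2 ^+ N0 * D ^+ d.
  by rewrite !mulr_ge0 ?sqr_ge0 ?exprn_ge0 ?(ltW D0).
split; first by rewrite ltr_wpDl// divr_ge0.
move=> r f w r1 sf fsupp w0 [mw _].
have r0 : 0 < r by exact: lt_le_trans r1.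
have [rf1 rf2] := schwartz_rapid sf.
set s := r `^ (- rho) / D; have s0 : 0 < s by rewrite divr_gt0 ?powR_gt0.
have l0 : 0 < (c2 * r) *+ 2 by rewrite mulrn_wgt0// mulr_gt0.
have locz z := loc s (B * r `^ m) _ a f _ _ z s0 l0 (trunc _ r sm1 sb1 r1) (trunc _ r sm2 sb2 r1)
  rf1 rf2 (fun x xi => truncation_on_support a N0.*2 x xi c10 c20 r0 fsupp).
have [mg _] := locz 0.
set I := (\int[lam]_x _)%E; set J := (\int[lam]_x _)%E.
have J0 : (0 <= J)%E.
  apply: integral_ge0 => x _; rewrite mule_ge0 ?lee_fin ?sqr_ge0//.
  rewrite /Aop mule_ge0 ?lee_fin ?powR_ge0//; apply: integral_ge0 => y _.
  by rewrite mule_ge0 ?ball_sup_ge0 ?powR_ge0// lee_fin divr_ge0 ?powR_ge0.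
(* That the unit cube has positive measure is not needed: if it were null, so
   would be every integral. *)
have [v00|vn0] := eqVneq v 0.
  have lam0 : lam [set x : 'rV[R]_d | `|x| < 1] = 0%E by rewrite -(fineK vfin) -/v v00.
  have mgw : measurable_fun setT (fun x : LebRd R d => (cabs (psido a f x) ^+ 2 * w x)%:E).
    by apply/measurable_EFinP; exact: (measurable_funM mg mw).
  have -> : I = 0%E := integral_lebRd_null lam0 mgw.
  by rewrite mule_ge0// lee_fin addr_ge0// divr_ge0.
have vp : 0 < v by rewrite lt_neqAle eq_sym vn0.
(* The truncated symbol has size [B * r^m]; its square produces the factor r^(2m) of [Aop]. *)
pose A := C * (B * r `^ m) ^+ 2.
have A0 : 0 <= A by rewrite mulr_ge0// sqr_ge0.
pose K := C * B ^+ 2 * 2 ^+ N0.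
pose rd := r `^ (- (rho * d%:R)).
have rd0 : 0 < rd by rewrite powR_gt0.
have localz z : (\int[lam]_x (\1_[set x : 'rV[R]_d | (`|x - z| < s)%R] x * cabs (psido a f x) ^+ 2)%R%:E <=
     A%:E * \int[lam]_x (cabs (f x) ^+ 2 * (weight N0 s 0 (x - z))^-1 ^+ 2)%R%:E)%E.
  apply: le_trans (locz z).2 _; apply: lee_wpmul2l; first by rewrite lee_fin.
  apply: ge0_le_integralW => x; first by rewrite lee_fin sqr_ge0.
  by rewrite -weight_shift exprMn.
have := weighted_average_bound s0 w0 mw (fun x => sqr_ge0 (cabs (psido a f x))) mg
  (fun x => sqr_ge0 (cabs (f x))) (measurable_cabs_sqr rf1.1 rf2.1) A0 localz.
have AopK y : (0 <= Aop rho m r N0 w y)%E.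
  rewrite /Aop mule_ge0 ?lee_fin ?powR_ge0//; apply: integral_ge0 => z _.
  by rewrite mule_ge0 ?ball_sup_ge0 ?powR_ge0// lee_fin divr_ge0 ?powR_ge0.
have AopA y : (\int[lam]_z (cube_sup w s z * (A * (weight N0 s 0 (y - z)%R)^-1 ^+ 2)%R%:E) <=
    (K * rd)%:E * Aop rho m r N0 w y)%E.
  have -> : (K * rd)%:E = ((C * B ^+ 2)%:E * (2 ^+ N0 * rd)%:E)%E.
    by rewrite -EFinM mulrA.
  rewrite -muleA.
  have CB0 : 0 <= C * B ^+ 2 by rewrite mulr_ge0// sqr_ge0.
  apply: le_trans (lee_wpmul2l _ (le_Aop m y r1 N00 w0 (erefl s))); last by rewrite lee_fin.
  have p z : (0 <= cube_sup w s z * (r `^ (2 * m) * (weight N0 s 0 (y - z)%R)^-1 ^+ 2)%R%:E)%E.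
    by rewrite mule_ge0 ?cube_sup_ge0// lee_fin mulr_ge0 ?powR_ge0 ?sqr_ge0.
  apply: le_trans (integralZl_le lam CB0 p).
  apply: ge0_le_integralW => z.
    by rewrite mule_ge0 ?cube_sup_ge0// lee_fin mulr_ge0 ?sqr_ge0.
  rewrite muleCA -EFinM /A exprMn -(powR_mulrn 2 (powR_ge0 r m)) -powRrM (mulrC m).
  by rewrite (_ : (C * B ^+ 2 * _)%R = C * (B ^+ 2 * r `^ (2 * m)) * (weight N0 s 0 (y - z))^-1 ^+ 2)//; ring.
have KJ : (\int[lam]_y ((cabs (f y) ^+ 2)%:E * \int[lam]_z (cube_sup w s z *
      (A * (weight N0 s 0 (y - z)%R)^-1 ^+ 2)%R%:E)) <= (K * rd)%:E * J)%E.
  have Krd0 : 0 <= K * rd by rewrite mulr_ge0 ?mulr_ge0 ?sqr_ge0 ?exprn_ge0 ?(ltW rd0).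
  have p y : (0 <= (cabs (f y) ^+ 2)%:E * Aop rho m r N0 w y)%E.
    by rewrite mule_ge0// lee_fin sqr_ge0.
  apply: le_trans (integralZl_le lam Krd0 p).
  apply: ge0_le_integralW => y.
    rewrite mule_ge0 ?lee_fin ?sqr_ge0//; apply: integral_ge0 => z _.
    by rewrite mule_ge0 ?cube_sup_ge0// lee_fin mulr_ge0 ?sqr_ge0.
  by rewrite muleCA lee_wpmul2l ?lee_fin ?sqr_ge0.
move=> /le_trans/(_ KJ) avg'.
have avg : ((s ^+ d * v)%:E * I <= (K * rd)%:E * J)%E by rewrite EFinM /v (fineK vfin).
(* The volume of the averaging cube carries the same power r^(- rho d) as the bound by [Aop], so [r]
   disappears from the final constant. *)
have sdE : s ^+ d * v = rd * (v / D ^+ d).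
  rewrite /s expr_div_n -(powR_mulrn d (powR_ge0 r (- rho))) -powRrM mulNr -/rd.
  by field; rewrite expf_neq0// gt_eqF.
have sv0 : 0 < s ^+ d * v by rewrite mulr_gt0 ?exprn_gt0.
apply: (@le_trans _ _ ((s ^+ d * v)^-1%:E * ((s ^+ d * v)%:E * I))%E).
  by rewrite muleA -EFinM mulVf ?gt_eqF// mul1e.
apply: le_trans (lee_wpmul2l _ avg) _; first by rewrite lee_fin invr_ge0 ltW.
rewrite muleA -EFinM; apply: lee_wpmul2r => //; rewrite lee_fin sdE.
rewrite [leLHS](_ : _ = K * D ^+ d / v); first by rewrite /K lerDl.
by field; rewrite expf_neq0 ?gt_eqF.
Qed.
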